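(* Let $n\ge2$, $k\ge1$, let $M^n\hookrightarrow\tilde M^{n+k}$ be an embedded submanifold of a Riemannian manifold, $v$ a vector field on $M$, $p\in M$, with $v$ extended to a neighborhood of $p$ in $\tilde M$ (still denoted $v$). Let $-\tilde\Delta_h$ and $-\Delta_h$ denote the Hodge Laplacians on $\tilde M$ and $M$. Then, evaluating at $p$, $$\begin{aligned}-\tilde\Delta_hv&=-\Delta_hv+2\sum_{l=1}^kW_{N_l}W_{N_l}v-2nW_{\mathbf H}v+\sum_{l=1}^k\delta^{ij}\tilde g(\tilde R(N_l,E_i)v,N_l)E_j\\&\quad+n[\mathbf H,v]-\sum_{l=1}^k\tilde\nabla_{N_l}\tilde\nabla_{N_l}v+\sum_{l=1}^k\tilde\nabla_{\tilde\nabla_{N_l}N_l}v\\&\quad-2\delta^{ij}\mathrm{II}(E_i,\nabla_{E_j}v)-\delta^{ij}(\tilde R(E_j,v)E_i)^\perp+(\widetilde{\mathrm{Ric}}\,v)^\perp,\end{aligned}$$ or equivalently $$\begin{aligned}-\tilde\Delta_hv&=-\Delta_hv+2\sum_{l=1}^kW_{N_l}W_{N_l}v-nW_{\mathbf H}v+\sum_{l=1}^k\delta^{ij}\tilde g(\tilde R(N_l,E_i)v,N_l)E_j\\&\quad+n\tilde\nabla_{\mathbf H}v-\sum_{l=1}^k\tilde\nabla_{N_l}\tilde\nabla_{N_l}v+\sum_{l=1}^k\tilde\nabla_{\tilde\nabla_{N_l}N_l}v\\&\quad-(\operatorname{tr}\nabla^B\mathrm{II})(v)-2\delta^{ij}\mathrm{II}(E_i,\nabla_{E_j}v)+(\widetilde{\mathrm{Ric}}\,v)^\perp.\end{aligned}$$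 In the case of a hypersurface $M^n\hookrightarrow\tilde M^{n+1}$, $$-\tilde\Delta_hv=-\Delta_hv+2s^2v+nH(\tilde\nabla_Nv-sv)+\delta^{ij}\tilde R(N,E_i,v,N)E_j-\tilde\nabla_N\tilde\nabla_Nv+\nabla_{\tilde\nabla_NN}v+\mathcal N_5(v),$$ where $$\begin{aligned}\mathcal N_5(v)&=-\Big(2\sum_i\kappa_i\nabla_iv^i+nv(H)-h(\tilde\nabla_NN,v)\Big)N+2(\widetilde{\mathrm{Ric}}\,v)^\perp\\&=-\Big((\operatorname{div}h)(v)+2\sum_i\kappa_i\nabla_iv^i-h(\tilde\nabla_NN,v)\Big)N+(\widetilde{\mathrm{Ric}}\,v)^\perp.\end{aligned}$$
   Context: Everything is smooth. $M$ carries the induced metric $g$; $\tilde\nabla,\nabla$ are the Levi-Civita connections of $(\tilde M,\tilde g)$ and $(M,g)$. ${}^T,{}^\perp$ are orthogonal projections onto $T_pM$ and $(T_pM)^\perp$. Hodge Laplacian: on 1-forms $-\Delta_h=dd^*+d^*d$ ($d^*$ the formal adjoint of $d$); on vector fields it is defined through the musical isomorphisms, $-\Delta_hv=\big((dd^*+d^*d)v^\flat\big)^\sharp$; similarly $-\tilde\Delta_h$ on $\tilde M$. Frames: $E_1,\dots,E_n$ is a local orthonormal (ON) frame on $M$ near $p$, $N_1,\dots,N_k$ a local ON frame of the normal bundle, extended so that together they form an ON frame of $\tilde M$ in a neighborhood of $p$. For $k=1$, $N=N_1$ is a choice of unit normal and the $E_i$ at $p$ are eigenvectors of the shape operator. Indices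 $i,j$ run over $1,\dots,n$; repeated indices are summed. $\mathrm{II}(X,Y)=(\tilde\nabla_XY)^\perp$; for a normal field $\eta$, $g(W_\eta X,Y)=\tilde g(\eta,\mathrm{II}(X,Y))$, i.e. $W_\eta X=-(\tilde\nabla_X\eta)^T$; $\mathbf H=\frac1n\delta^{ij}\mathrm{II}(E_i,E_j)$ (extended to a neighborhood of $p$ in $[\mathbf H,v]$); $\nabla^\perp_X\eta=(\tilde\nabla_X\eta)^\perp$; $(\nabla^B_XA)(Y,Z)=\nabla^\perp_X(A(Y,Z))-A(\nabla_XY,Z)-A(Y,\nabla_XZ)$ for normal-bundle-valued bilinear maps $A$ on $TM$; $(\operatorname{tr}\nabla^B\mathrm{II})(v)=\delta^{ij}(\nabla^B_{E_i}\mathrm{II})(E_j,v)$. For $k=1$: $h(X,Y)=\tilde g(N,\mathrm{II}(X,Y))$; $g(sX,Y)=h(X,Y)$, so $sX=-\tilde\nabla_XN$; $sE_i=\kappa_iE_i$ at $p$; $H=\frac1n\sum_i\kappa_i$, $\mathbf H=HN$; $(\operatorname{div}h)(v)=\sum_i(\nabla_{E_i}h)(E_i,v)$. $\nabla_iv^j=E_i(v^j)+\Gamma^j_{ik}v^k$ with $\nabla_{E_i}E_k=\Gamma_{ik}^jE_j$; in $\sum_i\kappa_i\nabla_iv^i$, $\nabla_iv^i=g(\nabla_{E_i}v,E_i)$. Curvature convention: $\tilde R(X,Y)Z=\tilde\nabla_X\tilde\nabla_YZ-\tilde\nabla_Y\tilde\nabla_XZ-\tilde\nabla_{[X,Y]}Z$,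 $\tilde R(W,X,Y,Z)=\tilde g(\tilde R(W,X)Y,Z)$, $\widetilde{\mathrm{Ric}}(X,Y)=\sum_\alpha\tilde R(E_\alpha,X,Y,E_\alpha)$ over an ON frame of $\tilde M$, $\widetilde{\mathrm{Ric}}\,v=\widetilde{\mathrm{Ric}}(v,\cdot)^\sharp$. *)

(* Defs.v *)
From HB Require Import structures.
From mathcomp Require Import all_boot all_order all_algebra.
From mathcomp Require Import ring.
From mathcomp Require Import all_classical all_reals all_analysis.
Import Order.TTheory GRing.Theory Num.Theory.
Import numFieldNormedType.Exports.

Set Implicit Arguments.
Unset Strict Implicit.
Unset Printing Implicit Defensive.

Local Open Scope classical_set_scope.
Local Open Scope ring_scope.

(* Conventions. Tensor fields on a manifold are given by their components in
   every chart of the atlas, subject to the usual transformation laws. Vectors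
   and covectors are row vectors; the differential of a map F between
   coordinate spaces is u |-> u *m jacobian F x, as in MathComp-Analysis; a
   metric is a matrix A with A(u, w) = u A w^T. *)

(** * Smooth maps and integration on coordinate spaces *)

Section Euclidean.
Context {R : realType} {m : nat}.
Local Notation V := 'rV[R]_m.

Definition basis_vec (i : 'I_m) : V := delta_mx 0 i.

Fixpoint Cr_on {W : normedModType R} (r : nat) (D : set V) (f : V -> W)
    : Prop :=
  (forall x, D x -> {for x, continuous f}) /\
  if r is r'.+1 then
    forall i : 'I_m, (forall x, D x -> derivable f x (basis_vec i)) /\
      Cr_on r' D (fun x => 'D_(basis_vec i) f x)
  else True.

(* meant for open D *)
Definition smooth_on {W : normedModType R} (D : set V) (f : V -> W) : Prop :=
  forall r, Cr_on r D f.

Definition test_on {W : normedModType R} (D : set V) (f : V -> W) : Prop :=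
  smooth_on [set: V] f /\
  exists K : set V, [/\ compact K, K `<=` D & forall x, ~ K x -> f x = 0].

End Euclidean.

(* Lebesgue integral over R^m as an iterated integral; only used for
   continuous compactly supported integrands. *)
Fixpoint iterated_integral {R : realType} (m : nat) : ('rV[R]_m -> R) -> R :=
  match m with
  | 0%N => fun f => f 0
  | m'.+1 => fun f =>
      Rintegral (@lebesgue_measure R) [set: R] (fun t : R =>
        iterated_integral
          (fun y : 'rV[R]_m' => f (row_mx (t%:M : 'M[R]_1) y : 'rV[R]_(1 + m'))))
  end.

(** * Riemannian calculus in one chart *)

Section ChartCalculus.
Context {R : realType} {m : nat}.
Local Notation V := 'rV[R]_m.
Implicit Types (A : 'M[R]_m) (G : V -> 'M[R]_m) (X Y Z : V -> V) (x : V).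

Definition ip A (u w : V) : R := (u *m A *m w^T) 0 0.
Definition sharp A (a : V) : V := a *m invmx A.
Definition flat G X : V -> V := fun x => X x *m G x.

Definition coord_field (i : 'I_m) : V -> V := fun=> basis_vec i.

(* partial G x i j l = d_i g_{jl} *)
Definition partial_metric G x (i j l : 'I_m) : R :=
  'D_(basis_vec i) (fun y => G y j l) x.

(* christoffel G x i j l = Gamma_{ij}^l of the Levi-Civita connection *)
Definition christoffel G x (i j l : 'I_m) : R :=
  2^-1 * \sum_a invmx (G x) l a *
    (partial_metric G x i j a + partial_metric G x j i a
     - partial_metric G x a i j).

Definition christoffel_form G x (u w : V) : V :=
  \row_l \sum_i \sum_j u 0 i * w 0 j * christoffel G x i j l.

Definition cov G X Y : V -> V :=
  fun x => 'D_(X x) Y x + christoffel_form G x (X x) (Y x).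

Definition bracket X Y : V -> V :=
  fun x => 'D_(X x) Y x - 'D_(Y x) X x.

(* R(X,Y)Z *)
Definition curv G X Y Z : V -> V :=
  fun x => cov G X (cov G Y Z) x - cov G Y (cov G X Z) x
           - cov G (bracket X Y) Z x.

(* R(W,X,Y,Z) *)
Definition curv4 G W X Y Z : V -> R :=
  fun x => ip (G x) (curv G W X Y x) (Z x).

(* Frame is expected to be an orthonormal frame *)
Definition ric G (Frame : 'I_m -> V -> V) X Y : V -> R :=
  fun x => \sum_a curv4 G (Frame a) X Y (Frame a) x.

(* Ric(X, .)^sharp *)
Definition ric_vec G (Frame : 'I_m -> V -> V) X : V -> V :=
  fun x => sharp (G x) (\row_a ric G Frame X (coord_field a) x).

(* A 1-form is its row of components; a 2-form w is the skew matrix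
   w_{ij} = w(d_i, d_j). *)

Definition d0 (f : V -> R) : V -> V :=
  fun x => \row_i 'D_(basis_vec i) f x.

Definition d1 (w : V -> V) : V -> 'M[R]_m :=
  fun x => \matrix_(i, j) ('D_(basis_vec i) (fun y => w y 0 j) x
                           - 'D_(basis_vec j) (fun y => w y 0 i) x).

Definition ip_form1 A (a b : V) : R := (a *m invmx A *m b^T) 0 0.

(* <a,b> = 1/2 g^{ik} g^{jl} a_{ij} b_{kl}: the e^i /\ e^j with i < j are
   orthonormal for an orthonormal coframe e *)
Definition ip_form2 A (a b : 'M[R]_m) : R :=
  2^-1 * \tr (invmx A *m a *m invmx A *m b^T).

Definition vol_integral G (f : V -> R) : R :=
  iterated_integral (fun x => f x * Num.sqrt (\det (G x))).

(* The formal adjoints d^* of d on (D, G), D open: the smooth forms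
   satisfying the adjunction against all compactly supported smooth test
   forms; they are unique on D, and irrelevant outside D. Since d^* is local,
   test forms supported in one coordinate domain determine it there. *)

Definition codiff1 (D : set V) G (w : V -> V) : V -> R :=
  xget (fun=> 0) [set u : V -> R | smooth_on D u /\
    forall f : V -> R, test_on D f ->
      vol_integral G (fun x => ip_form1 (G x) (d0 f x) (w x)) =
      vol_integral G (fun x => f x * u x)].

Definition codiff2 (D : set V) G (w : V -> 'M[R]_m) : V -> V :=
  xget (fun=> 0) [set u : V -> V | smooth_on D u /\
    forall f : V -> V, test_on D f ->
      vol_integral G (fun x => ip_form2 (G x) (d1 f x) (w x)) =
      vol_integral G (fun x => ip_form1 (G x) (f x) (u x))].

(* The operator -Delta_h = ((d d^* + d^* d) v^flat)^sharp, sign included. *)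
Definition hodge_laplacian (D : set V) G X : V -> V :=
  fun x => sharp (G x) (d0 (codiff1 D G (flat G X)) x
                        + codiff2 D G (d1 (flat G X)) x).

(* The two properties that characterize the Levi-Civita connection. *)

Lemma partial_metricC G x i j l :
  (\near x, (G x)^T = G x) ->
  partial_metric G x i j l = partial_metric G x i l j.
Proof.
move=> symG; rewrite /partial_metric; apply: near_eq_derive.
by near=> y; rewrite -[G y in RHS](near symG y) // mxE.
Unshelve. all: by end_near. Qed.

Lemma christoffel_torsion_free G x i j l :
  (\near x, (G x)^T = G x) -> christoffel G x i j l = christoffel G x j i l.
Proof.
move=> symG; rewrite /christoffel; congr (_ * _); apply: eq_bigr => a _.
by rewrite (partial_metricC a i j symG) [X in X - _]addrC.
Qed.

Lemma christoffel_metric G x i j l :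
  (\near x, (G x)^T = G x) -> G x \in unitmx ->
  partial_metric G x l i j =
  \sum_a (christoffel G x l i a * G x a j + christoffel G x l j a * G x i a).
Proof.
move=> symG uG.
have sG a b : G x a b = G x b a.
  by rewrite -[G x in LHS](nbhs_singleton symG) mxE.
have sP a b c := partial_metricC a b c symG.
pose P a b f := partial_metric G x a b f + partial_metric G x b a f
                - partial_metric G x f a b.
have low a b c : \sum_e christoffel G x a b e * G x e c = 2^-1 * P a b c.
  transitivity (2^-1 * \sum_f (G x *m invmx (G x)) c f * P a b f); last first.
    rewrite mulmxV // (bigD1 c) //= mxE eqxx mul1r big1 ?addr0 // => f fc.
    by rewrite mxE eq_sym (negPf fc) mul0r.
  under eq_bigr do rewrite /christoffel -mulrA mulr_suml.
  rewrite -mulr_sumr exchange_big /=; congr (_ * _); apply: eq_bigr => f _.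
  rewrite mxE mulr_suml; apply: eq_bigr => e _.
  by rewrite (sG e c) mulrC mulrA.
rewrite big_split /= low.
under [X in _ = _ + X]eq_bigr do rewrite (sG i).
rewrite low -mulrDr /P (sP l j i) (sP i l j) (sP j l i).
set a := partial_metric _ _ l i j; set b := partial_metric _ _ i _ _.
set c := partial_metric _ _ j _ _.
rewrite addrACA [- c + _]addrC addrACA.
by field.
Qed.

End ChartCalculus.

(** * Manifolds *)

Record manifold (R : realType) (m : nat) := Manifold {
  space :> topologicalType;
  chart : Type;
  cdom : chart -> set space;
  chart_map : chart -> space -> 'rV[R]_m;
  chart_inv : chart -> 'rV[R]_m -> space;
  space_hausdorff : hausdorff_space space;
  space_second_countable : @second_countable space;
  cdom_cover : forall q, exists c, cdom c q;
  cdom_open : forall c, open (cdom c);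
  chart_map_open : forall c, open (chart_map c @` cdom c);
  chart_mapK : forall c q, cdom c q -> chart_inv c (chart_map c q) = q;
  chart_map_continuous : forall c q, cdom c q ->
    {for q, continuous (chart_map c)};
  chart_inv_continuous : forall c q, cdom c q ->
    {for chart_map c q, continuous (chart_inv c)};
  transition_smooth : forall c c',
    smooth_on (chart_map c @` (cdom c `&` cdom c'))
              (chart_map c' \o chart_inv c)
}.

(* Components of a field of objects of type W in all charts. *)
Definition field {R : realType} {m : nat} (M : manifold R m) (W : Type) :=
  chart M -> 'rV[R]_m -> W.

Section Manifolds.
Context {R : realType} {m : nat} (M : manifold R m).

Definition chart_image (c : chart M) (U : set M) : set 'rV[R]_m :=
  chart_map c @` (cdom c `&` U).

Definition transition (c c' : chart M) : 'rV[R]_m -> 'rV[R]_m :=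
  chart_map c' \o chart_inv c.

Definition vector_field (U : set M) (X : field M 'rV[R]_m) : Prop :=
  (forall c, smooth_on (chart_image c U) (X c)) /\
  (forall c c' x, chart_image c (cdom c' `&` U) x ->
     X c' (transition c c' x) = X c x *m jacobian (transition c c') x).

Definition riemannian_metric (g : field M 'M[R]_m) : Prop :=
  [/\ forall c, smooth_on (chart_image c setT) (g c),
      forall c c' x, chart_image c (cdom c') x ->
        g c x = jacobian (transition c c') x *m g c' (transition c c' x)
                *m (jacobian (transition c c') x)^T,
      forall c x, chart_image c setT x -> (g c x)^T = g c x &
      forall c x, chart_image c setT x ->
        forall u : 'rV[R]_m, u != 0 -> 0 < ip (g c x) u u].

Definition orthonormal_frame (g : field M 'M[R]_m) (U : set M)
    (Frame : 'I_m -> field M 'rV[R]_m) : Prop :=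
  (forall a, vector_field U (Frame a)) /\
  forall c x, chart_image c U x -> forall a b,
    ip (g c x) (Frame a c x) (Frame b c x) = (a == b)%:R.

End Manifolds.

(** * Submanifold calculus in a pair of charts *)

(* An isometric immersion read in charts: the map, the ambient metric and
   the metric on the source. *)
Record local_sub (R : realType) (n m : nat) := LocalSub {
  lmap : 'rV[R]_n -> 'rV[R]_m;
  lamb : 'rV[R]_m -> 'M[R]_m;
  lind : 'rV[R]_n -> 'M[R]_n
}.

Section SubCalculus.
Context {R : realType} {n m : nat} (L : local_sub R n m).
Local Notation F := (lmap L).
Local Notation G := (lamb L).
Local Notation g := (lind L).
(* TM and TA: fields on the submanifold that are tangent to it, resp. that
   take values in the ambient tangent spaces *)
Local Notation TM := ('rV[R]_n -> 'rV[R]_n).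
Local Notation TA := ('rV[R]_n -> 'rV[R]_m).
Implicit Types (X Y Z : TM) (eta : TA) (x : 'rV[R]_n) (w : 'rV[R]_m).

Definition push X : TA := fun x => X x *m jacobian F x.

(* The vector of T_pM whose image under dF is the orthogonal projection of w:
   the u with g(u, .) = G(w, dF .). *)
Definition tan_part x w : 'rV[R]_n :=
  sharp (g x) (w *m G (F x) *m (jacobian F x)^T).

Definition nor_part x w : 'rV[R]_m := w - tan_part x w *m jacobian F x.

(* ambient connection applied to a field along the submanifold, in a
   direction tangent to the submanifold *)
Definition cov_along X eta : TA :=
  fun x => 'D_(X x) eta x + christoffel_form G (F x) (push X x) (eta x).

Definition II X Y : TA := fun x => nor_part x (cov_along X (push Y) x).

(* W_eta X, defined by g(W_eta X, Y) = G(eta, II(X, Y)) *)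
Definition weingarten eta X : TM :=
  fun x => sharp (g x) (\row_a ip (G (F x)) (eta x) (II X (coord_field a) x)).

Definition cov_perp X eta : TA := fun x => nor_part x (cov_along X eta x).

Definition covB X (A : TM -> TM -> TA) Y Z : TA :=
  fun x => cov_perp X (A Y Z) x - A (cov g X Y) Z x - A Y (cov g X Z) x.

(* E is an orthonormal frame of the submanifold in the following *)

Definition tr_covB_II (E : 'I_n -> TM) X : TA :=
  fun x => \sum_i covB (E i) II (E i) X x.

Definition mean_curv_vec (E : 'I_n -> TM) : TA :=
  fun x => n%:R^-1 *: \sum_i II (E i) (E i) x.

(* N is the unit normal of a hypersurface in the following *)

Definition sff (N : TA) X Y : 'rV[R]_n -> R :=
  fun x => ip (G (F x)) (N x) (II X Y x).

Definition shape_op (N : TA) X : TM := weingarten N X.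

(* (1/n) tr s *)
Definition mean_curv (N : TA) (E : 'I_n -> TM) : 'rV[R]_n -> R :=
  fun x => n%:R^-1 * \sum_i ip (g x) (shape_op N (E i) x) (E i x).

Definition cov_sff (N : TA) X Y Z : 'rV[R]_n -> R :=
  fun x => 'D_(X x) (sff N Y Z) x - sff N (cov g X Y) Z x
           - sff N Y (cov g X Z) x.

Definition div_sff (N : TA) (E : 'I_n -> TM) X : 'rV[R]_n -> R :=
  fun x => \sum_i cov_sff N (E i) (E i) X x.

End SubCalculus.

(** * Embedded submanifolds *)

Section Submanifolds.
Context {R : realType} {n m : nat} (M : manifold R n) (Mt : manifold R m).
Implicit Types (iota : M -> Mt).

Definition local_rep iota (b : chart M) (c : chart Mt)
    : 'rV[R]_n -> 'rV[R]_m :=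
  chart_map c \o iota \o chart_inv b.

Definition embedding iota : Prop :=
  [/\ injective iota,
      continuous iota,
      (forall O : set M, open O ->
         exists2 O' : set Mt, open O' & O = iota @^-1` O'),
      (forall b c, smooth_on (chart_image b (iota @^-1` cdom c))
                             (local_rep iota b c)) &
      (forall b c x, chart_image b (iota @^-1` cdom c) x ->
         \rank (jacobian (local_rep iota b c) x) = n)].

Definition induced_metric iota (gt : field Mt 'M[R]_m) (g : field M 'M[R]_n)
    : Prop :=
  forall b c x, chart_image b (iota @^-1` cdom c) x ->
    let J := jacobian (local_rep iota b c) x in
    g b x = J *m gt c (local_rep iota b c x) *m J^T.

Definition in_charts iota (gt : field Mt 'M[R]_m) (g : field M 'M[R]_n)
    (b : chart M) (c : chart Mt) : local_sub R n m :=
  LocalSub (local_rep iota b c) (gt c) (g b).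

(* The field Xt on U restricts along M to the field eta, where eta b c x is
   the value at the point with b-coordinates x, in c-components. *)
Definition extends_along iota (U : set Mt)
    (eta : chart M -> chart Mt -> 'rV[R]_n -> 'rV[R]_m)
    (Xt : field Mt 'rV[R]_m) : Prop :=
  forall b c x, chart_image b (iota @^-1` (cdom c `&` U)) x ->
    Xt c (local_rep iota b c x) = eta b c x.

(* Xt extends d(iota) X *)
Definition extends_field iota (gt : field Mt 'M[R]_m) (g : field M 'M[R]_n)
    (U : set Mt) (X : field M 'rV[R]_n) (Xt : field Mt 'rV[R]_m) : Prop :=
  extends_along iota U (fun b c => push (in_charts iota gt g b c) (X b)) Xt.

End Submanifolds.

(* E_1, ..., E_n, N_1, ..., N_k *)
Definition join_frame {n k : nat} {T : Type} (E : 'I_n -> T) (N : 'I_k -> T)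
    : 'I_(n + k) -> T :=
  fun a => match fintype.split a with inl i => E i | inr l => N l end.

(* Main.v *)
From HB Require Import structures.
Require Import Defs.
From mathcomp Require Import all_boot all_order all_algebra ring lra.
From mathcomp Require Import perm.
From mathcomp Require Import all_classical all_reals all_analysis.
From mathcomp Require polyrcf.
Import Order.TTheory GRing.Theory Num.Theory.
Import numFieldNormedType.Exports.

(** Why the formulas hold. The Bochner-Weitzenboeck formula writes a Hodge
    Laplacian on vector fields, in an orthonormal frame E_a, as

      - sum_a (nabla_{E_a} nabla_{E_a} X - nabla_{nabla_{E_a} E_a} X)
      - sum_a R(E_a, X) E_a,

    the last sum being minus the Ricci endomorphism applied to X. It is used
    twice: on the ambient manifold with the adapted frame E_i, N_l, and on the
    submanifold with the frame E_i. The terms of the ambient formula that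
    involve the N_l are kept as they are, except that the curvature terms are
    rewritten by the pair symmetry of the curvature tensor. In the terms that
    involve only the E_i every derivative is tangential, so it can be computed
    along the submanifold: the formulas of Gauss and Weingarten split the second
    derivatives (second_cov_along), and the equations of Gauss and Codazzi split
    the curvature (gauss_codazzi). Summing over the frame, the tangential part
    is the intrinsic formula plus shape operators and the normal part is a trace
    of the covariant derivative of II. The sum of the vectors II(E_i, E_i) that
    appears as a direction of differentiation is n times the mean curvature
    vector. This gives hodge_laplacian_submanifold, the second of the two
    general formulas.

    The first general formula follows (hodge_laplacian_submanifold_bracket):
    since the connection is torsion free, the derivative of v along H is
    [H, v] plus the derivative of H along v, which has tangential part minus
    W_H v; its normal part and the trace of the derivative of II are related by
    the contracted Codazzi equation, up to the normal parts of the curvature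
    terms. For a hypersurface all normal
    vectors are multiples of N, and a unit normal has no normal derivative, so
    each vector identity turns into one for its component along N
    (hodge_laplacian_hypersurface).

    The Weitzenboeck formula itself is proved in coordinates. The codifferentials
    are only given as formal adjoints, so they are first identified with
    divergences (codiff1E, codiff2E). The existence half is integration by parts
    for the iterated integral: the integral of a partial derivative of a
    compactly supported function vanishes because integrals are translation
    invariant and difference quotients converge uniformly; Jacobi's formula for
    the derivative of the determinant supplies the derivative of the volume
    density. The uniqueness half is the fundamental lemma of the calculus of
    variations, with bump functions built from t^-k exp(-1/t). After that,
    d^* d and d d^* are contractions of second covariant derivatives, and
    their sum differs from the rough Laplacian by a commutator of covariant
    derivatives, which is curvature.

    Vectors are rows, so the connection in the direction x_i differentiates a row
    Y as dY/dx_i + Y *m conn G i x; torsion freeness and metric compatibility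
    become two matrix identities (conn_torsion and conn_metric), from which
    everything about curvature follows by matrix algebra. *)

Set Implicit Arguments.
Unset Strict Implicit.
Unset Printing Implicit Defensive.

Local Open Scope classical_set_scope.
Local Open Scope ring_scope.

(** * Functions of class C^r on open sets *)

Lemma near_eq_continuous (S T : topologicalType) (f g : S -> T) x :
  (\near x, f x = g x) -> {for x, continuous f} -> {for x, continuous g}.
Proof.
move=> fg fx; rewrite /prop_for/continuous_at -(nbhs_singleton fg).
by apply: cvg_trans fx; apply: near_eq_cvg; apply: filterS fg => z ->.
Qed.

Section Smooth.
Context {R : realType} {m : nat}.
Local Notation V := 'rV[R]_m.
Implicit Types (D : set V) (x : V).

Lemma open_near_eq (T : Type) D (f g : V -> T) x :
  open D -> D x -> {in D, f =1 g} -> \near x, f x = g x.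
Proof.
move=> oD Dx fg; near=> z; apply: fg; rewrite inE.
by near: z; apply: open_nbhs_nbhs; split.
Unshelve. all: by end_near. Qed.

Lemma Cr_on_continuous (W : normedModType R) r D (f : V -> W) x :
  Cr_on r D f -> D x -> {for x, continuous f}.
Proof. by case: r => [|r] [cf _]; exact: cf. Qed.

Lemma Cr_onW (W : normedModType R) r D (f : V -> W) :
  Cr_on r.+1 D f -> Cr_on r D f.
Proof.
elim: r f => [|r IH] f [cf H]; split => // i; have [d C] := H i; split => //.
exact: IH.
Qed.

(** Differentiability at a point of an open set only sees nearby points. *)
Lemma Cr_on_eq (W : normedModType R) r D (f g : V -> W) :
  open D -> {in D, f =1 g} -> Cr_on r D f -> Cr_on r D g.
Proof.
move=> oD; elim: r f g => [|r IH] f g fg [cf H].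
  split=> // x Dx; apply: (near_eq_continuous (open_near_eq oD Dx fg)).
  exact: cf.
split; first by move=> x Dx; apply: (near_eq_continuous (open_near_eq oD Dx fg));
  exact: cf.
move=> i; have [df C] := H i; split.
  by move=> x Dx; apply: (near_eq_derivable (open_near_eq oD Dx fg)); exact: df.
apply: IH C => x; rewrite inE => Dx; exact: near_eq_derive (open_near_eq oD Dx fg).
Qed.

Lemma Cr_on_sub (W : normedModType R) r D D' (f : V -> W) :
  D' `<=` D -> Cr_on r D f -> Cr_on r D' f.
Proof.
move=> sD; elim: r f => [|r IH] f [cf H]; split => //.
- by move=> x /sD; exact: cf.
- by move=> x /sD; exact: cf.
- by move=> i; have [d C] := H i; split; [move=> x /sD; exact: d|exact: IH].
Qed.

Lemma Cr_on_cst (W : normedModType R) r D (w : W) : Cr_on r D (fun=> w).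
Proof.
elim: r w => [|r IH] w; split => //.
- by move=> x _; exact: cst_continuous.
- by move=> x _; exact: cst_continuous.
move=> i; split => [x _|]; first exact: derivable_cst.
under [fun x => _]eq_fun do rewrite derive_cst; exact: IH.
Qed.

Lemma Cr_onD (W : normedModType R) r D (f g : V -> W) : open D ->
  Cr_on r D f -> Cr_on r D g -> Cr_on r D (fun x => f x + g x).
Proof.
move=> oD; elim: r f g => [|r IH] f g [cf F] [cg G]; split => //.
- by move=> x Dx; apply: continuousD; [exact: cf|exact: cg].
- by move=> x Dx; apply: continuousD; [exact: cf|exact: cg].
move=> i; have [df Cf] := F i; have [dg Cg] := G i; split.
  by move=> x Dx; apply: derivableD; [exact: df|exact: dg].
apply: Cr_on_eq (IH _ _ Cf Cg) => // x; rewrite inE => Dx.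
by rewrite -deriveD//; [exact: df|exact: dg].
Qed.

Lemma Cr_onM r D (f g : V -> R) : open D ->
  Cr_on r D f -> Cr_on r D g -> Cr_on r D (fun x => f x * g x).
Proof.
move=> oD; elim: r f g => [|r IH] f g Cf Cg.
  by case: Cf Cg => cf _ [cg _]; split => // x Dx; apply: continuousM; [exact: cf|exact: cg].
have [cf F] := Cf; have [cg G] := Cg; split.
  by move=> x Dx; apply: continuousM; [exact: cf|exact: cg].
move=> i; have [df CDf] := F i; have [dg CDg] := G i; split.
  by move=> x Dx; apply: derivableM; [exact: df|exact: dg].
have H := Cr_onD oD (IH _ _ (Cr_onW Cf) CDg) (IH _ _ (Cr_onW Cg) CDf).
apply: Cr_on_eq H => // x; rewrite inE => Dx.
by rewrite deriveM//; [exact: df|exact: dg].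
Qed.

(** The derivative of 1/f is - (1/f)^2 f', so the induction on r feeds on itself. *)
Lemma Cr_onV r D (f : V -> R) : open D -> (forall x, D x -> f x != 0) ->
  Cr_on r D f -> Cr_on r D (fun x => (f x)^-1).
Proof.
move=> oD f0; elim: r => [|r IH] Cf.
  case: Cf => cf _; split => // x Dx; apply: continuousV; [exact: f0|exact: cf].
have [cf F] := Cf; split.
  by move=> x Dx; apply: continuousV; [exact: f0|exact: cf].
move=> i; have [df CDf] := F i; split.
  by move=> x Dx; apply: derivableV; [exact: f0|exact: df].
have H := IH (Cr_onW Cf).
have H2 := Cr_onM oD (Cr_onM oD (Cr_on_cst r D (- (1:R))) (Cr_onM oD H H)) CDf.
apply: Cr_on_eq H2 => // x; rewrite inE => Dx.
rewrite deriveV//; [|exact: f0|exact: df].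
by rewrite mulN1r -invfM -expr2.
Qed.

Lemma Cr_on_sum (W : normedModType R) (I : Type) (s : seq I) (P : pred I) r D (f : I -> V -> W) :
  open D -> (forall i, P i -> Cr_on r D (f i)) ->
  Cr_on r D (fun x => \sum_(i <- s | P i) f i x).
Proof.
move=> oD Cf; elim: s => [|a s IH].
  by apply: Cr_on_eq (Cr_on_cst r D 0) => // x _; rewrite big_nil.
case Pa: (P a); last by apply: Cr_on_eq IH => // x _; rewrite big_cons Pa.
by apply: Cr_on_eq (Cr_onD oD (Cf _ Pa) IH) => // x _; rewrite big_cons Pa.
Qed.

Lemma Cr_on_prod (I : Type) (s : seq I) (P : pred I) r D (f : I -> V -> R) :
  open D -> (forall i, P i -> Cr_on r D (f i)) ->
  Cr_on r D (fun x => \prod_(i <- s | P i) f i x).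
Proof.
move=> oD Cf; elim: s => [|a s IH].
  by apply: Cr_on_eq (Cr_on_cst r D (1 : R)) => // x _; rewrite big_nil.
case Pa: (P a); last by apply: Cr_on_eq IH => // x _; rewrite big_cons Pa.
by apply: Cr_on_eq (Cr_onM oD (Cf _ Pa) IH) => // x _; rewrite big_cons Pa.
Qed.

Lemma continuous_mxP (T : topologicalType) p q (f : T -> 'M[R]_(p, q)) (x : T) :
  {for x, continuous f} <-> forall i j, {for x, continuous (fun z => f z i j)}.
Proof.
split=> [cf i j|cf].
  exact: (continuous_comp cf (@coord_continuous _ _ _ i j _)).
apply/cvgrPdist_le => e e0; near=> z.
rewrite /Num.Def.normr/= mx_normrE (bigmax_le _ (ltW e0))//= => i _.
rewrite !mxE/=; move: i; near: z; apply: filter_forall => /= i.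
exact: ((cvgrPdist_le _ _).1 (cf i.1 i.2)).
Unshelve. all: by end_near. Qed.

Lemma Cr_on_mxP p q r D (f : V -> 'M[R]_(p, q)) : open D ->
  Cr_on r D f <-> forall i j, Cr_on r D (fun x => f x i j).
Proof.
move=> oD; elim: r f => [|r IH] f; split.
- by move=> [cf _] i j; split => // x Dx; move: i j; apply/continuous_mxP; exact: cf.
- move=> H; split => // x Dx; apply/continuous_mxP => i j; exact: (H i j).1.
- move=> [cf H] i j; split.
    by move=> x Dx; move: i j; apply/continuous_mxP; exact: cf.
  move=> k; have [d C] := H k; split.
    by move=> x Dx; move: i j; apply/derivable_mxP; exact: d.
  apply: Cr_on_eq ((IH _).1 C i j) => // x; rewrite inE => Dx.
  by rewrite derive_mx ?mxE//; exact: d.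
- move=> H; split.
    by move=> x Dx; apply/continuous_mxP => i j; apply: (H i j).1.
  have dfe k x : D x -> derivable f x (basis_vec k).
    by move=> Dx; apply/derivable_mxP => i j; exact: ((H i j).2 k).1.
  move=> k; split; first by move=> x; exact: dfe.
  apply/IH => i j; apply: Cr_on_eq ((H i j).2 k).2 => // x; rewrite inE => Dx.
  by rewrite derive_mx ?mxE//; exact: dfe.
Qed.

Lemma derivable_coord (j : 'I_m) x v : derivable (fun z : V => z 0 j) x v.
Proof. apply: diff_derivable; exact: differentiable_coord. Qed.

Lemma derive_coord (j : 'I_m) x v : 'D_v (fun z : V => z 0 j) x = v 0 j.
Proof.
have -> : v 0 j = ('D_v id x : V) 0 j by rewrite derive_id.
by rewrite derive_mx ?mxE//; exact: derivable_id.
Qed.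

Lemma Cr_on_coord r D (j : 'I_m) : Cr_on r D (fun x : V => x 0 j).
Proof.
case: r => [|r]; (split; first by move=> x _; exact: coord_continuous) => //.
move=> i; split=> [x _|]; first exact: derivable_coord.
under eq_fun do rewrite derive_coord; exact: Cr_on_cst.
Qed.

End Smooth.

(** * Continuously differentiable functions are differentiable *)

Section Differentiability.
Context {R : realType} {m : nat}.
Local Notation V := 'rV[R]_m.
Implicit Types (D : set V) (x : V).

Lemma is_derive_line (W : normedModType R) (f : V -> W) z w (s : R) :
  derivable f (z + s *: w) w ->
  is_derive s 1 (fun t : R => f (z + t *: w)) ('D_w f (z + s *: w)).
Proof.
move=> df.
have E : (fun h : R => h^-1 *: (((fun t : R => f (z + t *: w)) \o shift s) (h *: 1)
    - f (z + s *: w))) =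
  (fun h : R => h^-1 *: ((f \o shift (z + s *: w)) (h *: w) - f (z + s *: w))).
  apply/funext => h /=; congr (_ *: (f _ - _)).
  by rewrite -[h *: 1]/(h * 1) mulr1 scalerDl addrCA.
by split; rewrite /derivable /derive E.
Qed.

(** The mean value theorem along a line, for either sign of the step. *)
Lemma partial_mean_value (f : V -> R) z w (t : R) :
  (forall s, `|s| <= `|t| -> derivable f (z + s *: w) w) ->
  exists2 s, `|s| <= `|t| & f (z + t *: w) - f z = t * 'D_w f (z + s *: w).
Proof.
move=> df; have dl s (hs : `|s| <= `|t|) := is_derive_line (df _ hs).
have cl s : `|s| <= `|t| -> {for s, continuous (fun t : R => f (z + t *: w))}.
  by move=> /dl[d _]; exact/differentiable_continuous/derivable1_diffP.
have z0 : f z = f (z + 0 *: w) by rewrite scale0r addr0.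
have [t0|t0] := leP 0 t.
  have tE : `|t| = t by rewrite ger0_norm.
  have [||s] := @MVT_segment R (fun t => f (z + t *: w))
     (fun s => 'D_w f (z + s *: w)) 0 t t0.
  - move=> s; rewrite in_itv /= => /andP[s0 st]; apply: dl.
    by rewrite tE ger0_norm ltW.
  - apply: (@continuous_in_subspaceT _ _ `[0, t]%classic) => s; rewrite inE /= in_itv /=.
    by move=> /andP[s0 st]; apply: cl; rewrite tE ger0_norm.
  rewrite in_itv /= => /andP[s0 st] E; exists s; first by rewrite tE ger0_norm.
  by rewrite z0 E subr0 mulrC.
have tE : `|t| = - t by rewrite ltr0_norm.
have [||s] := @MVT_segment R (fun t => f (z + t *: w))
   (fun s => 'D_w f (z + s *: w)) t 0 (ltW t0).
- move=> s; rewrite in_itv /= => /andP[s0 st]; apply: dl.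
  by rewrite tE ltr0_norm// lerN2 ltW.
- apply: (@continuous_in_subspaceT _ _ `[t, 0]%classic) => s; rewrite inE /= in_itv /=.
  by move=> /andP[s0 st]; apply: cl; rewrite tE ler0_norm// lerN2.
rewrite in_itv /= => /andP[s0 st] E; exists s; first by rewrite tE ler0_norm// lerN2.
by rewrite z0 -opprB E; ring.
Qed.

(** The points trunc k h, for k from 0 to m, lead from 0 to h through m steps
    parallel to the axes. *)
Definition trunc k (h : V) : V := \row_i (if (i < k)%N then h 0 i else 0).

Lemma norm_row_le (h : V) (e : R) : 0 <= e -> (forall i, `|h 0 i| <= e) -> `|h| <= e.
Proof.
move=> e0 H; rewrite /Num.Def.normr/= mx_normrE bigmax_le// => -[i j] _ /=.
by rewrite ord1.
Qed.

Lemma coord_norm_le (h : V) i : `|h 0 i| <= `|h|.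
Proof. by rewrite [leRHS]/Num.Def.normr/= mx_normrE; apply: (le_bigmax _ _ (0, i)). Qed.

Lemma truncS (k : 'I_m) (h : V) : trunc k.+1 h = trunc k h + h 0 k *: basis_vec k.
Proof.
apply/rowP => i; rewrite !mxE /= ltnS leq_eqVlt.
have [->|ik] := eqVneq i k; first by rewrite eqxx ltnn add0r mulr1.
by rewrite -val_eqE /= in ik *; rewrite (negPf ik) mulr0 addr0.
Qed.

Lemma trunc0 (h : V) : trunc 0 h = 0.
Proof. by apply/rowP => i; rewrite !mxE. Qed.

Lemma truncm (h : V) : trunc m h = h.
Proof. by apply/rowP => i; rewrite !mxE ltn_ord. Qed.

Definition grad_form (f : V -> R) x (h : V) : R :=
  \sum_i h 0 i * 'D_(basis_vec i) f x.

(** Telescoping along a path parallel to the axes, each step is controlled by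
    the mean value theorem and the continuity of one partial derivative. *)
Lemma C1_expansion D (f : V -> R) x (e : R) : open D -> Cr_on 1 D f -> D x -> 0 < e ->
  \forall h \near (0 : V), `|f (x + h) - f x - grad_form f x h| <= e * `|h|.
Proof.
move=> oD [_ Cf] Dx e0.
have e1 : 0 < e / m.+1%:R by rewrite divr_gt0.
have : \forall z \near x, D z /\
    forall i, `|'D_(basis_vec i) f x - 'D_(basis_vec i) f z| <= e / m.+1%:R.
  near=> z; split; first by near: z; apply: open_nbhs_nbhs; split.
  near: z; apply: filter_forall => i.
  exact: ((cvgrPdist_le _ _).1 ((Cf i).2.1 _ Dx)) _ e1.
move=> /nbhs_ballP[d /= d0 Hd].
near=> h.
have hd : `|h| < d.
  near: h; apply/nbhs_ballP; exists d => //= h; rewrite -ball_normE /= sub0r normrN//.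
(* the path from x to x + h stays in the ball *)
have inb k (s : R) (z : 'I_m) : `|s| <= `|h 0 z| -> (k <= z)%N ->
    ball x d (x + trunc k h + s *: basis_vec z).
  move=> sz kz; rewrite -ball_normE /= -!addrA opprD addNKr normrN.
  apply: le_lt_trans hd; apply: norm_row_le => // i.
  rewrite !mxE eqxx /=; case: ltnP => ik.
    have -> : (i == z) = false.
      by apply/negbTE; apply: contraTneq ik => ->; rewrite -leqNgt.
    by rewrite mulr0 addr0 coord_norm_le.
  rewrite add0r; case: (i == z); last by rewrite mulr0 normr0.
  by rewrite mulr1 (le_trans sz)// coord_norm_le.
have -> : f (x + h) - f x - grad_form f x h =
   \sum_(k < m) (f (x + trunc k.+1 h) - f (x + trunc k h)
                 - h 0 k * 'D_(basis_vec k) f x).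
  rewrite sumrB; congr (_ - _).
  rewrite -(big_mkord xpredT (fun k => f (x + trunc k.+1 h) - f (x + trunc k h))).
  by rewrite telescope_sumr// trunc0 truncm addr0.
apply: (le_trans (ler_norm_sum _ _ _)).
apply: (@le_trans _ _ (\sum_(k < m) (e / m.+1%:R) * `|h|)); last first.
  rewrite sumr_const card_ord -[leLHS]mulr_natl mulrA; apply: ler_wpM2r => //.
  rewrite mulrC -mulrA ger_pMr// ler_pdivrMl// mulr1 ler_nat//.
apply: ler_sum => k _.
have [s sk] := @partial_mean_value f (x + trunc k h) (basis_vec k) (h 0 k)
  (fun s hs => (Cf k).1 _ (Hd _ (inb k s k hs (leqnn k))).1).
rewrite truncS addrA => ->; rewrite -mulrBr normrM mulrC.
apply: ler_pM => //; last exact: coord_norm_le.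
by rewrite distrC; apply: (Hd _ _).2; apply: inb.
Unshelve. all: by end_near. Qed.

Lemma grad_form_linear f x : linear (grad_form f x).
Proof.
move=> a u w; rewrite /grad_form scaler_sumr -big_split /=; apply: eq_bigr => i _.
by rewrite !mxE mulrDl -[a *: _]/(a * _) mulrA.
Qed.

Lemma C1_differentiable_scalar D (f : V -> R) x :
  open D -> Cr_on 1 D f -> D x -> differentiable f x.
Proof.
move=> oD Cf Dx.
pose L : {linear V -> R} := HB.pack (grad_form f x)
  (GRing.isLinear.Build R V R *%R _ (grad_form_linear f x)).
have cL : continuous L.
  move=> z; rewrite /= /grad_form.
  apply: (@Cr_on_continuous _ _ _ 0 setT (fun h : V => \sum_i h 0 i * 'D_(basis_vec i) f x)) => //.
  apply: Cr_on_sum; first exact: openT.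
  move=> i _; apply: Cr_onM; [exact: openT|exact: Cr_on_coord|exact: Cr_on_cst].
have H : f \o shift x = cst (f x) + L +o_ (0 : V) id.
  apply/eqaddoP => e e0; apply: filterS (C1_expansion oD Cf Dx e0) => h.
  have -> // : (f \o shift x - (cst (f x) + L)) h = f (x + h) - f x - grad_form f x h.
  by rewrite /= !fctE /= opprD addrA [h + x]addrC.
apply/diff_locallyP; have := diff_unique cL H => dE; rewrite dE; split => //.
Qed.

End Differentiability.

(** * Symmetry of second derivatives and matrix-valued functions *)

Lemma continuous_near_le {R : realType} (T : topologicalType) (f : T -> R) x e :
  {for x, continuous f} -> 0 < e -> \forall z \near x, `|f x - f z| <= e.
Proof. by move=> cf e0; exact: ((cvgrPdist_le _ _).1 cf). Qed.

Lemma near_and3 (T : topologicalType) (P Q S : T -> Prop) (x : T) :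
  (\forall z \near x, P z) -> (\forall z \near x, Q z) ->
  (\forall z \near x, S z) -> \forall z \near x, [/\ P z, Q z & S z].
Proof. exact: filterS3. Qed.

Section Schwarz.
Context {R : realType} {m : nat}.
Local Notation V := 'rV[R]_m.
Implicit Types (D : set V) (x : V).

Lemma norm_two_steps (s t d : R) (i j : 'I_m) : `|s| <= d -> `|t| <= d ->
  `|s *: basis_vec i + t *: basis_vec j : V| <= d + d.
Proof.
move=> sd td; apply: (le_trans (ler_normD _ _)).
have bnd (k : 'I_m) : `|basis_vec k : V| <= 1.
  apply: norm_row_le => // l; rewrite mxE /=; case: (_ == k);
  by rewrite ?normr0 ?normr1.
by apply: lerD; rewrite normrZ -(mulr1 d); apply: ler_pM => //; exact: bnd.
Qed.

(** The second difference over a square, by two applications of the mean value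
    theorem; exchanging i and j gives the other mixed derivative. *)
Lemma mixed_difference D (f : V -> R) x (d : R) i j : open D -> Cr_on 2 D f ->
  0 < d -> (forall z, `|z| < d + d + d -> D (x + z)) ->
  exists s t, [/\ `|s| <= d, `|t| <= d &
    f (x + d *: basis_vec i + d *: basis_vec j) - f (x + d *: basis_vec i)
    - (f (x + d *: basis_vec j) - f x) =
    d * d * 'D_(basis_vec j) (fun z => 'D_(basis_vec i) f z)
       (x + s *: basis_vec i + t *: basis_vec j)].
Proof.
move=> oD [_ Cf] d0 Dd; have dE : `|d| = d by rewrite gtr0_norm.
have inD (s t : R) : `|s| <= d -> `|t| <= d ->
    D (x + s *: basis_vec i + t *: basis_vec j).
  move=> sd td; rewrite -addrA; apply: Dd.
  by apply: le_lt_trans (norm_two_steps _ _ sd td) _; rewrite ltrDl.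
(* the second difference of f is the first difference of phi *)
pose phi (z : V) := f (z + d *: basis_vec j) - f z.
have dD z : D z -> derivable f z (basis_vec i) by move=> /(Cf i).1.
have shiftD z w : derivable f (z + w) (basis_vec i) ->
    is_derive z (basis_vec i) (fun z => f (z + w)) ('D_(basis_vec i) f (z + w)).
  move=> dfz; have E : (fun h : R => h^-1 *: (((fun z => f (z + w)) \o shift z)
     (h *: basis_vec i) - f (z + w))) =
     (fun h : R => h^-1 *: ((f \o shift (z + w)) (h *: basis_vec i) - f (z + w))).
    by apply/funext => h /=; rewrite addrA.
  by split; rewrite /derivable /derive E.
have inD0 s : `|s| <= d -> D (x + s *: basis_vec i).
  move=> sd; have := inD s 0 sd; rewrite normr0 scale0r addr0; apply; exact: ltW.
have inDd s : `|s| <= d -> D (x + s *: basis_vec i + d *: basis_vec j).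
  by move=> sd; apply: inD => //; rewrite dE.
have dphi s : `|s| <= `|d| -> is_derive (x + s *: basis_vec i) (basis_vec i) phi
    ('D_(basis_vec i) f (x + s *: basis_vec i + d *: basis_vec j)
     - 'D_(basis_vec i) f (x + s *: basis_vec i)).
  rewrite dE => sd; apply: is_deriveB; first exact/shiftD/dD/inDd.
  by apply: derivableP; apply/dD/inD0.
have [s sd phiE] := @partial_mean_value _ _ phi x (basis_vec i) d
  (fun s hs => @ex_derive _ _ _ _ _ _ _ (dphi s hs)).
have [t td E] := @partial_mean_value _ _ (fun z => 'D_(basis_vec i) f z)
  (x + s *: basis_vec i) (basis_vec j) d
  (fun t ht => ((Cf i).2.2 j).1 _ (inD _ _ (eq_ind _ (fun u => `|s| <= u) sd _ dE)
     (eq_ind _ (fun u => `|t| <= u) ht _ dE))).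
exists s, t; split; [by rewrite -dE|by rewrite -dE|].
rewrite [LHS]phiE (@derive_val _ _ _ _ _ _ _ (dphi s sd)) E; ring.
Qed.

(** Both mixed derivatives at x are close to their values at nearby points where
    they equal the same second difference quotient. *)
Lemma partialC D (f : V -> R) x i j : open D -> Cr_on 2 D f -> D x ->
  'D_(basis_vec i) (fun z => 'D_(basis_vec j) f z) x =
  'D_(basis_vec j) (fun z => 'D_(basis_vec i) f z) x.
Proof.
move=> oD Cf Dx; apply/eqP; rewrite -subr_eq0 -normr_le0; apply/ler_addgt0Pr => e e0.
have e2 : 0 < e / 2 by rewrite divr_gt0.
have : \forall z \near x, [/\ D z,
    `|'D_(basis_vec i) (fun z => 'D_(basis_vec j) f z) x -
      'D_(basis_vec i) (fun z => 'D_(basis_vec j) f z) z| <= e / 2 &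
    `|'D_(basis_vec j) (fun z => 'D_(basis_vec i) f z) x -
      'D_(basis_vec j) (fun z => 'D_(basis_vec i) f z) z| <= e / 2].
  have ct k l : {for x, continuous (fun z => 'D_(basis_vec k) (fun z => 'D_(basis_vec l) f z) z)}.
    exact: (((Cf.2 l).2.2 k).2.1 _ Dx).
  have c1 := continuous_near_le (ct i j) e2.
  have c2 := continuous_near_le (ct j i) e2.
  have nD : nbhs x D by apply: open_nbhs_nbhs; split.
  exact: near_and3 nD c1 c2.
move=> /nbhs_ballP[d /= d0 Hd].
(* three steps of size r stay inside the ball of radius d *)
pose r := d / 4.
have r0 : 0 < r by rewrite divr_gt0.
have Hd' z : `|z| < r + r + r -> ball x d (x + z).
  move=> zr; rewrite -ball_normE /= opprD addNKr normrN (lt_trans zr)// /r; lra.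
have inb s t k l : `|s| <= r -> `|t| <= r ->
    ball x d (x + s *: basis_vec k + t *: basis_vec l).
  move=> sd td; rewrite -addrA; apply: Hd'.
  by apply: le_lt_trans (norm_two_steps _ _ sd td) _; rewrite ltrDl.
have rD z : `|z| < r + r + r -> D (x + z) by move=> /Hd' /Hd[].
have [s [t [sr tr E1]]] := mixed_difference i j oD Cf r0 rD.
have [s' [t' [sr' tr' E2]]] := mixed_difference j i oD Cf r0 rD.
have EE : 'D_(basis_vec j) (fun z => 'D_(basis_vec i) f z)
       (x + s *: basis_vec i + t *: basis_vec j) =
   'D_(basis_vec i) (fun z => 'D_(basis_vec j) f z)
       (x + s' *: basis_vec j + t' *: basis_vec i).
  apply: (@mulfI _ (r * r)); first by rewrite mulf_neq0// gt_eqF.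
  apply: (etrans (esym E1)); apply: (etrans _ E2).
  by rewrite [x + r *: basis_vec j + _]addrAC !opprB addrACA [RHS]addrACA;
  congr (_ + _); rewrite addrC.
have [_ _ h1] := Hd _ (inb s t i j sr tr).
have [_ h2 _] := Hd _ (inb s' t' j i sr' tr').
rewrite -EE in h2; rewrite add0r [e]splitr.
set a := 'D_(basis_vec j) _ (_ + _) in h1 h2.
rewrite -[X in `|X|](subrKA a); apply: (le_trans (ler_normD _ _)).
rewrite [X in _ + X]distrC; exact: lerD h2 h1.
Qed.

End Schwarz.

Section MatrixCalculus.
Context {R : realType} {V : normedModType R}.
Implicit Types x v : V.

Lemma differentiable_mxP p q (f : V -> 'M[R]_(p, q)) x :
  differentiable f x <-> forall i j, differentiable (fun z => f z i j) x.
Proof.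
split=> [df i j|df].
  exact: (differentiable_comp df (differentiable_coord _ i j)).
have -> : f = \sum_(i < p) \sum_(j < q) (fun z => f z i j *: delta_mx i j).
  apply/funext => z; rewrite fct_sumE {1}(matrix_sum_delta (f z)).
  by apply: eq_bigr => i _; rewrite fct_sumE.
apply: differentiable_sum => i; apply: differentiable_sum => j.
exact: differentiableZl.
Qed.

Lemma differentiable_mulmx p q r (A : V -> 'M[R]_(p, q)) (B : V -> 'M[R]_(q, r)) x :
  differentiable A x -> differentiable B x ->
  differentiable (fun z => A z *m B z) x.
Proof.
move=> /differentiable_mxP dA /differentiable_mxP dB; apply/differentiable_mxP => i j.
have -> : (fun z => (A z *m B z) i j) =
    \sum_(k < q) (fun z => A z i k * B z k j).
  by apply/funext => z; rewrite fct_sumE mxE.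
by apply: differentiable_sum => k; apply: differentiableM.
Qed.

Lemma differentiable_trmx p q (A : V -> 'M[R]_(p, q)) x :
  differentiable A x -> differentiable (fun z => (A z)^T) x.
Proof.
move=> /differentiable_mxP dA; apply/differentiable_mxP => i j.
by under eq_fun do rewrite mxE.
Qed.

Lemma derivable_mulmx p q r (A : V -> 'M[R]_(p, q)) (B : V -> 'M[R]_(q, r)) x v :
  derivable A x v -> derivable B x v ->
  derivable (fun z => A z *m B z) x v /\
  'D_v (fun z => A z *m B z) x = 'D_v A x *m B x + A x *m 'D_v B x.
Proof.
move=> dA dB; have dA' := (derivable_mxP _ _ _).1 dA.
have dB' := (derivable_mxP _ _ _).1 dB.
have E i j : (fun z => (A z *m B z) i j) = \sum_(k < q) (fun z => A z i k * B z k j).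
  by apply/funext => z; rewrite fct_sumE mxE.
have dM i j : derivable (fun z => (A z *m B z) i j) x v.
  by rewrite E; apply: derivable_sum => k; apply: derivableM.
have dAB : derivable (fun z => A z *m B z) x v by apply/derivable_mxP.
split => //; apply/matrixP => i j; rewrite derive_mx// mxE E derive_sum; last first.
  by move=> k; apply: derivableM.
rewrite !mxE -big_split /=; apply: eq_bigr => k _.
rewrite deriveM// addrC !derive_mx// !mxE /=.
by congr (_ + _); rewrite -[_ *: _]/(_ * _)// mulrC.
Qed.

Lemma derive_mulmx p q r (A : V -> 'M[R]_(p, q)) (B : V -> 'M[R]_(q, r)) x v :
  derivable A x v -> derivable B x v ->
  'D_v (fun z => A z *m B z) x = 'D_v A x *m B x + A x *m 'D_v B x.
Proof. by move=> dA dB; have [] := derivable_mulmx dA dB. Qed.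

Lemma derivable_trmx p q (A : V -> 'M[R]_(p, q)) x v :
  derivable A x v -> derivable (fun z => (A z)^T) x v /\
  'D_v (fun z => (A z)^T) x = ('D_v A x)^T.
Proof.
move=> dA; have dA' := (derivable_mxP _ _ _).1 dA.
have E i j : (fun z => (A z)^T i j) = (fun z => A z j i).
  by apply/funext => z; rewrite mxE.
have dT : derivable (fun z => (A z)^T) x v by apply/derivable_mxP => i j; rewrite E.
by split => //; apply/matrixP => i j; rewrite derive_mx// mxE E derive_mx// !mxE.
Qed.

Lemma derive_mxE p q (A : V -> 'M[R]_(p, q)) x v i j : derivable A x v ->
  'D_v (fun z => A z i j) x = ('D_v A x) i j.
Proof. by move=> dA; rewrite derive_mx// mxE. Qed.

End MatrixCalculus.

Section SmoothMatrix.
Context {R : realType} {m : nat}.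
Local Notation V := 'rV[R]_m.
Implicit Types (D : set V) (x : V).

Lemma C1_differentiable p q D (f : V -> 'M[R]_(p, q)) x :
  open D -> Cr_on 1 D f -> D x -> differentiable f x.
Proof.
move=> oD /(Cr_on_mxP _ _ oD) Cf Dx; apply/differentiable_mxP => i j.
exact: C1_differentiable_scalar (Cf i j) Dx.
Qed.

Lemma row_sum_basis (u : V) : u = \sum_i u 0 i *: basis_vec i.
Proof. exact: row_sum_delta. Qed.

Lemma derive_basis_sum (W : normedModType R) (f : V -> W) x v :
  differentiable f x -> 'D_v f x = \sum_i v 0 i *: 'D_(basis_vec i) f x.
Proof.
move=> df; rewrite deriveE// {1}(row_sum_basis v) linear_sum.
by apply: eq_bigr => i _; rewrite linearZ /= deriveE.
Qed.

Lemma Cr_on_mulmx p q s r D (A : V -> 'M[R]_(p, q)) (B : V -> 'M[R]_(q, s)) :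
  open D -> Cr_on r D A -> Cr_on r D B -> Cr_on r D (fun z => A z *m B z).
Proof.
move=> oD /(Cr_on_mxP _ _ oD) CA /(Cr_on_mxP _ _ oD) CB; apply/Cr_on_mxP => // i j.
have H : Cr_on r D (fun x => \sum_k A x i k * B x k j).
  by apply: Cr_on_sum => // k _; apply: Cr_onM.
by apply: Cr_on_eq H => // z _; rewrite mxE.
Qed.

Lemma Cr_on_det p r D (A : V -> 'M[R]_p) :
  open D -> Cr_on r D A -> Cr_on r D (fun z => \det (A z)).
Proof.
move=> oD /(Cr_on_mxP _ _ oD) CA; apply: Cr_on_sum => // s _.
by apply: Cr_onM => //; [exact: Cr_on_cst|exact: Cr_on_prod].
Qed.

(** Cramer's rule. *)
Lemma Cr_on_invmx p r D (A : V -> 'M[R]_p) : open D ->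
  (forall x, D x -> A x \in unitmx) -> Cr_on r D A -> Cr_on r D (fun z => invmx (A z)).
Proof.
move=> oD uA CA; apply/Cr_on_mxP => // i j.
have C1 : Cr_on r D (fun z => (\det (A z))^-1).
  apply: Cr_onV => //; last exact: Cr_on_det.
  by move=> x /uA; rewrite unitmxE unitfE.
have C2 : Cr_on r D (fun z => cofactor (A z) j i).
  apply: Cr_onM => //; first exact: Cr_on_cst.
  apply: Cr_on_det => //; apply/Cr_on_mxP => // k l.
  by apply: Cr_on_eq (((Cr_on_mxP _ _ oD).1 CA) (lift j k) (lift i l)) => // z _; rewrite !mxE.
apply: Cr_on_eq (Cr_onM oD C1 C2) => // z; rewrite inE => Dz.
by rewrite /invmx uA// !mxE.
Qed.

Lemma Cr_onZ r D (W : normedModType R) (a : R) (f : V -> W) : open D ->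
  Cr_on r D f -> Cr_on r D (fun z => a *: f z).
Proof.
move=> oD; elim: r f => [|r IH] f [cf H].
  by split => // x Dx; apply: continuousZ; [exact: cst_continuous|exact: cf].
split; first by move=> x Dx; apply: continuousZ; [exact: cst_continuous|exact: cf].
move=> i; have [d C] := H i; split; first by move=> x Dx; apply: derivableZ; exact: d.
apply: Cr_on_eq (IH _ C) => // x; rewrite inE => Dx.
by rewrite deriveZ//; exact: d.
Qed.

Lemma smooth_partial (W : normedModType R) D (f : V -> W) i :
  smooth_on D f -> smooth_on D (fun z => 'D_(basis_vec i) f z).
Proof. by move=> Cf r; exact: ((Cf r.+1).2 i).2. Qed.

End SmoothMatrix.

(** * Integration on the line *)

Section LineIntegral.
Context {R : realType}.
Local Notation mu := (@lebesgue_measure R).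
Implicit Types (f g : R -> R) (B : R).

Definition lint f : R := Rintegral mu [set: R] f.

(** Continuous with support in a fixed segment: carrying the bound B along makes
    integrability and uniform estimates immediate. *)
Definition cc1 B f := continuous f /\ forall t, B < `|t| -> f t = 0.

Lemma cc1_restrict B f : cc1 B f -> f = f \_ `[- B, B]%classic.
Proof.
move=> [_ f0]; apply/funext => t; rewrite patchE; case: ifPn => //.
rewrite notin_setE /= in_itv /= => /negP; rewrite -ler_norml -ltNge; exact: f0.
Qed.

Lemma integrable_segment (a b : R) f : continuous f ->
  mu.-integrable `[a, b]%classic (EFin \o f).
Proof.
move=> cf; apply: continuous_compact_integrable; first exact: segment_compact.
by apply: continuous_in_subspaceT => x _; exact: cf.
Qed.

Lemma cc1_integrable B f : cc1 B f -> mu.-integrable [set: R] (EFin \o f).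
Proof.
move=> cf; rewrite (cc1_restrict cf) -restrict_EFin; apply: (integrable_mkcond _ _).1.
  exact: measurable_itv.
by apply: integrable_segment; have [] := cf.
Qed.

Lemma lint_segment B f : cc1 B f -> lint f = Rintegral mu `[- B, B]%classic f.
Proof. by move=> cf; rewrite /lint [RHS]Rintegral_mkcond -(cc1_restrict cf). Qed.

Lemma lintD B f g : cc1 B f -> cc1 B g ->
  lint (fun t => f t + g t) = lint f + lint g.
Proof.
by move=> cf cg; rewrite /lint RintegralD//; [exact: cc1_integrable cf|exact: cc1_integrable cg].
Qed.

Lemma lintZ B f (a : R) : cc1 B f -> lint (fun t => a * f t) = a * lint f.
Proof. by move=> cf; rewrite /lint RintegralZl//; exact: cc1_integrable cf. Qed.

Lemma length_segment (a b : R) : a < b -> mu `[a, b]%classic = (b - a)%:E.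
Proof.
move=> ab; rewrite [LHS](lebesgue_measure_itv `[a, b]) /= lte_fin ab.
by rewrite EFinB.
Qed.

Lemma lint_bound B f (e : R) : 0 < B -> cc1 B f -> 0 <= e -> (forall t, `|f t| <= e) ->
  `|lint f| <= B *+ 2 * e.
Proof.
move=> B0 cf e0 fe; rewrite (lint_segment cf).
apply: (le_trans (le_normr_Rintegral _ (integrable_segment (- B) B cf.1))).
  exact: measurable_itv.
have cst_int : mu.-integrable `[- B, B]%classic (EFin \o (cst e : R -> R)).
  by apply: integrable_segment => x; exact: cst_continuous.
have abs_int : mu.-integrable `[- B, B]%classic (EFin \o (fun t => `|f t|)).
  apply: integrable_segment => x; apply: continuous_comp; first exact: cf.1.
  exact: norm_continuous.
apply: (@le_trans _ _ (Rintegral mu `[- B, B]%classic (cst e))).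
  by apply: le_Rintegral => //; exact: measurable_itv.
rewrite Rintegral_cst; last exact: measurable_itv.
rewrite mulrC; apply: ler_wpM2r => //.
have BB : - B < B by rewrite gtrN.
rewrite le_eqVlt; apply/orP; left; apply/eqP; apply: (etrans (congr1 fine (length_segment BB))).
by rewrite /= opprK mulr2n.
Qed.

Lemma lint_ge0 f : (forall t, 0 <= f t) -> 0 <= lint f.
Proof. by move=> f0; exact: Rintegral_ge0. Qed.

(** By continuity the integrand stays above half of its value at t0 on a whole
    segment. *)
Lemma lint_gt0 B f (t0 : R) : cc1 B f -> (forall t, 0 <= f t) -> 0 < f t0 -> 0 < lint f.
Proof.
move=> cf f0 ft0; have c0 : 0 < f t0 / 2 by rewrite divr_gt0.
have /nbhs_ballP[d /= d0 Hd] := continuous_near_le (cf.1 t0) c0.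
have Hc t : t0 - d / 2 <= t <= t0 + d / 2 -> f t0 / 2 <= f t.
  move=> /andP[t1 t2]; have /Hd : ball t0 d t.
    rewrite -ball_normE /= ltr_norml; apply/andP; split; lra.
  rewrite ler_norml => /andP[_]; lra.
pose I : set R := `[t0 - d / 2, t0 + d / 2]%classic.
have iI : mu.-integrable I (EFin \o f) by apply: integrable_segment; exact: cf.1.
have cI : mu.-integrable I (EFin \o (cst (f t0 / 2) : R -> R)).
  by apply: integrable_segment => x; exact: cst_continuous.
apply: (@lt_le_trans _ _ (Rintegral mu I (cst (f t0 / 2)))).
  rewrite Rintegral_cst; last exact: measurable_itv.
  apply: mulr_gt0 => //.
  have ab : t0 - d / 2 < t0 + d / 2 by lra.
  apply: (@lt_le_trans _ _ (fine ((t0 + d / 2) - (t0 - d / 2))%:E)).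
    by rewrite /= subr_gt0.
  rewrite le_eqVlt; apply/orP; left; apply/eqP/esym; exact: (congr1 fine (length_segment ab)).
apply: (@le_trans _ _ (Rintegral mu I f)).
  apply: le_Rintegral => //; exact: measurable_itv.
rewrite Rintegral_mkcond; apply: le_Rintegral => //.
- by rewrite -restrict_EFin; apply: (integrable_mkcond _ _).1 => //; exact: measurable_itv.
- exact: cc1_integrable cf.
- by move=> t _; rewrite patchE; case: ifP.
Qed.

Lemma derive1_shift (h x : R) : (fun t : R => t + h)^`()%classic x = 1.
Proof.
by rewrite derive1E deriveD//; first by rewrite derive_id derive_cst addr0.
Qed.

(** Substitution by a translation, whose derivative is 1. *)
Lemma segment_shift f (a b h : R) : a <= b -> continuous f ->
  Rintegral mu `[a + h, b + h]%classic f = Rintegral mu `[a, b]%classic (fun t => f (t + h)).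
Proof.
move=> ab cf.
have E : (fun t : R => t + h)^`()%classic = cst 1 by apply/funext => x; exact: derive1_shift.
have cs : continuous (fun t : R => t + h).
  by move=> x; apply: continuousD; [exact: cvg_id|exact: cst_continuous].
rewrite /Rintegral (@integration_by_substitution_increasing R (fun t => t + h)) //.
- congr fine; apply: eq_integral => t _; rewrite E.
  by congr (_%:E); rewrite -[RHS]mulr1.
- by move=> x y _ _; rewrite ltrD2r.
- by move=> x _; rewrite E; exact: cst_continuous.
- by rewrite E; exact: is_cvg_cst.
- by rewrite E; exact: is_cvg_cst.
- split.
  + by move=> x _; apply: derivableD.
  + by apply: cvg_at_right_filter; exact: cs.
  + by apply: cvg_at_left_filter; exact: cs.
- by apply: continuous_in_subspaceT => x _; exact: cf.
Qed.

Lemma lint_shift B f (h : R) : 0 < B -> cc1 B f -> lint (fun t => f (t + h)) = lint f.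
Proof.
move=> B0 cf; have [cf1 f0] := cf.
(* the segment [- B, B], written as the image of the translation *)
have H : f = f \_ `[(- B - h) + h, (B - h) + h]%classic.
  by rewrite !subrK; exact: cc1_restrict cf.
rewrite [RHS]/lint [in RHS]H -Rintegral_mkcond segment_shift//; last by rewrite lerD2r; lra.
rewrite Rintegral_mkcond; apply: eq_Rintegral => t _.
rewrite patchE; case: ifPn => //.
rewrite notin_setE /= in_itv /= => /negP; rewrite lerBrDr lerBlDr.
rewrite -ler_norml -ltNge; exact: f0.
Qed.

End LineIntegral.

(** * Iterated integrals of compactly supported functions *)

Lemma near_le_continuous {R : realType} (T : topologicalType) (f : T -> R) x :
  (forall e, 0 < e -> \forall z \near x, `|f x - f z| <= e) ->
  {for x, continuous f}.
Proof. by move=> H; apply/cvgrPdist_le => e e0; exact: H. Qed.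

Section IteratedIntegral.
Context {R : realType}.

(** The analogue of cc1 in dimension m: continuous, with support in the cube of
    half-side B. *)
Definition cc (m : nat) (B : R) (f : 'rV[R]_m -> R) :=
  continuous f /\ forall x : 'rV[R]_m, (exists i, B < `|x 0 i|) -> f x = 0.

Lemma ccW m (B B' : R) (f : 'rV[R]_m -> R) : B <= B' -> cc B f -> cc B' f.
Proof.
move=> BB' [cf f0]; split => // x [i xi]; apply: f0; exists i.
exact: le_lt_trans xi.
Qed.

Lemma ccD m (B : R) (f g : 'rV[R]_m -> R) : cc B f -> cc B g ->
  cc B (fun x => f x + g x).
Proof.
move=> [cf f0] [cg g0]; split; last by move=> x xi; rewrite f0// g0// addr0.
by move=> x; apply: continuousD; [exact: cf|exact: cg].
Qed.

Lemma ccZ m (B a : R) (f : 'rV[R]_m -> R) : cc B f -> cc B (fun x => a * f x).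
Proof.
move=> [cf f0]; split; last by move=> x xi; rewrite f0// mulr0.
by move=> x; apply: continuousM; [exact: cst_continuous|exact: cf].
Qed.

Lemma translation_continuous m (h : 'rV[R]_m) : continuous (fun x : 'rV[R]_m => x + h).
Proof.
move=> x; apply: (@continuousD _ _ _ (fun x : 'rV[R]_m => x) (fun=> h)); [exact: cvg_id|exact: cst_continuous].
Qed.

Lemma cc_translate m (B : R) (f : 'rV[R]_m -> R) h : cc B f ->
  cc (B + `|h|) (fun x => f (x + h)).
Proof.
move=> [cf f0]; split.
  move=> x; apply: (@continuous_comp _ _ _ (fun x : 'rV[R]_m => x + h) f); last exact: cf.
  exact: translation_continuous.
move=> x [i xi]; apply: f0; exists i; rewrite mxE.
have := ler_normD (x 0 i + h 0 i) (- h 0 i); rewrite addrK normrN => H.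
have := coord_norm_le h i; lra.
Qed.

Lemma near_swap_translate m (f : 'rV[R]_m -> R) (x : 'rV[R]_m) (e : R) :
  0 < e -> {for x, continuous f} ->
  \forall z \near x & h \near (0 : 'rV[R]_m), `|f (z + h) - f z| <= e.
Proof.
move=> e0 cf; have e2 : 0 < e / 2 by rewrite divr_gt0.
have /nbhs_ballP[d /= d0 Hd] := continuous_near_le cf e2.
have d2 : 0 < d / 2 by rewrite divr_gt0.
exists (ball x (d / 2), ball (0 : 'rV[R]_m) (d / 2)) => /=.
  by split; apply: nbhsx_ballx.
move=> [z h] /= [xz h0].
have xz' : ball x d z by apply: le_ball xz; lra.
have xzh : ball x d (z + h).
  move: xz h0; rewrite -!ball_normE /= sub0r normrN => xz h0.
  rewrite opprD addrA; apply: le_lt_trans (ler_normB _ _) _; lra.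
have := Hd _ xz'; have := Hd _ xzh; rewrite !ler_norml => /andP[? ?] /andP[? ?].
apply/andP; split; lra.
Qed.

(** Uniform continuity: the support is contained in a compact cube, and outside a
    slightly larger cube both values vanish. *)
Lemma cc_unif m (B : R) (f : 'rV[R]_m -> R) (e : R) : cc B f -> 0 < e ->
  exists2 d, 0 < d & forall x h, `|h| < d -> `|f (x + h) - f x| <= e.
Proof.
move=> [cf f0] e0.
have K : compact [set v : 'rV[R]_m | forall i, `[- (B + 1), B + 1]%classic (v 0 i)].
  by apply: (@rV_compact _ _ (fun=> `[- (B + 1), B + 1]%classic)) => i; exact: segment_compact.
have := (compact_near_coveringP _).1 K _ (nbhs (0 : 'rV[R]_m)) (fun h x => `|f (x + h) - f x| <= e).
have H x : [set v : 'rV[R]_m | forall i, `[- (B + 1), B + 1]%classic (v 0 i)] x ->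
    \forall z \near x & h \near (0 : 'rV[R]_m), `|f (z + h) - f z| <= e.
  by move=> _; exact: (near_swap_translate e0 (cf x)).
move=> /(_ (nbhs_filter _) H) /nbhs_ballP[d /= d0 Hd].
exists (Num.min d 1); first by rewrite lt_min d0 ltr01.
move=> x h; rewrite lt_min => /andP[hd h1].
have [xB|] := pselect (forall i, `|x 0 i| <= B + 1).
  apply: Hd; first by rewrite -ball_normE /= sub0r normrN.
  by move=> i; rewrite /= in_itv /= -ler_norml.
move=> /existsNP[i /negP]; rewrite -ltNge => xi.
rewrite !f0 ?subrr ?normr0 ?ltW//; first by exists i; lra.
exists i; rewrite mxE.
have := ler_normD (x 0 i + h 0 i) (- h 0 i); rewrite addrK normrN => H'.
have := coord_norm_le h i; lra.
Qed.

Definition slice m (f : 'rV[R]_m.+1 -> R) (t : R) : 'rV[R]_m -> R :=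
  fun y => f (row_mx (t%:M : 'M[R]_1) y : 'rV[R]_(1 + m)).

Lemma row_mxD m (s t : R) (y z : 'rV[R]_m) :
  (row_mx (s%:M : 'M[R]_1) y : 'rV[R]_(1 + m)) + row_mx (t%:M : 'M[R]_1) z =
  row_mx ((s + t)%:M : 'M[R]_1) (y + z).
Proof. by rewrite add_row_mx raddfD. Qed.

Lemma row_mx_head m (t : R) (y : 'rV[R]_m) :
  (row_mx (t%:M : 'M[R]_1) y : 'rV[R]_(1 + m)) 0 (lshift m (0 : 'I_1)) = t.
Proof. by rewrite row_mxEl mxE eqxx. Qed.

Lemma row_mx_norm_le m (t e : R) (y : 'rV[R]_m) : 0 <= e -> `|t| <= e -> `|y| <= e ->
  `|row_mx (t%:M : 'M[R]_1) y : 'rV[R]_(1 + m)| <= e.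
Proof.
move=> e0 te ye; apply: norm_row_le => // i; rewrite -(splitK i).
case: (fintype.split i) => j /=; rewrite ?row_mxEl ?row_mxEr.
  by rewrite mxE ord1 eqxx.
exact: le_trans (coord_norm_le _ _) ye.
Qed.

Lemma cc_slice m (B : R) (f : 'rV[R]_m.+1 -> R) t : cc B f -> cc B (slice f t).
Proof.
move=> cf; split; last first.
  move=> x [i xi]; apply: cf.2; exists (rshift 1 i : 'I_(1 + m)).
  by rewrite (@row_mxEr _ 1 1 m).
move=> y; apply: near_le_continuous => e e0.
have [d d0 Hd] := cc_unif cf e0.
apply/nbhs_ballP; exists d => //= z; rewrite -ball_normE /= => yz.
rewrite distrC /slice.
have -> : (row_mx (t%:M : 'M[R]_1) z : 'rV[R]_(1 + m)) =
    row_mx (t%:M : 'M[R]_1) y + row_mx (0%:M : 'M[R]_1) (z - y).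
  by rewrite row_mxD addr0 addrC subrK.
apply: Hd; apply: le_lt_trans yz; apply: row_mx_norm_le => //.
  by rewrite normr0.
by rewrite distrC.
Qed.

Lemma slice_vanish m (B : R) (f : 'rV[R]_m.+1 -> R) t : cc B f -> B < `|t| ->
  slice f t = fun=> 0.
Proof.
move=> [_ f0] Bt; apply/funext => y; apply: f0.
by exists (lshift m (0 : 'I_1)); rewrite row_mx_head.
Qed.

Lemma iter_S m (f : 'rV[R]_m.+1 -> R) :
  iterated_integral f = lint (fun t => iterated_integral (slice f t)).
Proof. by []. Qed.

Lemma iter0 m : iterated_integral (fun _ : 'rV[R]_m => 0) = 0.
Proof.
elim: m => [//|m IH]; rewrite iter_S.
have -> : (fun t : R => iterated_integral (slice (fun _ : 'rV[R]_m.+1 => 0) t)) = fun=> 0.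
  by apply/funext => t; exact: IH.
have c0 : cc1 1 (fun _ : R => 0 : R).
  by split => // x; exact: cst_continuous.
have -> : (fun _ : R => 0 : R) = (fun _ : R => 0 * 0) by rewrite mulr0.
by rewrite (lintZ 0 c0) mul0r.
Qed.

(** Additivity, homogeneity and the sup-norm bound have to be proved together, by
    induction on the dimension: continuity of the inner integrals, needed to
    integrate once more, uses all three in the lower dimension. *)
Definition linear_bounded m (B : R) : Prop :=
  [/\ forall f g, cc B f -> cc B g -> iterated_integral (fun x : 'rV[R]_m => f x + g x)
        = iterated_integral f + iterated_integral g,
      forall f a, cc B f -> iterated_integral (fun x : 'rV[R]_m => a * f x)
        = a * iterated_integral f &
      forall f e, cc B f -> 0 <= e -> (forall x : 'rV[R]_m, `|f x| <= e) ->
        `|iterated_integral f| <= (B *+ 2) ^+ m * e].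

(** The bound on inner integrals turns uniform continuity of the integrand into
    continuity of the inner integral. *)
Lemma slice_integral_cc1 m (B : R) (f : 'rV[R]_m.+1 -> R) : 0 < B ->
  linear_bounded m B -> cc B f -> cc1 B (fun t => iterated_integral (slice f t)).
Proof.
move=> B0 [ID IZ IB] cf; have B20 : 0 <= B *+ 2 by rewrite mulrn_wge0// ltW.
split; last by move=> t Bt; rewrite (slice_vanish cf Bt) iter0.
move=> t; apply/cvgrPdist_le => e e0.
pose e' := e / ((B *+ 2) ^+ m + 1).
have p0 : 0 < (B *+ 2) ^+ m + 1 by rewrite ltr_wpDl// exprn_ge0.
have e'0 : 0 < e' by rewrite divr_gt0.
have [d d0 Hd] := cc_unif cf e'0.
apply/nbhs_ballP; exists d => // s; rewrite /ball /= => ts.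
have E : iterated_integral (slice f t) - iterated_integral (slice f s) =
    iterated_integral (fun y => slice f t y + (-1) * slice f s y).
  rewrite ID; [|exact: cc_slice|by apply: ccZ; exact: cc_slice].
  by rewrite IZ ?mulN1r//; exact: cc_slice.
rewrite E; apply: (@le_trans _ _ ((B *+ 2) ^+ m * e')); last first.
  by rewrite /e' mulrA ler_pdivrMr// mulrC ler_pM2l// lerDl.
apply: IB; [|exact: ltW|].
  by apply: ccD; [|apply: ccZ]; exact: cc_slice.
move=> y; rewrite mulN1r /slice.
have -> : (row_mx (t%:M : 'M[R]_1) y : 'rV[R]_(1 + m)) =
    row_mx (s%:M : 'M[R]_1) y + row_mx ((t - s)%:M : 'M[R]_1) 0.
  by rewrite row_mxD addr0 addrC subrK.
apply: Hd; apply: le_lt_trans ts; apply: row_mx_norm_le => //.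
by rewrite normr0.
Qed.

Lemma iter_linear_bounded m (B : R) : 0 < B -> linear_bounded m B.
Proof.
move=> B0; have B20 : 0 <= B *+ 2 by rewrite mulrn_wge0// ltW.
elim: m => [|m LB].
  by split => //= f e _ e0 fe; rewrite mul1r.
have c1 (f : 'rV[R]_m.+1 -> R) : cc B f -> cc1 B (fun t => iterated_integral (slice f t)).
  exact: slice_integral_cc1.
have [ID IZ IB] := LB; split.
- move=> f g cf cg; rewrite !iter_S -(lintD (c1 _ cf) (c1 _ cg)).
  congr lint; apply/funext => t.
  by rewrite -ID; [|exact: cc_slice cf|exact: cc_slice cg].
- move=> f a cf; rewrite !iter_S -(lintZ a (c1 _ cf)).
  congr lint; apply/funext => t.
  by rewrite -IZ; [|exact: cc_slice cf].
- move=> f e cf e0 fe; rewrite iter_S exprS -mulrA.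
  apply: lint_bound => //; [exact: c1|by rewrite mulr_ge0// exprn_ge0|].
  by move=> t; apply: IB; [exact: cc_slice cf|by []|move=> y; exact: fe].
Qed.

Lemma iter_cc1 m (B : R) (f : 'rV[R]_m.+1 -> R) : 0 < B -> cc B f ->
  cc1 B (fun t => iterated_integral (slice f t)).
Proof.
by move=> B0; apply: slice_integral_cc1 => //; exact: iter_linear_bounded.
Qed.

Lemma iterD m (B : R) (f g : 'rV[R]_m -> R) : 0 < B -> cc B f -> cc B g ->
  iterated_integral (fun x => f x + g x) = iterated_integral f + iterated_integral g.
Proof. by move=> B0; have [+ _ _] := iter_linear_bounded m B0; apply. Qed.

Lemma iterZ m (B a : R) (f : 'rV[R]_m -> R) : 0 < B -> cc B f ->
  iterated_integral (fun x => a * f x) = a * iterated_integral f.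
Proof. by move=> B0; have [_ + _] := iter_linear_bounded m B0; apply. Qed.

Lemma iter_bound m (B e : R) (f : 'rV[R]_m -> R) : 0 < B -> cc B f -> 0 <= e ->
  (forall x, `|f x| <= e) -> `|iterated_integral f| <= (B *+ 2) ^+ m * e.
Proof. by move=> B0; have [_ _ +] := iter_linear_bounded m B0; apply. Qed.

Lemma iterB m (B : R) (f g : 'rV[R]_m -> R) : 0 < B -> cc B f -> cc B g ->
  iterated_integral (fun x => f x - g x) = iterated_integral f - iterated_integral g.
Proof.
move=> B0 cf cg; rewrite -mulN1r -(iterZ (-1) B0 cg) -(iterD B0 cf (ccZ (-1) cg)).
by congr iterated_integral; apply/funext => x; rewrite mulN1r.
Qed.

Lemma iter_sum m (B : R) (I : Type) (s : seq I) (f : I -> 'rV[R]_m -> R) : 0 < B ->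
  (forall i, cc B (f i)) ->
  cc B (fun x => \sum_(i <- s) f i x) /\
  iterated_integral (fun x => \sum_(i <- s) f i x) = \sum_(i <- s) iterated_integral (f i).
Proof.
move=> B0 cf; elim: s => [|a s [IHc IH]].
  have -> : (fun x : 'rV[R]_m => \sum_(i <- [::]) f i x) = fun=> 0.
    by apply/funext => x; rewrite big_nil.
  rewrite big_nil iter0; split => //; split => // x; exact: cst_continuous.
have -> : (fun x : 'rV[R]_m => \sum_(i <- a :: s) f i x) =
    fun x => f a x + \sum_(i <- s) f i x.
  by apply/funext => x; rewrite big_cons.
by rewrite big_cons (iterD B0 (cf a) IHc) IH; split => //; exact: ccD.
Qed.

Lemma iter_ge0 m (f : 'rV[R]_m -> R) : (forall x, 0 <= f x) -> 0 <= iterated_integral f.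
Proof.
elim: m f => [f f0|m IH f f0]; first exact: f0.
by rewrite iter_S; apply: lint_ge0 => t; apply: IH => y; exact: f0.
Qed.

(** In each variable the inner integral is nonnegative, and positive at the
    coordinate of x0. *)
Lemma iter_gt0 m (B : R) (f : 'rV[R]_m -> R) x0 : 0 < B -> cc B f ->
  (forall x, 0 <= f x) -> 0 < f x0 -> 0 < iterated_integral f.
Proof.
move=> B0; elim: m f x0 => [f x0 _ _|m IH f x0 cf f0 fx0].
  by rewrite (_ : x0 = 0)//; apply/rowP => -[].
rewrite iter_S; apply: (lint_gt0 (t0 := x0 0 0) (iter_cc1 B0 cf)).
  by move=> t; apply: iter_ge0 => y; exact: f0.
apply: (IH _ (rsubmx (x0 : 'rV[R]_(1 + m)))).
- exact: cc_slice.
- by move=> y; exact: f0.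
- rewrite /slice.
  have -> : (x0 0 0)%:M = lsubmx (x0 : 'rV[R]_(1 + m)) :> 'M[R]_1.
    apply/matrixP => i j; rewrite !mxE !ord1 eqxx mulr1n.
    by congr (x0 _ _); apply/val_inj.
  by rewrite hsubmxK.
Qed.

(** A translation along an axis moves either the outer variable or one of the
    inner ones. *)
Lemma iter_translate m (B h : R) (i : 'I_m) (f : 'rV[R]_m -> R) : 0 < B -> cc B f ->
  iterated_integral (fun x => f (x + h *: basis_vec i)) = iterated_integral f.
Proof.
move=> B0; elim: m i f => [[]//|m IH] i f cf.
have E (j : 'I_(1 + m)) : basis_vec j = match fintype.split j with
   | inl _ => row_mx (1%:M : 'M[R]_1) (0 : 'rV[R]_m)
   | inr k => row_mx (0%:M : 'M[R]_1) (basis_vec k) end :> 'rV[R]_(1 + m).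
  apply/rowP => l; rewrite -(splitK j) unsplitK -(splitK l).
  case: (fintype.split j) => k; case: (fintype.split l) => r /=;
    rewrite ?row_mxEl ?row_mxEr !mxE /= ?ord1 ?eq_lshift ?eq_rshift ?eq_lrshift ?eq_rlshift //.
rewrite !iter_S; move: (E i); case: (fintype.split _) => k bE.
  rewrite -(lint_shift h B0 (iter_cc1 B0 cf)); congr lint; apply/funext => t.
  congr iterated_integral; apply/funext => y; apply: (congr1 f).
  have : (row_mx (t%:M : 'M[R]_1) y : 'rV[R]_(1 + m)) + h *: (basis_vec (i : 'I_(1 + m)))
     = row_mx ((t + h)%:M : 'M[R]_1) y.
    by rewrite bE scale_row_mx scale_scalar_mx mulr1 scaler0 row_mxD addr0.
  exact.
congr lint; apply/funext => t; rewrite -[RHS](IH k _ (cc_slice t cf)).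
congr iterated_integral; apply/funext => y; apply: (congr1 f).
have : (row_mx (t%:M : 'M[R]_1) y : 'rV[R]_(1 + m)) + h *: (basis_vec (i : 'I_(1 + m)))
   = row_mx (t%:M : 'M[R]_1) (y + h *: basis_vec k).
  by rewrite bE scale_row_mx scale_scalar_mx mulr0 row_mxD addr0.
exact.
Qed.

(** Difference quotients have integral zero by translation invariance and converge
    uniformly to the partial derivative. *)
Lemma iter_partial m (B : R) (f : 'rV[R]_m -> R) i : 0 < B -> cc B f ->
  (forall x, derivable f x (basis_vec i)) ->
  cc B (fun x => 'D_(basis_vec i) f x) ->
  iterated_integral (fun x => 'D_(basis_vec i) f x) = 0.
Proof.
move=> B0 cf df cDf; apply/eqP; rewrite -normr_le0; apply/ler_addgt0Pr => e e0.
have B10 : 0 < B + 1 by rewrite addr_gt0.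
have p0 : 0 < ((B + 1) *+ 2) ^+ m by rewrite exprn_gt0// pmulrn_lgt0.
pose e' := e / ((B + 1) *+ 2) ^+ m.
have e'0 : 0 < e' by rewrite divr_gt0.
have [d d0 Hd] := cc_unif cDf e'0.
(* h <= 1 keeps the translate supported in the cube of half-side B + 1 *)
pose h := Num.min (d / 2) 1.
have h0 : 0 < h by rewrite lt_min ltr01 divr_gt0.
have h1 : h <= 1 by rewrite ge_min lexx orbT.
have hd : h < d by rewrite gt_min; apply/orP; left; lra.
have nb (s : R) : `|s *: basis_vec i : 'rV[R]_m| <= `|s|.
  apply: norm_row_le => // l; rewrite !mxE /= normrM.
  by case: (_ == i); rewrite ?normr0 ?normr1 ?mulr0 ?mulr1.
have cf1 : cc (B + 1) f by apply: ccW cf; rewrite lerDl.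
have cDf1 : cc (B + 1) (fun x => 'D_(basis_vec i) f x) by apply: ccW cDf; rewrite lerDl.
have cft : cc (B + 1) (fun x => f (x + h *: basis_vec i)).
  apply: ccW (cc_translate (h *: basis_vec i) cf); rewrite lerD2l.
  by apply: le_trans (nb h) _; rewrite gtr0_norm.
pose q x := h^-1 * (f (x + h *: basis_vec i) + (-1) * f x).
have cq : cc (B + 1) q by apply: ccZ; apply: ccD => //; apply: ccZ.
have Iq : iterated_integral q = 0.
  rewrite (iterZ _ B10 (ccD cft (ccZ (-1) cf1))) (iterD B10 cft (ccZ (-1) cf1)).
  by rewrite (iter_translate h i B0 cf) (iterZ _ B10 cf1) mulN1r subrr mulr0.
rewrite add0r -[X in `|X|]subr0 -Iq -(iterB B10 cDf1 cq).
have -> : e = ((B + 1) *+ 2) ^+ m * e' by rewrite /e' mulrC divfK// gt_eqF.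
apply: iter_bound => //; [|exact: ltW|].
  have := ccD cDf1 (ccZ (-1) cq).
  by under eq_fun do rewrite mulN1r.
move=> x; rewrite /q mulN1r.
have [s sh ->] := @partial_mean_value _ _ f x (basis_vec i) h (fun s _ => df _).
rewrite mulKf ?gt_eqF// distrC; apply: Hd.
apply: le_lt_trans (nb s) _; apply: le_lt_trans sh _.
by rewrite gtr0_norm.
Qed.

End IteratedIntegral.

(** * A flat function *)

Section FlatFunction.
Context {R : realType}.

(** The exponent k makes the family closed under differentiation:
    flat_exp k has derivative flat_exp k.+2 - k flat_exp k.+1. *)
Definition flat_exp (k : nat) (t : R) : R :=
  if 0 < t then t ^- k * expR (- t^-1) else 0.

Lemma flat_exp_gt0 k t : 0 < t -> 0 < flat_exp k t.
Proof. by move=> t0; rewrite /flat_exp t0 mulr_gt0 ?expR_gt0// invr_gt0 exprn_gt0. Qed.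

Lemma flat_exp_le0 k t : t <= 0 -> flat_exp k t = 0.
Proof. by rewrite /flat_exp ltNge => ->. Qed.

Lemma flat_exp_ge0 k t : 0 <= flat_exp k t.
Proof.
by have [t0|t0] := leP t 0; [rewrite flat_exp_le0|exact/ltW/flat_exp_gt0].
Qed.

(** From exp (1/t) >= (1/t)^(k+1) / (k+1)!. *)
Lemma flat_exp_bound k t : `|flat_exp k t| <= (k.+1)`!%:R * `|t|.
Proof.
have [t0|t0] := leP t 0; first by rewrite flat_exp_le0// normr0 mulr_ge0.
rewrite (ger0_norm (flat_exp_ge0 _ _)) (gtr0_norm t0) /flat_exp t0 expRN.
have tV : 0 <= t^-1 by rewrite invr_ge0 ltW.
have f0 : 0 < (k.+1)`!%:R :> R by rewrite ltr0n fact_gt0.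
have H := expR_ge1Dxn k tV.
have H1 : t^-1 ^+ k.+1 / (k.+1)`!%:R <= expR t^-1 by apply: le_trans H; rewrite lerDr.
have H2 : 0 < t^-1 ^+ k.+1 / (k.+1)`!%:R by rewrite divr_gt0// exprn_gt0// invr_gt0.
apply: (@le_trans _ _ (t ^- k * (t^-1 ^+ k.+1 / (k.+1)`!%:R)^-1)).
  by rewrite ler_pM2l ?invr_gt0 ?exprn_gt0// lef_pV2// posrE expR_gt0.
rewrite invfM invrK exprVn invrK exprS mulrA [t * _]mulrC mulKf; last first.
  by rewrite expf_neq0// gt_eqF.
by rewrite mulrC.
Qed.

(** Away from 0 this is a computation; at 0 the difference quotient of
    flat_exp k is flat_exp k.+1, which tends to 0. *)
Lemma flat_exp_is_derive k (t : R) :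
  is_derive t (1 : R) (flat_exp k) (flat_exp k.+2 t - k%:R * flat_exp k.+1 t).
Proof.
have [t0|t0|->] := ltgtP t 0.
- rewrite !flat_exp_le0 ?(ltW t0)// mulr0 subr0.
  apply: (@near_eq_is_derive R R R (fun=> 0)).
  by near=> s; rewrite flat_exp_le0// ltW//; near: s; exact: lt_nbhsl.
- apply: (@near_eq_is_derive R R R (fun t : R => t ^- k * expR (- t^-1))).
    by near=> s; rewrite /flat_exp ifT//; near: s; exact: lt_nbhsr.
  have tn0 : t != 0 by rewrite gt_eqF.
  have d1 : is_derive t 1 (fun s : R => s ^+ k) (k%:R * t ^+ k.-1).
    split; first exact: exprn_derivable.
    by rewrite exp_derive -![_ *: _]/(_ * _) mulr1.
  have d2 : is_derive t 1 (fun s : R => s ^- k) (- (t ^+ k) ^- 2 * (k%:R * t ^+ k.-1)).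
    have [d1d d1v] := d1.
    have tk0 : t ^+ k != 0 by rewrite expf_neq0.
    split; first exact: derivableV.
    by rewrite deriveV// d1v.
  have d3 : is_derive t 1 (fun s : R => - s^-1) (t ^- 2).
    have dV : derivable (fun s : R => s^-1) t 1 by apply: derivableV.
    split; first exact: derivableN.
    by rewrite deriveN// deriveV// derive_id -[_ *: 1]/(_ * 1) mulr1 opprK.
  have d4 : is_derive t 1 (fun s : R => expR (- s^-1)) (t ^- 2 * expR (- t^-1)).
    have [d3d d3v] := d3.
    have [ed ev] := is_derive_expR (- t^-1).
    have dd : derivable (expR \o (fun s : R => - s^-1)) t 1.
      apply/derivable1_diffP; apply: differentiable_comp; exact/derivable1_diffP.
    split; first exact: dd.
    have := derive1_comp d3d ed; rewrite !derive1E d3v ev => ->.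
    by rewrite mulrC.
  have [d2d d2v] := d2; have [d4d d4v] := d4.
  split; first exact: derivableM.
  rewrite deriveM// d2v d4v /flat_exp t0 -![_ *: _]/(_ * _).
  case: k {d1 d2 d2d d2v} => [|k]; first by rewrite !mul0r mulr0 mulr0 addr0 subr0 !expr0 invr1 mul1r.
  rewrite -pred_Sn; set E := expR _.
  have T0 : t ^+ k != 0 by rewrite expf_neq0.
  rewrite !exprS expr0 mulr1; move: (t ^+ k) T0 E => T T0 E; generalize (k.+1%:R : R) => K.
  by field; rewrite T0.
- have b0 (j : nat) : flat_exp j 0 = 0 :> R by rewrite flat_exp_le0.
  rewrite !b0 mulr0 subr0.
  have H : h^-1 *: ((flat_exp k \o shift 0) (h *: 1) - flat_exp k 0) @[h --> 0^'] --> (0 : R).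
    apply/cvgr0Pnorm_le => e e0.
    have c0 : 0 < (k.+2)`!%:R :> R by rewrite ltr0n fact_gt0.
    have ec : 0 < e / (k.+2)`!%:R by rewrite divr_gt0.
    near=> h.
    have hn0 : h != 0 by near: h; exact: nbhs_dnbhs_neq.
    rewrite /= b0 subr0 addr0 -[h *: 1]/(h * 1) mulr1.
    have -> : h^-1 *: flat_exp k h = flat_exp k.+1 h.
      rewrite /flat_exp; case: ifPn => _; last by rewrite scaler0.
      by rewrite -[_ *: _]/(_ * _) mulrA exprS invfM.
    apply: le_trans (flat_exp_bound _ _) _.
    rewrite mulrC -ler_pdivlMr//; near: h.
    by apply: dnbhs0_le.
  by split; [apply/cvg_ex; exists 0|apply/cvg_lim].
Unshelve. all: by end_near. Qed.

End FlatFunction.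

(** * Test functions and the fundamental lemma *)

Section TestFunctions.
Context {R : realType} {m : nat}.
Local Notation V := 'rV[R]_m.
Implicit Types (D K : set V) (x : V).

Lemma affine_coord_is_derive (i j : 'I_m) (c a : R) x :
  is_derive x (basis_vec j : V) (fun z : V => c * z 0 i + a) (c * (i == j)%:R).
Proof.
have d : derivable (fun z : V => z 0 i) x (basis_vec j) by exact: derivable_coord.
have dc : derivable (fun z : V => c * z 0 i) x (basis_vec j) by exact: derivableZ.
split; first by apply: derivableD; [exact: dc|exact: derivable_cst].
rewrite deriveD; [|exact: dc|exact: derivable_cst].
rewrite derive_cst addr0 [LHS](deriveZ c d) derive_coord mxE eqxx /=.
by [].
Qed.

Lemma flat_exp_coord_is_derive k (i j : 'I_m) (c a : R) x :
  is_derive x (basis_vec j : V) (fun z : V => flat_exp k (c * z 0 i + a))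
   ((flat_exp k.+2 (c * x 0 i + a) - k%:R * flat_exp k.+1 (c * x 0 i + a))
     * (c * (i == j)%:R)).
Proof.
have [dl vl] := affine_coord_is_derive i j c a x.
have [df vf] := flat_exp_is_derive k (c * x 0 i + a).
have dfl : differentiable (fun z : V => c * z 0 i + a) x.
  apply: differentiableD; last exact: differentiable_cst.
  by apply: differentiableZ; exact: differentiable_coord.
have dff : differentiable (flat_exp k) (c * x 0 i + a) by exact/derivable1_diffP.
have dc : differentiable (flat_exp k \o (fun z : V => c * z 0 i + a)) x.
  exact: differentiable_comp.
split; first exact: diff_derivable.
rewrite [LHS](deriveE _ dc) (diff_comp dfl dff) [LHS]/=.
rewrite -(deriveE (basis_vec j) dfl) vl -vf (deriveE (1 : R) dff).
rewrite -[X in 'd _ _ X = _]mulr1.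
rewrite [LHS]linearZ; exact: mulrC.
Qed.

Lemma Cr_on_flat_exp_coord r k (i : 'I_m) (c a : R) :
  Cr_on r [set: V] (fun z : V => flat_exp k (c * z 0 i + a)).
Proof.
elim: r k => [|r IH] k.
  split => // x _; apply: differentiable_continuous.
  apply: (@differentiable_comp _ _ _ _ (fun z : V => c * z 0 i + a)).
    apply: differentiableD; last exact: differentiable_cst.
    by apply: differentiableZ; exact: differentiable_coord.
  by apply/derivable1_diffP; have [] := flat_exp_is_derive k (c * x 0 i + a).
split; first by move=> x xT; exact: (Cr_on_continuous (IH k) xT).
move=> j; split; first by move=> x _; have [] := flat_exp_coord_is_derive k i j c a x.
have oT := @openT V.
have H := Cr_onM oT (Cr_onD oT (IH k.+2) (Cr_onM oT (Cr_on_cst r setT (- k%:R : R)) (IH k.+1)))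
   (Cr_on_cst r setT (c * (i == j)%:R : R)).
apply: Cr_on_eq H => // x _.
have [_ ->] := flat_exp_coord_is_derive k i j c a x.
by rewrite mulNr.
Qed.

(** A product of one-variable bumps, positive exactly on the open cube of
    half-side d about x0. *)
Definition cube_bump (x0 : V) (d : R) (x : V) : R :=
  \prod_i (flat_exp 0 (x 0 i - (x0 0 i - d)) * flat_exp 0 (x0 0 i + d - x 0 i)).

Lemma cube_bump_smooth x0 d : smooth_on [set: V] (cube_bump x0 d).
Proof.
move=> r; apply: Cr_on_prod; first exact: openT.
move=> i _; apply: Cr_onM; first exact: openT.
  apply: Cr_on_eq (Cr_on_flat_exp_coord r 0 i 1 (- (x0 0 i - d))) => [|x _]; first exact: openT.
  by rewrite mul1r.
apply: Cr_on_eq (Cr_on_flat_exp_coord r 0 i (-1) (x0 0 i + d)) => [|x _]; first exact: openT.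
by rewrite mulN1r addrC.
Qed.

Lemma cube_bump_ge0 x0 d x : 0 <= cube_bump x0 d x.
Proof. by apply: prodr_ge0 => i _; rewrite mulr_ge0// flat_exp_ge0. Qed.

Lemma cube_bump_gt0 x0 d : 0 < d -> 0 < cube_bump x0 d x0.
Proof.
move=> d0; apply: prodr_gt0 => i _; apply: mulr_gt0; apply: flat_exp_gt0.
  by rewrite opprB addrCA subrr addr0.
by rewrite addrAC subrr add0r.
Qed.

Lemma cube_bump_support x0 d x : 0 <= d -> cube_bump x0 d x != 0 -> `|x - x0| <= d.
Proof.
move=> d0 /prodf_neq0 H; apply: norm_row_le => // i; have := H i isT.
rewrite mulf_eq0 negb_or => /andP[h1 h2]; rewrite !mxE ler_norml.
apply/andP; split.
  rewrite leNgt; apply: contraNN h1 => h; rewrite flat_exp_le0//; lra.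
rewrite leNgt; apply: contraNN h2 => h; rewrite flat_exp_le0//; lra.
Qed.

Lemma closed_norm_ball_compact x0 d : compact [set x : V | `|x - x0| <= d].
Proof.
apply: bounded_closed_compact.
  exists (`|x0| + d); split; first by rewrite num_real.
  move=> M hM x /= xd; rewrite -(subrK x0 x).
  apply: le_trans (ler_normD _ _) _; lra.
have -> : [set x : V | `|x - x0| <= d] = (fun x : V => `|x - x0|) @^-1` [set t | t <= d] by [].
apply: closed_comp; last exact: closed_le.
move=> x _; apply: continuous_comp; last exact: norm_continuous.
exact: translation_continuous.
Qed.

Lemma compact_closed_rV K : compact K -> closed K.
Proof. by apply: compact_closed; exact: norm_hausdorff. Qed.

Lemma near_outside_compact K x : compact K -> ~ K x -> \forall z \near x, ~ K z.
Proof.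
move=> cK nKx; have oK : open (~` K) by apply: closed_openC; exact: compact_closed_rV.
exact: (open_nbhs_nbhs (conj oK nKx)).
Qed.

(** Off the compact set the functions vanish locally, so they are continuous
    everywhere, whatever their formulas mean outside D. *)
Lemma compact_support_cc D K : compact K -> K `<=` D ->
  exists2 B, 0 < B & forall u : V -> R,
    (forall x, D x -> {for x, continuous u}) -> (forall x, ~ K x -> u x = 0) ->
    cc B u.
Proof.
move=> cK KD; have [M [_ HM]] := compact_bounded cK.
pose B := `|M| + 1.
have B0 : 0 < B by rewrite ltr_wpDl.
exists B => // u cu u0; split.
  move=> x; have [Dx|nDx] := pselect (D x); first exact: cu.
  have nKx : ~ K x by move=> /KD.
  apply: (@near_eq_continuous _ _ (fun=> 0)); last exact: cst_continuous.
  by apply: filterS (near_outside_compact cK nKx) => z /u0 ->.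
move=> x [i xi]; apply: u0 => Kx.
have /= H := HM B _ _ Kx.
have MB : M < B by apply: le_lt_trans (ler_norm M) _; rewrite ltrDl.
have := coord_norm_le x i; have := H MB; lra.
Qed.

Lemma compact_support_partial K (u : V -> R) i : compact K ->
  (forall x, ~ K x -> u x = 0) ->
  (forall x, ~ K x -> derivable u x (basis_vec i) /\ 'D_(basis_vec i) u x = 0).
Proof.
move=> cK u0 x nKx.
have H : \forall z \near x, (fun=> 0) z = u z.
  by apply: filterS (near_outside_compact cK nKx) => z /u0 ->.
split.
  exact: near_eq_derivable H (derivable_cst _ _ _).
by rewrite -(near_eq_derive (basis_vec i) H) derive_cst.
Qed.

(** Compact support leaves no boundary terms, and makes the function continuous
    outside D as well. *)
Lemma iter_partial_compact D K (u : V -> R) i : open D -> compact K -> K `<=` D ->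
  Cr_on 1 D u -> (forall x, ~ K x -> u x = 0) ->
  iterated_integral (fun x => 'D_(basis_vec i) u x) = 0.
Proof.
move=> oD cK KD [cu Cu] u0.
have [B B0 ccB] := compact_support_cc cK KD.
apply: (iter_partial B0); first exact: ccB.
- move=> x; have [/KD Dx|nKx] := pselect (K x); first exact: (Cu i).1.
  by have [] := compact_support_partial i cK u0 nKx.
- apply: ccB; first exact: (Cu i).2.1.
  by move=> x nKx; have [] := compact_support_partial i cK u0 nKx.
Qed.

(** A bump supported where w stays positive. *)
Lemma fundamental_gt0 D (w : V -> R) x0 : open D ->
  (forall x, D x -> {for x, continuous w}) -> D x0 -> 0 < w x0 ->
  exists2 f : V -> R, test_on D f & 0 < iterated_integral (fun x => f x * w x).
Proof.
move=> oD cw Dx0 w0; have w2 : 0 < w x0 / 2 by rewrite divr_gt0.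
have nD : nbhs x0 D by apply: open_nbhs_nbhs; split.
have c0 := continuous_near_le (cw _ Dx0) w2.
have [d d0 Hd] : exists2 d, 0 < d & forall x, `|x - x0| <= d -> D x /\ 0 < w x.
  have /nbhs_ballP[d /= d0 Hd] := near_and3 nD c0 c0.
  exists (d / 2); first by rewrite divr_gt0.
  move=> x xd; have /Hd[Dx] : ball x0 d x.
    rewrite -ball_normE /= distrC; apply: le_lt_trans xd _; lra.
  by rewrite ler_norml => /andP[_ h1 _]; split => //; lra.
pose K := [set x : V | `|x - x0| <= d].
have cK : compact K := @closed_norm_ball_compact x0 d.
have KD : K `<=` D by move=> x /Hd[].
have b0 x : ~ K x -> cube_bump x0 d x = 0.
  by move=> nK; apply: contrapT => /eqP b; apply: nK; apply: cube_bump_support => //; exact: ltW.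
exists (cube_bump x0 d).
  by split; [exact: cube_bump_smooth|exists K].
have cf x : D x -> {for x, continuous (fun x => cube_bump x0 d x * w x)}.
  move=> Dx; apply: continuousM; last exact: cw.
  exact: (Cr_on_continuous (cube_bump_smooth x0 d 0)).
have [B B0 ccB] := compact_support_cc cK KD.
have ccf := ccB _ cf (fun x nK => etrans (congr1 (fun u => u * w x) (b0 x nK)) (mul0r _)).
apply: (iter_gt0 (x0 := x0) B0 ccf).
  move=> x; have [/Hd[_ wx]|/b0 ->] := pselect (K x); last by rewrite mul0r.
  by rewrite mulr_ge0 ?cube_bump_ge0// ltW.
by rewrite mulr_gt0 ?cube_bump_gt0.
Qed.

(** Apply fundamental_gt0 to w and to - w. *)
Lemma fundamental_lemma D (w : V -> R) : open D ->
  (forall x, D x -> {for x, continuous w}) ->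
  (forall f : V -> R, test_on D f -> iterated_integral (fun x => f x * w x) = 0) ->
  forall x, D x -> w x = 0.
Proof.
move=> oD cw H x Dx; apply/eqP; rewrite eq_le; apply/andP; split; rewrite leNgt; apply/negP => wx.
  have [f tf] := fundamental_gt0 oD cw Dx wx.
  by rewrite H// ltxx.
have cw' z : D z -> {for z, continuous (fun z => - w z)} by move=> Dz; apply: continuousN; exact: cw.
have wx' : 0 < - w x by rewrite oppr_gt0.
have [f tf] := fundamental_gt0 oD cw' Dx wx'.
have [fs [K [cK KD f0]]] := tf.
have [B B0 ccB] := compact_support_cc cK KD.
have ccf : cc B (fun x => f x * w x).
  apply: ccB; last by move=> z /f0 ->; rewrite mul0r.
  move=> z Dz; apply: continuousM; last exact: cw.
  exact: (Cr_on_continuous (fs 0)).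
have -> : (fun x => f x * - w x) = (fun x => (-1) * (f x * w x)).
  by apply/funext => z; rewrite mulN1r mulrN.
by rewrite (iterZ _ B0 ccf) H// mulr0 ltxx.
Qed.

End TestFunctions.

(** * Inner products and determinants *)

Section PositiveDefinite.
Context {R : realType} {m : nat}.
Implicit Types (A : 'M[R]_m) (u w : 'rV[R]_m).

Definition posdef A := forall u, u != 0 -> 0 < ip A u u.

Lemma ipDl A u u' w : ip A (u + u') w = ip A u w + ip A u' w.
Proof. by rewrite /ip !mulmxDl mxE. Qed.

Lemma ipZl A a u w : ip A (a *: u) w = a * ip A u w.
Proof. by rewrite /ip -!scalemxAl mxE. Qed.

Lemma ipDr A u w w' : ip A u (w + w') = ip A u w + ip A u w'.
Proof. by rewrite /ip linearD mulmxDr mxE. Qed.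

Lemma ipZr A a u w : ip A u (a *: w) = a * ip A u w.
Proof. by rewrite /ip linearZ -scalemxAr mxE. Qed.

Lemma ip0l A w : ip A 0 w = 0.
Proof. by rewrite /ip !mul0mx mxE. Qed.

Lemma ip0r A w : ip A w 0 = 0.
Proof. by rewrite /ip trmx0 mulmx0 mxE. Qed.

Lemma ipNl A u w : ip A (- u) w = - ip A u w.
Proof. by rewrite -scaleN1r ipZl mulN1r. Qed.

Lemma ipNr A u w : ip A u (- w) = - ip A u w.
Proof. by rewrite -scaleN1r ipZr mulN1r. Qed.

Lemma ipC A u w : A^T = A -> ip A u w = ip A w u.
Proof.
move=> sA; rewrite /ip; have -> : u *m A *m w^T = (w *m A *m u^T)^T.
  by rewrite !trmx_mul trmxK sA mulmxA.
by rewrite mxE.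
Qed.

Lemma ip_suml A (I : Type) (s : seq I) (P : pred I) (f : I -> 'rV[R]_m) w :
  ip A (\sum_(i <- s | P i) f i) w = \sum_(i <- s | P i) ip A (f i) w.
Proof.
by elim/big_rec2: _ => [|i a b _ <-]; rewrite ?ip0l// ipDl.
Qed.

Lemma ip_sumr A (I : Type) (s : seq I) (P : pred I) (f : I -> 'rV[R]_m) w :
  ip A w (\sum_(i <- s | P i) f i) = \sum_(i <- s | P i) ip A w (f i).
Proof.
by elim/big_rec2: _ => [|i a b _ <-]; rewrite ?ip0r// ipDr.
Qed.

Lemma posdef_unit A : posdef A -> A \in unitmx.
Proof.
move=> pA; rewrite unitmxE unitfE; apply/det0P => -[u u0 uA].
by have := pA _ u0; rewrite /ip uA mul0mx mxE ltxx.
Qed.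

(** The polynomial det (s + A) has no root s >= 0 and is monic in s, so it is
    positive at s = 0. *)
Lemma posdef_det_gt0 A : posdef A -> 0 < \det A.
Proof.
move=> pA; pose p := char_poly (- A).
have p0 : p.[0] = \det A.
  rewrite horner_coef0 char_poly_det -(scaleN1r A) detZ mulrA -exprMn mulN1r opprK.
  by rewrite expr1n mul1r.
(* a root s >= 0 would give u A = - s u for some u != 0 *)
have noroot s : 0 <= s -> ~~ root p s.
  move=> s0; rewrite -eigenvalue_root_char; apply/eigenvalueP => -[u uA u0].
  have := pA _ u0; have -> : ip A u u = - s * (u *m u^T) 0 0.
    by rewrite /ip -[A]opprK mulmxN uA -scaleNr -scalemxAl mxE.
  have : 0 <= (u *m u^T) 0 0.
    by rewrite mxE; apply: sumr_ge0 => i _; rewrite mxE -expr2 sqr_ge0.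
  move=> h1; rewrite mulNr oppr_gt0 ltNge => /negP; apply; exact: mulr_ge0.
have mp : p \is monic by exact: char_poly_monic.
have [b Hb] : exists b, forall x, b <= x -> lead_coef p <= p.[x].
  by apply: polyrcf.poly_pinfty_gt_lc; rewrite (monicP mp).
rewrite -p0 ltNge; apply/negP => p0le.
have b0 : 0 <= Num.max 0 b by rewrite le_max lexx.
have pb : 0 <= p.[Num.max 0 b].
  apply: le_trans (Hb _ _); first by rewrite (monicP mp).
  by rewrite le_max lexx orbT.
have [|s /andP[s0 _] rs] := @poly_ivt R p 0 (Num.max 0 b) b0.
  by rewrite p0le.
by have := noroot s s0; rewrite rs.
Qed.

End PositiveDefinite.

Section DeterminantDerivative.
Context {R : realType} {V : normedModType R}.

Lemma derive_bigsum (W : normedModType R) (I : Type) (s : seq I) (f : I -> V -> W) x v :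
  (forall i, derivable (f i) x v) ->
  derivable (fun z => \sum_(i <- s) f i z) x v /\
  'D_v (fun z => \sum_(i <- s) f i z) x = \sum_(i <- s) 'D_v (f i) x.
Proof.
move=> df; elim: s => [|a s [ds es]].
  have -> : (fun z => \sum_(i <- [::]) f i z) = cst 0 by apply/funext => z; rewrite big_nil.
  by rewrite derive_cst big_nil; split => //; exact: derivable_cst.
have -> : (fun z => \sum_(i <- a :: s) f i z) = f a + (fun z => \sum_(i <- s) f i z).
  by apply/funext => z; rewrite big_cons.
split; first by apply: derivableD; [exact: df|exact: ds].
by rewrite big_cons -es; apply: deriveD; [exact: df|exact: ds].
Qed.

Lemma derive_bigprod (I : finType) (f : I -> V -> R) x v :
  (forall i, derivable (f i) x v) ->
  derivable (fun z => \prod_i f i z) x v /\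
  'D_v (fun z => \prod_i f i z) x = \sum_i 'D_v (f i) x * \prod_(j | j != i) f j x.
Proof.
move=> df.
pose g (s : seq I) z := \prod_(i <- s) f i z.
have H (s : seq I) : uniq s -> derivable (g s) x v /\
   'D_v (g s) x = \sum_(i <- s) 'D_v (f i) x * \prod_(j <- s | j != i) f j x.
  elim: s => [_|a s IH /= /andP[nas us]].
    have -> : g [::] = cst 1 by apply/funext => z; rewrite /g big_nil.
    by rewrite derive_cst big_nil; split => //; exact: derivable_cst.
  have [ds es] := IH us.
  have E : g (a :: s) = f a * g s.
    by apply/funext => z; rewrite /g big_cons.
  rewrite E; split; first exact: derivableM.
  rewrite deriveM; [|exact: df|exact: ds].
  rewrite es big_cons addrC; congr (_ + _).
    rewrite -[_ *: _]/(_ * _) mulrC; congr (_ * _).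
    rewrite big_cons eqxx /= /g [LHS]big_seq_cond [RHS]big_seq_cond.
    apply: eq_bigl => j; rewrite andbT; case: (boolP (j \in s)) => //= js.
    by apply/esym; apply: contraNneq nas => <-.
  rewrite -[_ *: _]/(_ * _) mulr_sumr !big_seq; apply: eq_bigr => i si.
  rewrite big_cons ifT; first by rewrite mulrCA.
  by apply: contraNneq nas => ->.
have [d e] := H (index_enum I) (index_enum_uniq I).
by split.
Qed.

(** Jacobi's formula. By the Leibniz rule the derivative is a sum over i of
    determinants of A with row i replaced by its derivative; expanding each along
    that row gives the adjugate. *)
Lemma derive_det p (A : V -> 'M[R]_p) x v : derivable A x v ->
  derivable (fun z => \det (A z)) x v /\
  'D_v (fun z => \det (A z)) x = \tr (\adj (A x) *m 'D_v A x).
Proof.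
move=> dA; have dA' := (derivable_mxP _ _ _).1 dA.
have dp s := derive_bigprod (f := fun i z => A z i ((s : 'S_p) i)) (fun i => dA' i (s i)).
have dm (s : 'S_p) : derivable (fun z => (-1) ^+ s * \prod_i A z i (s i)) x v.
  by apply: derivableZ; have [] := dp s.
have [ds es] := derive_bigsum (index_enum 'S_p) dm.
split; first exact: ds.
rewrite [LHS]es.
have eZ (s : 'S_p) : 'D_v (fun z => (-1) ^+ s * \prod_i A z i (s i)) x =
    \sum_i (-1) ^+ s * (('D_v A x) i (s i) * \prod_(j | j != i) A x j (s j)).
  have [d e] := dp s; rewrite [LHS](deriveZ _ d) e -[_ *: _]/(_ * _) mulr_sumr.
  by apply: eq_bigr => i _; rewrite (derive_mxE _ _ dA).
rewrite (eq_bigr _ (fun s _ => eZ s)).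
rewrite exchange_big mxtrace_mulC /mxtrace; apply: eq_bigr => i _.
(* A with its i-th row differentiated *)
pose B := \matrix_(r < p, c < p) (if r == i then ('D_v A x) i c else A x r c).
transitivity (\det B).
  rewrite /determinant; apply: eq_bigr => s _; congr (_ * _).
  rewrite [RHS](bigD1 i)//= mxE eqxx; congr (_ * _).
  by apply: eq_bigr => j ji; rewrite mxE (negPf ji).
rewrite (expand_det_row B i) mxE; apply: eq_bigr => k _.
rewrite !mxE eqxx; congr (_ * _); congr (_ * \det _).
by apply/matrixP => r c; rewrite !mxE eq_sym (negPf (neq_lift _ _)).
Qed.

End DeterminantDerivative.

(** * The Levi-Civita connection in a chart *)

Section SmoothClosure.
Context {R : realType} {m : nat}.
Local Notation V := 'rV[R]_m.
Implicit Types (D : set V).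

Lemma smooth_differentiable p q D (f : V -> 'M[R]_(p, q)) x :
  open D -> smooth_on D f -> D x -> differentiable f x.
Proof. by move=> oD sf; exact: C1_differentiable (sf 1%N). Qed.

Lemma smooth_derivable p q D (f : V -> 'M[R]_(p, q)) x v :
  open D -> smooth_on D f -> D x -> derivable f x v.
Proof. by move=> oD sf Dx; apply: diff_derivable; exact: smooth_differentiable Dx. Qed.

Lemma smooth_entry p q D (f : V -> 'M[R]_(p, q)) i j : open D ->
  smooth_on D f -> smooth_on D (fun x => f x i j).
Proof. by move=> oD sf r; exact: ((Cr_on_mxP _ _ oD).1 (sf r)). Qed.

Lemma smooth_mx p q D (f : V -> 'M[R]_(p, q)) : open D ->
  (forall i j, smooth_on D (fun x => f x i j)) -> smooth_on D f.
Proof. by move=> oD sf r; apply/Cr_on_mxP => // i j; exact: sf. Qed.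

Lemma smooth_mulmx p q r D (A : V -> 'M[R]_(p, q)) (B : V -> 'M[R]_(q, r)) :
  open D -> smooth_on D A -> smooth_on D B -> smooth_on D (fun x => A x *m B x).
Proof. by move=> oD sA sB k; exact: Cr_on_mulmx. Qed.

Lemma smoothD (W : normedModType R) D (f g : V -> W) : open D ->
  smooth_on D f -> smooth_on D g -> smooth_on D (fun x => f x + g x).
Proof. by move=> oD sf sg k; exact: Cr_onD. Qed.

Lemma smoothZ (W : normedModType R) D a (f : V -> W) : open D ->
  smooth_on D f -> smooth_on D (fun x => a *: f x).
Proof. by move=> oD sf k; exact: Cr_onZ. Qed.

Lemma smoothN (W : normedModType R) D (f : V -> W) : open D ->
  smooth_on D f -> smooth_on D (fun x => - f x).
Proof.
move=> oD sf k; apply: Cr_on_eq (smoothZ (-1) oD sf k) => // x _; exact: scaleN1r.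
Qed.

Lemma smoothM D (f g : V -> R) : open D ->
  smooth_on D f -> smooth_on D g -> smooth_on D (fun x => f x * g x).
Proof. by move=> oD sf sg k; exact: Cr_onM. Qed.

Lemma smooth_sum (W : normedModType R) (I : Type) (s : seq I) D (f : I -> V -> W) :
  open D -> (forall i, smooth_on D (f i)) -> smooth_on D (fun x => \sum_(i <- s) f i x).
Proof. by move=> oD sf k; apply: Cr_on_sum => // i _; exact: sf. Qed.

Lemma smooth_scale p q D (a : V -> R) (f : V -> 'M[R]_(p, q)) : open D ->
  smooth_on D a -> smooth_on D f -> smooth_on D (fun x => a x *: f x).
Proof.
move=> oD sa sf; apply: smooth_mx => // i j k.
apply: Cr_on_eq (smoothM oD sa (smooth_entry i j oD sf) k) => // x _.
by rewrite mxE.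
Qed.

Lemma smooth_eq (W : normedModType R) D (f g : V -> W) : open D ->
  (forall x, D x -> f x = g x) -> smooth_on D f -> smooth_on D g.
Proof. by move=> oD fg sf k; apply: Cr_on_eq (sf k) => // x; rewrite inE; exact: fg. Qed.

Lemma derivative_along_smooth p q D (X : V -> V) (f : V -> 'M[R]_(p, q)) : open D ->
  smooth_on D X -> smooth_on D f -> smooth_on D (fun x => 'D_(X x) f x).
Proof.
move=> oD sX sf.
apply: (@smooth_eq _ _ (fun x => \sum_i X x 0 i *: 'D_(basis_vec i) f x)) => //.
  by move=> x Dx; rewrite [RHS]derive_basis_sum//; exact: smooth_differentiable Dx.
apply: smooth_sum => // i; apply: smooth_scale => //; first exact: smooth_entry.
exact: smooth_partial.
Qed.

End SmoothClosure.

Section MetricChart.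
Context {R : realType} {m : nat}.
Local Notation V := 'rV[R]_m.
Implicit Types (D : set V) (G : V -> 'M[R]_m) (X Y Z : V -> V) (x u w : V).

Definition metric_on D G : Prop :=
  [/\ open D, smooth_on D G, forall x, D x -> (G x)^T = G x &
      forall x, D x -> posdef (G x)].

(** Connection matrices: the Levi-Civita connection differentiates a row Y of
    components in the i-th coordinate direction as dY/dx_i + Y *m conn G i x. *)
Definition conn G (i : 'I_m) x : 'M[R]_m := \matrix_(j, l) christoffel G x i j l.

Definition covi G (i : 'I_m) Y : V -> V :=
  fun x => 'D_(basis_vec i) Y x + Y x *m conn G i x.

Lemma metric_unit D G x : metric_on D G -> D x -> G x \in unitmx.
Proof. by move=> [_ _ _ pG] /pG; exact: posdef_unit. Qed.

Lemma metric_near_sym D G x : metric_on D G -> D x -> \near x, (G x)^T = G x.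
Proof.
move=> [oD _ sG _] Dx; have nD : nbhs x D by apply: open_nbhs_nbhs; split.
by near=> z; apply: sG; near: z.
Unshelve. all: by end_near.
Qed.

Lemma conn_torsion D G x i j l : metric_on D G -> D x ->
  conn G i x j l = conn G j x i l.
Proof.
move=> hG Dx; rewrite !mxE; apply: christoffel_torsion_free; exact: metric_near_sym hG Dx.
Qed.

Lemma conn_metric D G x i : metric_on D G -> D x ->
  'D_(basis_vec i) G x = conn G i x *m G x + G x *m (conn G i x)^T.
Proof.
move=> hG Dx; have [oD sG _ _] := hG.
apply/matrixP => a b.
have dG : derivable G x (basis_vec i) by exact: smooth_derivable Dx.
rewrite -(derive_mxE _ _ dG) mxE.
have := @christoffel_metric _ _ G x a b i (metric_near_sym hG Dx) (metric_unit hG Dx).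
rewrite /partial_metric => ->; rewrite !mxE -big_split /=.
by apply: eq_bigr => l _; rewrite !mxE [G x a l * _]mulrC.
Qed.

Lemma christoffel_formE G x u w :
  christoffel_form G x u w = \sum_i u 0 i *: (w *m conn G i x).
Proof.
apply/rowP => l; rewrite mxE summxE; apply: eq_bigr => i _.
by rewrite !mxE mulr_sumr; apply: eq_bigr => j _; rewrite !mxE mulrA.
Qed.

Lemma covE G X Y x : differentiable Y x ->
  cov G X Y x = \sum_i X x 0 i *: covi G i Y x.
Proof.
move=> dY; rewrite /cov derive_basis_sum// christoffel_formE -big_split /=.
by apply: eq_bigr => i _; rewrite scalerDr.
Qed.

Lemma invmx_smooth D G : metric_on D G -> smooth_on D (fun x => invmx (G x)).
Proof.
move=> hG r; have [oD sG _ _] := hG; apply: Cr_on_invmx => //.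
by move=> x; exact: metric_unit.
Qed.

Lemma conn_smooth D G i : metric_on D G -> smooth_on D (conn G i).
Proof.
move=> hG; have [oD sG _ _] := hG; apply: smooth_mx => // j l.
have sP a b c : smooth_on D (fun x => partial_metric G x a b c).
  exact/smooth_partial/smooth_entry.
have H : smooth_on D (fun x => 2^-1 * \sum_a invmx (G x) l a *
    (partial_metric G x i j a + partial_metric G x j i a
     - partial_metric G x a i j)).
  apply: (smoothZ (2^-1 : R)) => //; apply: smooth_sum => // a.
  apply: smoothM => //; first exact/smooth_entry/invmx_smooth.
  apply: smoothD => //; last exact: smoothN.
  exact: smoothD.
by apply: smooth_eq H => // x _; rewrite mxE.
Qed.

Lemma covi_smooth D G i Y : metric_on D G -> smooth_on D Y -> smooth_on D (covi G i Y).
Proof.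
move=> hG sY; have [oD sG _ _] := hG; apply: smoothD => //; first exact: smooth_partial.
by apply: smooth_mulmx => //; exact: conn_smooth.
Qed.

Lemma cov_smooth D G X Y : metric_on D G -> smooth_on D X -> smooth_on D Y ->
  smooth_on D (cov G X Y).
Proof.
move=> hG sX sY; have [oD sG _ _] := hG.
apply: (@smooth_eq _ _ _ _ (fun x => \sum_i X x 0 i *: covi G i Y x)) => //.
  by move=> x Dx; rewrite covE//; exact: smooth_differentiable Dx.
apply: smooth_sum => // i; apply: smooth_scale => //; first exact: smooth_entry.
exact: covi_smooth.
Qed.

(** Differentiate invmx G *m G = 1. *)
Lemma derive_invmx D G x i : metric_on D G -> D x ->
  'D_(basis_vec i) (fun z => invmx (G z)) x =
  - (invmx (G x) *m conn G i x + (conn G i x)^T *m invmx (G x)).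
Proof.
move=> hG Dx; have [oD sG _ _] := hG.
have uG := metric_unit hG Dx.
have dI : derivable (fun z => invmx (G z)) x (basis_vec i).
  exact: smooth_derivable (invmx_smooth hG) Dx.
have dG : derivable G x (basis_vec i) by exact: smooth_derivable Dx.
have E : 'D_(basis_vec i) (fun z => invmx (G z) *m G z) x = 0.
  rewrite (near_eq_derive (g := fun=> 1%:M)); first by rewrite derive_cst.
  have nD : nbhs x D by apply: open_nbhs_nbhs; split.
  by apply: filterS nD => z /(metric_unit hG) /mulVmx.
move: E; rewrite (derive_mulmx dI dG) => /(congr1 (fun A => A *m invmx (G x))).
rewrite mul0mx mulmxDl -mulmxA (mulmxV uG) mulmx1 => /eqP.
rewrite addr_eq0 => /eqP ->; congr (- _).
rewrite (conn_metric i hG Dx) mulmxDr mulmxDl !mulmxA (mulVmx uG) mul1mx; congr (_ + _).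
by rewrite mulmxK.
Qed.

Definition vol_density G x : R := Num.sqrt (\det (G x)).

Lemma vol_density_gt0 D G x : metric_on D G -> D x -> 0 < vol_density G x.
Proof. by move=> [_ _ _ pG] /pG /posdef_det_gt0; rewrite sqrtr_gt0. Qed.

(** Jacobi's formula and metric compatibility: d(log det G) = 2 tr conn. *)
Lemma vol_density_partial D G x i : metric_on D G -> D x ->
  derivable (vol_density G) x (basis_vec i) /\
  'D_(basis_vec i) (vol_density G) x = vol_density G x * \tr (conn G i x).
Proof.
move=> hG Dx; have [oD sG _ pG] := hG; have uG := metric_unit hG Dx.
have d0 : 0 < \det (G x) := posdef_det_gt0 (pG _ Dx).
have dG : derivable G x (basis_vec i) by exact: smooth_derivable Dx.
have [dd ed] := derive_det dG.
have diffd : differentiable (fun z => \det (G z)) x.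
  apply: (@C1_differentiable_scalar _ _ D) => //; exact: Cr_on_det.
have [ds es] := is_derive1_sqrt d0.
have diffs : differentiable (@Num.sqrt R) (\det (G x)) by exact/derivable1_diffP.
have diffv : differentiable (@Num.sqrt R \o (fun z => \det (G z))) x.
  exact: differentiable_comp.
split; first exact: diff_derivable.
rewrite [LHS](deriveE _ diffv) (diff_comp diffd diffs) [LHS]/=.
rewrite -(deriveE (basis_vec i) diffd) ed.
have -> : \tr (\adj (G x) *m 'D_(basis_vec i) G x) = \det (G x) * (2 * \tr (conn G i x)).
  rewrite (conn_metric i hG Dx) mulmxDr !mulmxA mul_adj_mx mxtraceD.
  rewrite mul_scalar_mx mxtraceZ mxtrace_tr.
  rewrite mxtrace_mulC mulmxA mul_mx_adj mul_scalar_mx mxtraceZ; ring.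
rewrite -[X in 'd _ _ X = _]mulr1 [LHS]linearZ.
rewrite -(deriveE (1 : R) diffs) es.
have s0 : vol_density G x != 0 by rewrite gt_eqF// (vol_density_gt0 hG Dx).
have {1}-> : \det (G x) = vol_density G x * vol_density G x.
  by rewrite -expr2 sqr_sqrtr// ltW.
rewrite -/(vol_density G x) -[LHS]/(_ * _); field.
exact: s0.
Qed.

End MetricChart.

(** * Codifferentials as divergences *)

Section Codifferential.
Context {R : realType} {m : nat}.
Local Notation V := 'rV[R]_m.
Implicit Types (D : set V) (G : V -> 'M[R]_m) (X : V -> V) (f u : V -> R).

Definition divergence G X : V -> R := fun x => \sum_i covi G i X x 0 i.

Lemma divergence_smooth D G X : metric_on D G -> smooth_on D X ->
  smooth_on D (divergence G X).
Proof.
move=> hG sX; have [oD _ _ _] := hG.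
by apply: smooth_sum => // i; apply: smooth_entry => //; exact: covi_smooth.
Qed.

(** By symmetry of the Christoffel symbols, tracing them over the upper index and
    the direction is the same as tracing the connection matrix. *)
Lemma divergenceE D G X x : metric_on D G -> D x ->
  divergence G X x =
  \sum_i ('D_(basis_vec i) X x 0 i + X x 0 i * \tr (conn G i x)).
Proof.
move=> hG Dx; rewrite /divergence /covi.
under eq_bigr do rewrite mxE.
rewrite !big_split /=; congr (_ + _).
under eq_bigr do rewrite mxE.
rewrite exchange_big; apply: eq_bigr => j _; rewrite -mulr_sumr; congr (_ * _).
by apply: eq_bigr => i _; exact: conn_torsion hG Dx.
Qed.

Lemma vol_density_C1 D G : metric_on D G -> Cr_on 1 D (vol_density G).
Proof.
move=> hG; have [oD sG _ _] := hG.
have sqc : forall x, D x -> {for x, continuous (vol_density G)}.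
  move=> x Dx; apply: (@continuous_comp _ _ _ (fun z => \det (G z)) Num.sqrt).
    exact: (Cr_on_continuous (Cr_on_det oD (sG 0%N)) Dx).
  exact: sqrt_continuous.
split => // i; split; first by move=> x Dx; have [] := vol_density_partial i hG Dx.
have H : Cr_on 0 D (fun x => vol_density G x * \sum_a conn G i x a a).
  apply: Cr_onM => //; apply: (@smooth_sum _ _ _ _ _ D (fun a x => conn G i x a a)) => // a.
  by apply: smooth_entry => //; exact: conn_smooth.
apply: Cr_on_eq H => // x; rewrite inE => Dx.
by have [_ ->] := vol_density_partial i hG Dx.
Qed.

Lemma test_zero_outside D f : test_on D f -> exists K : set V,
  [/\ compact K, K `<=` D, forall x, ~ K x -> f x = 0 &
      forall x i, ~ K x -> 'D_(basis_vec i) f x = 0].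
Proof.
move=> [_ [K [cK KD f0]]]; exists K; split => // x i nK.
by have [] := compact_support_partial i cK f0 nK.
Qed.

(** Green's formula: d_i (f X^i vol) = (X f + f div X) vol has integral zero. *)
Lemma vol_integral_divergence D G f X : metric_on D G -> test_on D f ->
  smooth_on D X ->
  vol_integral G (fun x => \sum_i 'D_(basis_vec i) f x * X x 0 i) =
  vol_integral G (fun x => f x * - divergence G X x).
Proof.
move=> hG tf sX; have [oD sG _ _] := hG.
have [K [cK KD f0 df0]] := test_zero_outside tf; have [sf _] := tf.
have sfD : smooth_on D f by move=> r; exact: Cr_on_sub (sf r).
have sXi i : smooth_on D (fun x => X x 0 i) by exact: smooth_entry.
have cvol := vol_density_C1 hG.
pose Phi i x := f x * X x 0 i * vol_density G x.
have CPhi i : Cr_on 1 D (Phi i) := Cr_onM oD (Cr_onM oD (sfD 1%N) (sXi i 1%N)) cvol.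
have I0 i : iterated_integral (fun x => 'D_(basis_vec i) (Phi i) x) = 0.
  apply: (iter_partial_compact i oD cK KD (CPhi i)).
  by move=> x /f0 fx; rewrite /Phi fx !mul0r.
pose A x := (\sum_i 'D_(basis_vec i) f x * X x 0 i) * vol_density G x.
pose B x := (f x * - divergence G X x) * vol_density G x.
have dPhi i x : D x -> 'D_(basis_vec i) (Phi i) x =
    ('D_(basis_vec i) f x * X x 0 i
     + f x * ('D_(basis_vec i) X x 0 i + X x 0 i * \tr (conn G i x))) * vol_density G x.
  move=> Dx; have df := ((sfD 1%N).2 i).1 x Dx.
  have dX : derivable X x (basis_vec i) by exact: smooth_derivable Dx.
  have dXi := ((sXi i 1%N).2 i).1 x Dx.
  have [dv ev] := vol_density_partial i hG Dx.
  rewrite [LHS](deriveM (derivableM df dXi) dv) ev (deriveM df dXi) (derive_mxE _ _ dX).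
  rewrite -![_ *: _]/(_ * _) !fctE; ring.
have [b b0 ccb] := compact_support_cc cK KD.
have sdf i : smooth_on D (fun x => 'D_(basis_vec i) f x) by exact: smooth_partial.
have cA : cc b A.
  apply: ccb.
    have sA := @smooth_sum _ _ _ _ (index_enum 'I_m) D _ oD (fun i => smoothM oD (sdf i) (sXi i)).
    exact: (Cr_onM oD (sA 0%N) (Cr_onW cvol)).1.
  by move=> x nK; rewrite /A big1 ?mul0r// => i _; rewrite df0// mul0r.
have cB : cc b B.
  apply: ccb.
    have sB := smoothM oD sfD (smoothN oD (divergence_smooth hG sX)).
    exact: (Cr_onM oD (sB 0%N) (Cr_onW cvol)).1.
  by move=> x nK; rewrite /B f0// !mul0r.
have P0 i z : ~ K z -> Phi i z = 0 by move=> /f0 fz; rewrite /Phi fz !mul0r.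
have cPhi i : cc b (fun x => 'D_(basis_vec i) (Phi i) x).
  apply: ccb; first exact: ((CPhi i).2 i).2.1.
  by move=> x nK; have [] := compact_support_partial i cK (P0 i) nK.
have AB : iterated_integral (fun x => A x - B x) = 0.
  have [_ E] := iter_sum (index_enum 'I_m) b0 cPhi.
  rewrite (eq_bigr (fun=> 0) (fun i _ => I0 i)) big1// in E.
  rewrite -[RHS]E; congr iterated_integral; apply/funext => x.
  have [/KD Dx|nK] := pselect (K x).
    rewrite (eq_bigr _ (fun i _ => dPhi i x Dx)) -mulr_suml big_split /= -mulr_sumr.
    rewrite -(divergenceE _ hG Dx) /A /B; ring.
  rewrite [RHS]big1; last first.
    by move=> i _; have [] := compact_support_partial i cK (P0 i) nK.
  rewrite /A /B f0// !mul0r subr0 big1 ?mul0r// => i _; rewrite df0// mul0r//.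
rewrite (iterB b0 cA cB) in AB.
by apply/eqP; rewrite -subr_eq0; apply/eqP.
Qed.

Lemma vol_integral_sum D K G (I : Type) (s : seq I) (a : I -> V -> R) :
  metric_on D G -> compact K -> K `<=` D ->
  (forall j x, D x -> {for x, continuous (a j)}) ->
  (forall j x, ~ K x -> a j x = 0) ->
  vol_integral G (fun x => \sum_(j <- s) a j x) = \sum_(j <- s) vol_integral G (a j).
Proof.
move=> hG cK KD ca a0; have [b b0 ccb] := compact_support_cc cK KD.
have cv : forall x, D x -> {for x, continuous (vol_density G)} := (vol_density_C1 hG).1.
have cca j : cc b (fun x => a j x * vol_density G x).
  apply: ccb; last by move=> x nK; rewrite a0// mul0r.
  by move=> x Dx; apply: continuousM; [exact: ca|exact: cv].
have [_ <-] := iter_sum s b0 cca.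
by congr iterated_integral; apply/funext => x; rewrite mulr_suml.
Qed.

(** The fundamental lemma, the volume density being positive. *)
Lemma vol_integral_unique D G u u' : metric_on D G ->
  (forall x, D x -> {for x, continuous u}) -> (forall x, D x -> {for x, continuous u'}) ->
  (forall f, test_on D f ->
    vol_integral G (fun x => f x * u x) = vol_integral G (fun x => f x * u' x)) ->
  forall x, D x -> u x = u' x.
Proof.
move=> hG cu cu' H; have [oD sG _ _] := hG.
have cv : forall x, D x -> {for x, continuous (vol_density G)} := (vol_density_C1 hG).1.
pose w x := (u x - u' x) * vol_density G x.
have cw x : D x -> {for x, continuous w}.
  move=> Dx; apply: continuousM; last exact: cv.
  by apply: continuousB; [exact: cu|exact: cu'].
move=> x Dx; have : w x = 0.
  apply: (fundamental_lemma oD cw) => // f tf.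
  have [K [cK KD f0 _]] := test_zero_outside tf; have [sf _] := tf.
  have cf z : {for z, continuous f} by exact: Cr_on_continuous (sf 0%N) I.
  have [b b0 ccb] := compact_support_cc cK KD.
  have cont (t : V -> R) : (forall z, D z -> {for z, continuous t}) ->
      cc b (fun z => f z * t z * vol_density G z).
    move=> ct; apply: ccb; last by move=> z /f0 ->; rewrite !mul0r.
    move=> z Dz; apply: continuousM; last exact: cv.
    by apply: continuousM; [exact: cf|exact: ct].
  transitivity (iterated_integral (fun z => f z * u z * vol_density G z
                                           - f z * u' z * vol_density G z)).
    by congr iterated_integral; apply/funext => z; rewrite /w -mulrBl -mulrBr mulrA.
  rewrite (iterB b0 (cont _ cu) (cont _ cu')); apply/eqP; rewrite subr_eq0; apply/eqP.
  exact: H tf.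
move=> /eqP; rewrite mulf_eq0 (gt_eqF (vol_density_gt0 hG Dx)) orbF subr_eq0.
by move/eqP.
Qed.

Lemma flat_ip_form1 D G X x (a : V) : metric_on D G -> D x ->
  ip_form1 (G x) a (flat G X x) = \sum_i a 0 i * X x 0 i.
Proof.
move=> hG Dx; have [_ _ sG _] := hG.
rewrite /ip_form1 /flat trmx_mul (sG _ Dx) mulmxA mulmxKV ?(metric_unit hG Dx)//.
by rewrite mxE; apply: eq_bigr => i _; rewrite mxE.
Qed.

(** The adjoint of d on functions. The choice in codiff1 is harmless, as two
    adjoints agree on D. *)
Lemma codiff1E D G X x : metric_on D G -> smooth_on D X -> D x ->
  codiff1 D G (flat G X) x = - divergence G X x.
Proof.
move=> hG sX Dx; have [oD sG _ _] := hG.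
have sdiv := smoothN oD (divergence_smooth hG sX).
pose P := [set u : V -> R | smooth_on D u /\
    forall f : V -> R, test_on D f ->
      vol_integral G (fun x => ip_form1 (G x) (d0 f x) (flat G X x)) =
      vol_integral G (fun x => f x * u x)].
have lhs f : test_on D f ->
    vol_integral G (fun x => ip_form1 (G x) (d0 f x) (flat G X x)) =
    vol_integral G (fun x => \sum_i 'D_(basis_vec i) f x * X x 0 i).
  move=> tf; have [K [_ KD _ df0]] := test_zero_outside tf.
  congr iterated_integral; apply/funext => z; congr (_ * _).
  have [/KD Dz|nK] := pselect (K z).
    by rewrite (flat_ip_form1 _ _ hG Dz); apply: eq_bigr => i _; rewrite mxE.
  have -> : d0 f z = 0 by apply/rowP => i; rewrite !mxE df0.
  by rewrite /ip_form1 !mul0mx mxE big1// => i _; rewrite df0// mul0r.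
have P0 : P (fun x => - divergence G X x).
  by split => // f tf; rewrite (lhs f tf); exact: vol_integral_divergence hG tf sX.
have [sc Hc] : P (codiff1 D G (flat G X)) by exact: (xgetI _ P0).
apply: (@vol_integral_unique D G _ (fun x => - divergence G X x) hG _ _ _ x Dx).
- by move=> z Dz; exact: Cr_on_continuous (sc 0%N) Dz.
- by move=> z Dz; exact: Cr_on_continuous (sdiv 0%N) Dz.
- by move=> f tf; rewrite -(Hc f tf) (P0.2 f tf).
Qed.

Definition raise2 G (w : V -> 'M[R]_m) : V -> 'M[R]_m :=
  fun x => invmx (G x) *m w x *m invmx (G x).

(** The divergence of a bivector field, column by column: for a skew W this is the
    covariant divergence, the Christoffel terms in the other index cancelling. *)
Definition divergence2 G (W : V -> 'M[R]_m) : V -> V :=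
  fun x => \row_j divergence G (fun z => (col j (W z))^T) x.

Lemma raise2_smooth D G w : metric_on D G -> smooth_on D w -> smooth_on D (raise2 G w).
Proof.
move=> hG sw; have [oD _ _ _] := hG.
exact: smooth_mulmx oD (smooth_mulmx oD (invmx_smooth hG) sw) (invmx_smooth hG).
Qed.

Lemma invmx_sym D G x : metric_on D G -> D x -> (invmx (G x))^T = invmx (G x).
Proof. by move=> [_ _ sG _] /sG E; rewrite trmx_inv E. Qed.

Lemma raise2_skew D G w x : metric_on D G -> D x -> (w x)^T = - w x ->
  (raise2 G w x)^T = - raise2 G w x.
Proof.
move=> hG Dx skw; rewrite /raise2 !trmx_mul (invmx_sym hG Dx) skw.
by rewrite mulNmx mulmxN mulmxA.
Qed.

(** Skewness of w makes the two halves of d1 f contribute equally, which cancels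
    the factor 1/2. *)
Lemma ip_form2_d1 D G w (f : V -> V) x : metric_on D G -> D x ->
  (w x)^T = - w x -> (forall i, derivable f x (basis_vec i)) ->
  ip_form2 (G x) (d1 f x) (w x) =
  \sum_j \sum_i 'D_(basis_vec i) (fun z => f z 0 j) x * raise2 G w x i j.
Proof.
move=> hG Dx skw df; rewrite /ip_form2.
pose W := raise2 G w x.
pose F : 'M[R]_m := \matrix_(i, j) 'D_(basis_vec i) (fun z => f z 0 j) x.
have -> : d1 f x = F - F^T by apply/matrixP => i j; rewrite !mxE.
have WT : W^T = - W := raise2_skew hG Dx skw.
have -> : \tr (invmx (G x) *m (F - F^T) *m invmx (G x) *m (w x)^T) = \tr ((F - F^T) *m W^T).
  rewrite -!mulmxA mxtrace_mulC -!mulmxA /W /raise2 !trmx_mul (invmx_sym hG Dx).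
  by rewrite !mulmxA.
have -> : \tr ((F - F^T) *m W^T) = 2 * \tr (F *m W^T).
  have E : \tr (F^T *m W^T) = - \tr (F *m W^T).
    by rewrite -trmx_mul mxtrace_tr mxtrace_mulC WT mulmxN linearN opprK.
  by rewrite mulmxBl linearB /= E opprK mulr2n mulrDl mul1r.
rewrite mulrA mulVf ?pnatr_eq0// mul1r /mxtrace exchange_big.
apply: eq_bigr => i _; rewrite mxE; apply: eq_bigr => j _.
by rewrite !mxE.
Qed.

(** Only plain partial derivatives enter d1, so Green's formula applies to each
    component of the test form against a column of the raised 2-form. Testing
    with the forms f dx^a identifies the adjoint component by component. *)
Lemma codiff2E D G w x : metric_on D G -> smooth_on D w ->
  (forall z, D z -> (w z)^T = - w z) -> D x ->
  codiff2 D G w x = - divergence2 G (raise2 G w) x *m G x.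
Proof.
move=> hG sw skw Dx; have [oD sG symG _] := hG.
have sW := raise2_smooth hG sw.
have sWc j : smooth_on D (fun z => (col j (raise2 G w z))^T).
  apply: (smooth_mx oD) => i k.
  apply: (smooth_eq oD _ (smooth_entry k j oD sW)) => z _; by rewrite !mxE.
have sdiv2 : smooth_on D (divergence2 G (raise2 G w)).
  apply: (smooth_mx oD) => i k.
  by apply: (smooth_eq oD _ (divergence_smooth hG (sWc k))) => z _; rewrite mxE.
pose u0 z := - divergence2 G (raise2 G w) z *m G z.
have su0 : smooth_on D u0 := smooth_mulmx oD (smoothN oD sdiv2) sG.
pose P := [set u : V -> V | smooth_on D u /\
    forall f : V -> V, test_on D f ->
      vol_integral G (fun x => ip_form2 (G x) (d1 f x) (w x)) =
      vol_integral G (fun x => ip_form1 (G x) (f x) (u x))].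
have test_comp (f : V -> V) j : test_on D f -> test_on D (fun z => f z 0 j).
  move=> [sf [K [cK KD f0]]]; split; first exact: smooth_entry openT sf.
  by exists K; split => // z /f0 ->; rewrite mxE.
have P0 : P u0.
  split => // f tf.
  have tfj j := test_comp f j tf.
  have sXf j : vol_integral G (fun x => \sum_i 'D_(basis_vec i) (fun z => f z 0 j) x
       * (col j (raise2 G w x))^T 0 i) =
     vol_integral G (fun x => f x 0 j * - divergence G (fun z => (col j (raise2 G w z))^T) x).
    exact: vol_integral_divergence hG (tfj j) (sWc j).
  have [K [cK KD f0]] := tf.2.
  have sf r : Cr_on r [set: V] f := tf.1 r.
  have cfj j z : {for z, continuous (fun z => f z 0 j)}.
    exact: Cr_on_continuous ((tfj j).1 0%N) I.
  have dfj i j z : {for z, continuous (fun z => 'D_(basis_vec i) (fun z => f z 0 j) z)}.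
    exact: (((tfj j).1 1%N).2 i).2.1.
  have f0j j z : ~ K z -> f z 0 j = 0 by move=> /f0 ->; rewrite mxE.
  have df0 i j z : ~ K z -> 'D_(basis_vec i) (fun z => f z 0 j) z = 0.
    by move=> nK; have [] := compact_support_partial i cK (f0j j) nK.
  transitivity (vol_integral G (fun x => \sum_j \sum_i
      'D_(basis_vec i) (fun z => f z 0 j) x * (col j (raise2 G w x))^T 0 i)).
    congr iterated_integral; apply/funext => z; congr (_ * _).
    have [/KD Dz|nK] := pselect (K z).
      rewrite (ip_form2_d1 hG Dz (skw _ Dz)); last first.
        by move=> i; exact: ((sf 1%N).2 i).1.
      apply: eq_bigr => j _; apply: eq_bigr => i _; congr (_ * _).
      by rewrite !mxE.
    have -> : d1 f z = 0 by apply/matrixP => i j; rewrite !mxE !df0// subrr.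
    rewrite /ip_form2 mulmx0 !mul0mx mxtrace0 mulr0 big1// => j _.
    by rewrite big1// => i _; rewrite df0// mul0r.
  transitivity (vol_integral G (fun x => \sum_j
      f x 0 j * - divergence G (fun z => (col j (raise2 G w z))^T) x)); last first.
    congr iterated_integral; apply/funext => z; congr (_ * _).
    have [/KD Dz|nK] := pselect (K z); last first.
      by rewrite (f0 z nK) /ip_form1 !mul0mx mxE big1// => j _; rewrite mxE mul0r.
    rewrite [RHS](@flat_ip_form1 D G (fun z => - divergence2 G (raise2 G w) z) z _ hG Dz).
    by apply: eq_bigr => j _; rewrite !mxE.
  rewrite (vol_integral_sum _ hG cK KD); first last.
  - by move=> j z nK; rewrite big1// => i _; rewrite df0// mul0r.
  - move=> j z Dz.
    have H i : Cr_on 0 D (fun x => 'D_(basis_vec i) (fun z => f z 0 j) x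
        * (col j (raise2 G w x))^T 0 i).
      apply: (Cr_onM oD); last exact: smooth_entry oD (sWc j) 0%N.
      by split => // t _; exact: dfj.
    exact: (Cr_on_sum (index_enum 'I_m) (P := xpredT) oD (fun i _ => H i)).1 z Dz.
  rewrite (vol_integral_sum _ hG cK KD); first last.
  - by move=> j z nK; rewrite f0j// mul0r.
  - move=> j z Dz; apply: continuousM; first exact: cfj.
    exact: Cr_on_continuous (smoothN oD (divergence_smooth hG (sWc j)) 0%N) Dz.
  by apply: eq_bigr => j _; exact: sXf.
have [sc Hc] : P (codiff2 D G w) by exact: (xgetI _ P0).
have sI := invmx_smooth hG.
(* pairing with f dx^a picks out the a-th component of the raised form *)
have key a z : D z -> (codiff2 D G w z *m invmx (G z)) 0 a = (u0 z *m invmx (G z)) 0 a.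
  move=> Dz.
  have cont (u : V -> V) : smooth_on D u -> forall t, D t ->
      {for t, continuous (fun t => (u t *m invmx (G t)) 0 a)}.
    move=> su t Dt.
    exact: Cr_on_continuous (smooth_entry 0 a oD (smooth_mulmx oD su sI) 0%N) Dt.
  apply: (vol_integral_unique hG (cont _ sc) (cont _ su0) _ Dz) => f tf.
  have tfa : test_on D (fun z => f z *: basis_vec a : V).
    have [sf [K [cK KD f0]]] := tf; split; last first.
      by exists K; split => // t /f0 ->; rewrite scale0r.
    apply: (smooth_scale openT sf) => r; exact: Cr_on_cst.
  have E (u : V -> V) : vol_integral G (fun x => ip_form1 (G x) (f x *: basis_vec a) (u x))
     = vol_integral G (fun x => f x * (u x *m invmx (G x)) 0 a).
    have [K [_ KD f0 _]] := test_zero_outside tf.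
    congr iterated_integral; apply/funext => t; congr (_ * _).
    have [/KD Dt|nK] := pselect (K t); last first.
      by rewrite f0// scale0r mul0r /ip_form1 !mul0mx mxE.
    rewrite /ip_form1 -!scalemxAl mxE; congr (_ * _).
    rewrite -[in LHS](invmx_sym hG Dt) -mulmxA -trmx_mul -rowE !mxE.
    by [].
  by rewrite -!E -(Hc _ tfa) (P0.2 _ tfa).
have uG := metric_unit hG Dx.
rewrite -[LHS](mulmxKV uG) -[RHS](mulmxKV uG); congr (_ *m _).
by apply/rowP => a; exact: key.
Qed.

End Codifferential.

(** * Second covariant derivatives and curvature *)

Section Curvature.
Context {R : realType} {m : nat}.
Local Notation V := 'rV[R]_m.
Implicit Types (D : set V) (G : V -> 'M[R]_m) (X Y Z W : V -> V) (x : V).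

(** Second covariant derivative in two coordinate directions. *)
Definition hess G (i k : 'I_m) X : V -> V :=
  fun x => covi G i (covi G k X) x - \sum_a conn G i x k a *: covi G a X x.

(** Curvature matrices: the components of R(d_i, d_j)Z are Z *m curv_mx G i j x. *)
Definition curv_mx G (i j : 'I_m) x : 'M[R]_m :=
  'D_(basis_vec i) (conn G j) x - 'D_(basis_vec j) (conn G i) x
  + conn G j x *m conn G i x - conn G i x *m conn G j x.

Lemma partialC_mx p q D (f : V -> 'M[R]_(p, q)) x i j : open D -> smooth_on D f -> D x ->
  'D_(basis_vec i) (fun z => 'D_(basis_vec j) f z) x =
  'D_(basis_vec j) (fun z => 'D_(basis_vec i) f z) x.
Proof.
move=> oD sf Dx; apply/matrixP => a b.
have d k l : derivable (fun z => 'D_(basis_vec l) f z) x (basis_vec k).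
  exact: smooth_derivable oD (smooth_partial l sf) Dx.
have E k l : ('D_(basis_vec k) (fun z => 'D_(basis_vec l) f z) x) a b =
    'D_(basis_vec k) (fun z => 'D_(basis_vec l) (fun y => f y a b) z) x.
  rewrite -(derive_mxE _ _ (d k l)); apply: near_eq_derive.
  apply: (open_near_eq oD Dx) => z; rewrite inE => Dz.
  by rewrite (derive_mxE _ _ (smooth_derivable oD sf Dz)).
apply: (etrans (E i j)); apply: (etrans _ (esym (E j i))).
have Cf : Cr_on 2 D (fun z => f z a b) := smooth_entry a b oD sf 2%N.
exact: (partialC i j oD Cf Dx).
Qed.

(** The second partial derivatives and the mixed first-order terms are symmetric
    in i and j; what remains is the curvature matrix. *)
Lemma covi_commutator D G X x i j : metric_on D G -> smooth_on D X -> D x ->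
  covi G i (covi G j X) x - covi G j (covi G i X) x = X x *m curv_mx G i j x.
Proof.
move=> hG sX Dx; have [oD _ _ _] := hG.
have E k l : covi G k (covi G l X) x =
    'D_(basis_vec k) (fun z => 'D_(basis_vec l) X z) x
    + 'D_(basis_vec k) X x *m conn G l x + X x *m 'D_(basis_vec k) (conn G l) x
    + ('D_(basis_vec l) X x *m conn G k x + X x *m conn G l x *m conn G k x).
  have dX : derivable X x (basis_vec k) := smooth_derivable oD sX Dx.
  have dC : derivable (conn G l) x (basis_vec k) := smooth_derivable oD (conn_smooth l hG) Dx.
  have dDX : derivable (fun z => 'D_(basis_vec l) X z) x (basis_vec k) :=
    smooth_derivable oD (smooth_partial l sX) Dx.
  rewrite /covi [X in X + _](deriveD dDX (derivable_mulmx dX dC).1).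
  by rewrite (derive_mulmx dX dC) mulmxDl !addrA.
rewrite !E (partialC_mx i j oD sX Dx) /curv_mx.
rewrite !mulmxDr !mulmxN !mulmxA.
have gen (a b c d e f h : V) : a + b + c + (d + e) - (a + d + f + (b + h)) = c - f + e - h.
  by apply/rowP => l; rewrite !mxE; ring.
exact: gen.
Qed.

Lemma hess_commutator D G X x i j : metric_on D G -> smooth_on D X -> D x ->
  hess G i j X x - hess G j i X x = X x *m curv_mx G i j x.
Proof.
move=> hG sX Dx; rewrite -(covi_commutator i j hG sX Dx) /hess.
have -> : \sum_a conn G j x i a *: covi G a X x = \sum_a conn G i x j a *: covi G a X x.
  by apply: eq_bigr => a _; rewrite (conn_torsion _ _ _ hG Dx).
by rewrite opprB addrA subrK.
Qed.

Lemma covi_sum D G Y X x i : metric_on D G -> smooth_on D Y -> smooth_on D X -> D x ->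
  covi G i (cov G Y X) x =
  \sum_j ('D_(basis_vec i) Y x 0 j *: covi G j X x + Y x 0 j *: covi G i (covi G j X) x).
Proof.
move=> hG sY sX Dx; have [oD _ _ _] := hG.
have dc j : derivable (covi G j X) x (basis_vec i) := smooth_derivable oD (covi_smooth j hG sX) Dx.
have dY : derivable Y x (basis_vec i) := smooth_derivable oD sY Dx.
have dYj j := ((smooth_entry 0 j oD sY 1%N).2 i).1 x Dx.
have near_cov : \near x, cov G Y X x = \sum_j Y x 0 j *: covi G j X x.
  apply: (open_near_eq oD Dx) => z; rewrite inE => Dz.
  by rewrite covE//; exact: smooth_differentiable oD sX Dz.
have dt j : derivable (fun z => Y z 0 j *: covi G j X z) x (basis_vec i) /\
    'D_(basis_vec i) (fun z => Y z 0 j *: covi G j X z) x =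
    'D_(basis_vec i) Y x 0 j *: covi G j X x + Y x 0 j *: 'D_(basis_vec i) (covi G j X) x.
  have sE : smooth_on D (fun z => Y z 0 j *: covi G j X z).
    exact: smooth_scale oD (smooth_entry 0 j oD sY) (covi_smooth j hG sX).
  have dE : derivable (fun z => Y z 0 j *: covi G j X z) x (basis_vec i) := smooth_derivable oD sE Dx.
  split => //; apply/rowP => l; rewrite -(derive_mxE _ _ dE).
  rewrite [RHS]mxE [X in _ = X + _]mxE [X in _ = _ + X]mxE.
  have -> : (fun z => (Y z 0 j *: covi G j X z) 0 l) = (fun z => Y z 0 j) * (fun z => covi G j X z 0 l).
    by apply/funext => z; rewrite mxE.
  have dcl := (derivable_mxP _ _ _).1 (dc j) 0 l.
  rewrite (deriveM (dYj j) dcl) (derive_mxE _ _ dY) (derive_mxE _ _ (dc j)).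
  rewrite -![_ *: _]/(_ * _) /=; ring.
have [ds es] := derive_bigsum (index_enum 'I_m) (fun j => (dt j).1).
rewrite {1}/covi (near_eq_derive (basis_vec i) near_cov) [X in X + _]es.
rewrite (nbhs_singleton near_cov) mulmx_suml -big_split /=; apply: eq_bigr => j _.
by rewrite (dt j).2 -addrA -scalemxAl -scalerDr.
Qed.

(** The first-order terms of the iterated derivative are removed by the
    correction term, so the difference is tensorial in Y and Z. *)
Lemma cov_cov_hess D G Y Z X x : metric_on D G -> smooth_on D Y -> smooth_on D Z ->
  smooth_on D X -> D x ->
  cov G Y (cov G Z X) x - cov G (cov G Y Z) X x =
  \sum_i \sum_j (Y x 0 i * Z x 0 j) *: hess G i j X x.
Proof.
move=> hG sY sZ sX Dx; have [oD _ _ _] := hG.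
have dX : differentiable X x := smooth_differentiable oD sX Dx.
have dZ : differentiable Z x := smooth_differentiable oD sZ Dx.
have dZX : differentiable (cov G Z X) x := smooth_differentiable oD (cov_smooth hG sZ sX) Dx.
rewrite (covE _ _ dZX) (covE _ _ dX) (covE _ _ dZ).
have -> : \sum_j (\sum_i Y x 0 i *: covi G i Z x) 0 j *: covi G j X x =
    \sum_i \sum_j (Y x 0 i * covi G i Z x 0 j) *: covi G j X x.
  rewrite exchange_big; apply: eq_bigr => j _; rewrite summxE scaler_suml.
  by apply: eq_bigr => i _; rewrite mxE.
rewrite -sumrB; apply: eq_bigr => i _.
rewrite (covi_sum i hG sZ sX Dx) scaler_sumr -sumrB /hess.
under [RHS]eq_bigr do rewrite scalerBr.
rewrite [RHS]big_split [X in _ = _ + X]sumrN.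
have -> : \sum_j (Y x 0 i * Z x 0 j) *: (\sum_a conn G i x j a *: covi G a X x) =
   \sum_a (Y x 0 i * (Z x *m conn G i x) 0 a) *: covi G a X x.
  under eq_bigr do rewrite scaler_sumr.
  rewrite exchange_big; apply: eq_bigr => a _.
  rewrite mxE mulr_sumr scaler_suml; apply: eq_bigr => j _.
  by rewrite scalerA mulrA.
rewrite -sumrB; apply: eq_bigr => j _.
have gen (y d z zc : R) (u w : V) :
    y *: (d *: u + z *: w) - (y * (d + zc)) *: u = (y * z) *: w - (y * zc) *: u.
  by apply/rowP => l; rewrite !mxE; ring.
rewrite [covi G i Z x 0 j]mxE; exact: gen.
Qed.

Lemma cov_torsion_free D G Y Z x : metric_on D G -> smooth_on D Y -> smooth_on D Z -> D x ->
  cov G Y Z x - cov G Z Y x = bracket Y Z x.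
Proof.
move=> hG sY sZ Dx; rewrite /cov /bracket opprD addrACA.
suff -> : christoffel_form G x (Y x) (Z x) = christoffel_form G x (Z x) (Y x).
  by rewrite subrr addr0.
apply/rowP => l; rewrite !mxE exchange_big; apply: eq_bigr => i _; apply: eq_bigr => j _.
rewrite [Y x 0 j * _]mulrC; congr (_ * _).
have := conn_torsion j i l hG Dx; by rewrite !mxE.
Qed.

Lemma covDl G X X' Y x : differentiable Y x ->
  forall U, U x = X x + X' x -> cov G U Y x = cov G X Y x + cov G X' Y x.
Proof.
move=> dY U UE; rewrite !covE// -big_split /=; apply: eq_bigr => i _.
by rewrite UE mxE scalerDl.
Qed.

(** The bracket is the antisymmetrization of the correction terms in cov_cov_hess,
    because the connection is torsion free. *)
Lemma curvE D G X Y Z x : metric_on D G -> smooth_on D X -> smooth_on D Y ->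
  smooth_on D Z -> D x ->
  curv G X Y Z x = \sum_i \sum_j (X x 0 i * Y x 0 j) *: (Z x *m curv_mx G i j x).
Proof.
move=> hG sX sY sZ Dx; have [oD _ _ _] := hG.
have dZ : differentiable Z x := smooth_differentiable oD sZ Dx.
have hXY := cov_cov_hess hG sX sY sZ Dx.
have hYX := cov_cov_hess hG sY sX sZ Dx.
have E : cov G (cov G X Y) Z x = cov G (bracket X Y) Z x + cov G (cov G Y X) Z x.
  by apply: covDl dZ _ _; rewrite -(cov_torsion_free hG sX sY Dx) subrK.
transitivity ((cov G X (cov G Y Z) x - cov G (cov G X Y) Z x)
  - (cov G Y (cov G X Z) x - cov G (cov G Y X) Z x)).
  have gen (a b c d : V) : a - b - c = (a - (c + d)) - (b - d).
    by apply/rowP => l; rewrite !mxE; ring.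
  by rewrite E; exact: gen.
rewrite hXY hYX [X in _ - X]exchange_big -sumrB; apply: eq_bigr => i _.
rewrite -sumrB; apply: eq_bigr => j _.
by rewrite -(hess_commutator i j hG sZ Dx) [Y x 0 j * _]mulrC -scalerBr.
Qed.

End Curvature.

(** * Symmetries of the curvature tensor *)

(** Four instances of the Bianchi identity, one for each index left out of the
    cyclic sum, combine to twice the claim. *)
Lemma curvature_pair_symmetry {R : realType} (I : Type) (f : I -> I -> I -> I -> R) :
  (forall i j k l, f i j k l = - f j i k l) ->
  (forall i j k l, f i j k l = - f i j l k) ->
  (forall i j k l, f i j k l + f j k i l + f k i j l = 0) ->
  forall i j k l, f i j k l = f k l i j.
Proof.
move=> s12 s34 B i j k l.
have B1 := B i j k l; have B2 := B j k l i; have B3 := B k l i j; have B4 := B l i j k.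
rewrite (s34 j k l i) (s34 k l j i) (s12 l j k i) in B2.
rewrite (s12 l i k j) (s34 i l k j) opprK (s12 i k l j) (s34 k i l j) opprK in B3.
rewrite (s12 l i j k) (s34 i j l k) (s34 j l i k) in B4.
lra.
Qed.

(** Both sides of curv_mx_skew regrouped as a difference of two second derivatives
    of the metric. *)
Lemma skew_expansion {R : realType} m (a b C E G : 'M[R]_m) :
  (a - b + E *m C - C *m E) *m G + G *m (a - b + E *m C - C *m E)^T =
  a *m G + E *m (C *m G + G *m C^T) + ((C *m G + G *m C^T) *m E^T + G *m a^T)
  - (b *m G + C *m (E *m G + G *m E^T) + ((E *m G + G *m E^T) *m C^T + G *m b^T)).
Proof.
have tD (A B : 'M[R]_m) : (A + B)^T = A^T + B^T by apply/matrixP => i j; rewrite !mxE.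
have tN (A : 'M[R]_m) : (- A)^T = - A^T by apply/matrixP => i j; rewrite !mxE.
rewrite !tD !tN !trmx_mul !(mulmxDl, mulmxDr, mulNmx, mulmxN, mulmxA).
have gen (p q r s t u v w y z : 'M[R]_m) :
   p - q + r - s + (t - u + v - w) =
   p + (r + y) + (z + v + t) - (q + (s + z) + (y + w + u)).
  by apply/matrixP => i j; rewrite !mxE; ring.
exact: gen.
Qed.

Lemma ipE {R : realType} m (A : 'M[R]_m) (u w : 'rV[R]_m) :
  ip A u w = \sum_k \sum_l u 0 k * A k l * w 0 l.
Proof.
rewrite /ip mxE exchange_big; apply: eq_bigr => l _.
by rewrite !mxE mulr_suml.
Qed.

Lemma exchange_pairs_big {R : realType} (I : finType) (F : I -> I -> I -> I -> R) :
  \sum_i \sum_j \sum_k \sum_l F i j k l = \sum_k \sum_l \sum_i \sum_j F i j k l.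
Proof.
transitivity (\sum_i \sum_k \sum_j \sum_l F i j k l).
  by apply: eq_bigr => i _; exact: exchange_big.
rewrite exchange_big; apply: eq_bigr => k _.
transitivity (\sum_i \sum_l \sum_j F i j k l).
  by apply: eq_bigr => i _; exact: exchange_big.
exact: exchange_big.
Qed.

Section CurvatureSymmetries.
Context {R : realType} {m : nat}.
Local Notation V := 'rV[R]_m.
Implicit Types (D : set V) (G : V -> 'M[R]_m) (X Y Z W : V -> V) (x : V).

Definition riem4 G x (i j k l : 'I_m) : R := (curv_mx G i j x *m G x) k l.

Lemma curv_mx_antisym G x i j : curv_mx G i j x = - curv_mx G j i x.
Proof.
have gen (a b c d : 'M[R]_m) : a - b + c - d = - (b - a + d - c).
  by apply/matrixP => k l; rewrite !mxE; ring.
exact: gen.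
Qed.

Lemma riem4_antisym12 G x i j k l : riem4 G x i j k l = - riem4 G x j i k l.
Proof. by rewrite /riem4 curv_mx_antisym mulNmx mxE. Qed.

(** Differentiating dG = C G + G C^T once more, the symmetric second derivatives of
    G cancel and leave the skewness of the curvature. *)
Lemma curv_mx_skew D G x i j : metric_on D G -> D x ->
  curv_mx G i j x *m G x = - (G x *m (curv_mx G i j x)^T).
Proof.
move=> hG Dx; have [oD sG _ _] := hG.
have dG k : derivable G x (basis_vec k) by exact: smooth_derivable oD sG Dx.
have dC k l : derivable (conn G l) x (basis_vec k) by exact: smooth_derivable oD (conn_smooth l hG) Dx.
have E k l : 'D_(basis_vec k) (fun z => 'D_(basis_vec l) G z) x =
   'D_(basis_vec k) (conn G l) x *m G x
   + conn G l x *m (conn G k x *m G x + G x *m (conn G k x)^T)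
   + ((conn G k x *m G x + G x *m (conn G k x)^T) *m (conn G l x)^T
      + G x *m ('D_(basis_vec k) (conn G l) x)^T).
  have near_eq : \near x, 'D_(basis_vec l) G x = conn G l x *m G x + G x *m (conn G l x)^T.
    by apply: (open_near_eq oD Dx) => z; rewrite inE => Dz; exact: conn_metric l hG Dz.
  have dT := derivable_trmx (dC k l).
  have d1 := derivable_mulmx (dC k l) (dG k).
  have d2 := derivable_mulmx (dG k) dT.1.
  rewrite (near_eq_derive (basis_vec k) near_eq) [LHS](deriveD d1.1 d2.1) d1.2 d2.2 dT.2.
  by rewrite (conn_metric k hG Dx).
have S := etrans (esym (E i j)) (etrans (partialC_mx i j oD sG Dx) (E j i)).
apply/eqP; rewrite -addr_eq0; apply/eqP.
apply: (etrans (skew_expansion _ _ _ _ _)); apply/eqP; rewrite subr_eq0; apply/eqP.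
exact: S.
Qed.

Lemma riem4_antisym34 D G x i j k l : metric_on D G -> D x ->
  riem4 G x i j k l = - riem4 G x i j l k.
Proof.
move=> hG Dx; have [_ _ sG _] := hG.
have E : G x *m (curv_mx G i j x)^T = (curv_mx G i j x *m G x)^T.
  by rewrite trmx_mul (sG _ Dx).
by rewrite /riem4 {1}(curv_mx_skew i j hG Dx) E mxE [X in - X]mxE.
Qed.

(** Symmetry of the Christoffel symbols, and of their first derivatives, makes the
    cyclic sum cancel term by term. *)
Lemma curv_mx_bianchi D G x i j k : metric_on D G -> D x ->
  row k (curv_mx G i j x) + row i (curv_mx G j k x) + row j (curv_mx G k i x) = 0.
Proof.
move=> hG Dx; have [oD sG _ _] := hG.
have T a b z : D z -> row a (conn G b z) = row b (conn G a z).
  by move=> Dz; apply/rowP => l; rewrite !mxE; have := conn_torsion b a l hG Dz; rewrite !mxE.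
have DT a b c : row a ('D_(basis_vec c) (conn G b) x) = row b ('D_(basis_vec c) (conn G a) x).
  apply/rowP => l; rewrite [LHS]mxE [RHS]mxE.
  have dC d : derivable (conn G d) x (basis_vec c) by exact: smooth_derivable oD (conn_smooth d hG) Dx.
  apply: (etrans (esym (derive_mxE a l (dC b)))); apply: (etrans _ (derive_mxE b l (dC a))).
  apply: near_eq_derive.
  by apply: (open_near_eq oD Dx) => z; rewrite inE => Dz; exact: conn_torsion hG Dz.
have rD p (A B : 'M[R]_m) : row p (A + B) = row p A + row p B by apply/rowP => ?; rewrite !mxE.
have rN p (A : 'M[R]_m) : row p (- A) = - row p A by apply/rowP => ?; rewrite !mxE.
(* both families are symmetric in their first two indices *)
pose P a b c := row a ('D_(basis_vec c) (conn G b) x); pose Q a b := row a (conn G b x).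
have E a b c : row a (curv_mx G b c x) =
    P a c b - P a b c + Q a c *m conn G b x - Q a b *m conn G c x.
  by rewrite /curv_mx !rD !rN !row_mul.
have PS a b c : P a b c = P b a c by exact: DT.
have QS a b : Q a b = Q b a by exact: T.
clearbody P Q; rewrite !E (PS k j i) (PS k i j) (PS i k j) (QS k j) (QS k i) (QS i j) (PS j i k).
have gen (a b c d e f : V) : a - b + d - e + (b - c + e - f) + (c - a + f - d) = 0.
  by apply/rowP => l; rewrite !mxE; ring.
exact: gen.
Qed.

Lemma riem4_bianchi D G x i j k l : metric_on D G -> D x ->
  riem4 G x i j k l + riem4 G x j k i l + riem4 G x k i j l = 0.
Proof.
move=> hG Dx; pose lf (A : V) := (A *m G x) 0 l.
have lfD A B : lf (A + B) = lf A + lf B by rewrite /lf mulmxDl mxE.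
have rE a b c : riem4 G x a b c l = lf (row c (curv_mx G a b x)).
  by rewrite /lf -row_mul mxE.
by rewrite !rE -!lfD (curv_mx_bianchi i j k hG Dx) /lf mul0mx mxE.
Qed.

Lemma riem4_pair D G x i j k l : metric_on D G -> D x ->
  riem4 G x i j k l = riem4 G x k l i j.
Proof.
move=> hG Dx; apply: curvature_pair_symmetry => [????|????|????].
- exact: riem4_antisym12.
- exact: riem4_antisym34 hG Dx.
- exact: riem4_bianchi hG Dx.
Qed.

Lemma curv4E D G X Y Z W x : metric_on D G -> smooth_on D X -> smooth_on D Y ->
  smooth_on D Z -> D x ->
  curv4 G X Y Z W x =
  \sum_i \sum_j \sum_k \sum_l X x 0 i * Y x 0 j * Z x 0 k * W x 0 l * riem4 G x i j k l.
Proof.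
move=> hG sX sY sZ Dx; rewrite /curv4 (curvE hG sX sY sZ Dx).
rewrite ip_suml; apply: eq_bigr => i _; rewrite ip_suml; apply: eq_bigr => j _.
rewrite ipZl; have -> : ip (G x) (Z x *m curv_mx G i j x) (W x) =
    ip (curv_mx G i j x *m G x) (Z x) (W x) by rewrite /ip mulmxA.
rewrite ipE mulr_sumr; apply: eq_bigr => k _; rewrite mulr_sumr; apply: eq_bigr => l _.
rewrite -/(riem4 G x i j k l); ring.
Qed.

Lemma curv4_pair D G X Y Z W x : metric_on D G -> smooth_on D X -> smooth_on D Y ->
  smooth_on D Z -> smooth_on D W -> D x ->
  curv4 G X Y Z W x = curv4 G Z W X Y x.
Proof.
move=> hG sX sY sZ sW Dx; rewrite (curv4E _ hG sX sY sZ Dx) (curv4E _ hG sZ sW sX Dx).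
rewrite exchange_pairs_big; apply: eq_bigr => k _; apply: eq_bigr => l _.
apply: eq_bigr => i _; apply: eq_bigr => j _.
rewrite (riem4_pair i j k l hG Dx); ring.
Qed.

Lemma curv4_antisym34 D G X Y Z W x : metric_on D G -> smooth_on D X -> smooth_on D Y ->
  smooth_on D Z -> smooth_on D W -> D x ->
  curv4 G X Y Z W x = - curv4 G X Y W Z x.
Proof.
move=> hG sX sY sZ sW Dx; rewrite (curv4E _ hG sX sY sZ Dx) (curv4E _ hG sX sY sW Dx).
rewrite -sumrN; apply: eq_bigr => i _; rewrite -sumrN; apply: eq_bigr => j _.
rewrite exchange_big -sumrN; apply: eq_bigr => l _; rewrite -sumrN; apply: eq_bigr => k _.
rewrite (riem4_antisym34 i j k l hG Dx); ring.
Qed.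

End CurvatureSymmetries.

(** * The coderivative of the exterior derivative *)

(** The index computation behind divergence2_raise2: g is the inverse metric, C the
    Christoffel symbols, a the first covariant derivative of the field and da the
    partial derivatives of a; the derivatives of g are already expressed by C.
    Both sides are T1 + T3 - T2 - (T5 - T4). *)
Lemma divergence2_algebra {R : realType} (I : finType) (g : I -> I -> R)
    (C : I -> I -> I -> R) (a : I -> I -> R) (da : I -> I -> I -> R) j :
  (forall i k, g i k = g k i) -> (forall i b c, C i b c = C b i c) ->
  \sum_k (\sum_i da i k j * g k i + a k j * - \sum_i \sum_b C i b k * g b i)
  - \sum_k (\sum_i - (\sum_b g k b * C i b j + \sum_b C i b k * g b j) * a k i
            + g k j * \sum_i (da i k i + \sum_b a k b * C i b i)) =
  \sum_i \sum_k g i k * (da i k j + \sum_b a k b * C i b j - \sum_b C i k b * a b j)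
  - \sum_c (\sum_i (da i c i + \sum_b a c b * C i b i - \sum_b C i c b * a b i)) * g c j.
Proof.
move=> gS CS.
pose T1 := \sum_i \sum_k g i k * da i k j.
pose T2 := \sum_i \sum_k g i k * \sum_b C i k b * a b j.
pose T3 := \sum_i \sum_k g i k * \sum_b a k b * C i b j.
pose T4 := \sum_c (\sum_i \sum_b C i c b * a b i) * g c j.
pose T5 := \sum_c (\sum_i (da i c i + \sum_b a c b * C i b i)) * g c j.
have E1 : \sum_k \sum_i da i k j * g k i = T1.
  rewrite exchange_big; apply: eq_bigr => i _; apply: eq_bigr => k _.
  by rewrite mulrC gS.
have E2 : \sum_k a k j * - (\sum_i \sum_b C i b k * g b i) = - T2.
  rewrite -sumrN; under eq_bigr do rewrite mulrN mulr_sumr -sumrN.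
  rewrite exchange_big; apply: eq_bigr => i _; rewrite sumrN; congr (- _).
  under eq_bigr do rewrite mulr_sumr.
  rewrite exchange_big; apply: eq_bigr => b _; rewrite mulr_sumr.
  by apply: eq_bigr => k _; rewrite gS; ring.
have E3 : \sum_k \sum_i (\sum_b g k b * C i b j) * a k i = T3.
  rewrite /T3 exchange_big [RHS]exchange_big /=.
  rewrite exchange_big; apply: eq_bigr => k _; under eq_bigr do rewrite mulr_suml.
  rewrite exchange_big; apply: eq_bigr => b _; rewrite mulr_sumr.
  by apply: eq_bigr => i _; rewrite gS CS; ring.
have E4 : \sum_k \sum_i (\sum_b C i b k * g b j) * a k i = T4.
  under eq_bigr do under eq_bigr do rewrite mulr_suml.
  under eq_bigr do rewrite exchange_big.
  rewrite exchange_big; apply: eq_bigr => c _; rewrite exchange_big mulr_suml.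
  apply: eq_bigr => i _; rewrite mulr_suml; apply: eq_bigr => k _; ring.
have E5 : \sum_k g k j * (\sum_i (da i k i + \sum_b a k b * C i b i)) = T5.
  by apply: eq_bigr => k _; rewrite mulrC.
have L2 : \sum_k \sum_i - (\sum_b g k b * C i b j + \sum_b C i b k * g b j) * a k i
   = - (T3 + T4).
  rewrite -E3 -E4 -big_split -sumrN; apply: eq_bigr => k _.
  rewrite -big_split -sumrN; apply: eq_bigr => i _ /=; ring.
have R1 : \sum_i \sum_k g i k * (da i k j + \sum_b a k b * C i b j - \sum_b C i k b * a b j)
   = T1 + T3 - T2.
  rewrite -big_split -sumrB; apply: eq_bigr => i _.
  rewrite -big_split -sumrB; apply: eq_bigr => k _ /=; ring.
have R2 : \sum_c (\sum_i (da i c i + \sum_b a c b * C i b i - \sum_b C i c b * a b i)) * g c j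
   = T5 - T4.
  rewrite -sumrB; apply: eq_bigr => c _; rewrite -mulrBl; congr (_ * _).
  by rewrite -sumrB.
rewrite R1 R2 !big_split /= E1 E2 L2 E5; ring.
Qed.

Section HodgeCoordinates.
Context {R : realType} {m : nat}.
Local Notation V := 'rV[R]_m.
Implicit Types (D : set V) (G : V -> 'M[R]_m) (X Y Z W : V -> V) (x : V).

Lemma divergence_eq D G X Y x : open D -> D x -> (forall z, D z -> X z = Y z) ->
  divergence G X x = divergence G Y x.
Proof.
move=> oD Dx XY; apply: eq_bigr => i _; rewrite /covi (XY x Dx).
have H : \near x, X x = Y x by apply: (open_near_eq oD Dx) => z; rewrite inE => /XY.
by rewrite (near_eq_derive (basis_vec i) H).
Qed.

Lemma divergence_scale D G (f : V -> R) Y x : open D -> smooth_on D f -> smooth_on D Y -> D x ->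
  divergence G (fun z => f z *: Y z) x =
  \sum_i 'D_(basis_vec i) f x * Y x 0 i + f x * divergence G Y x.
Proof.
move=> oD sf sY Dx; rewrite /divergence mulr_sumr -big_split; apply: eq_bigr => i _.
have df := ((sf 1%N).2 i).1 x Dx.
have dY : derivable Y x (basis_vec i) := smooth_derivable oD sY Dx.
have dfY : derivable (fun z => f z *: Y z) x (basis_vec i) :=
  smooth_derivable oD (smooth_scale oD sf sY) Dx.
have dYi := (derivable_mxP _ _ _).1 dY 0 i.
rewrite /covi mxE -(derive_mxE 0 i dfY).
have -> : (fun z => (f z *: Y z) 0 i) = f * (fun z => Y z 0 i).
  by apply/funext => z; rewrite mxE.
rewrite (deriveM df dYi) (derive_mxE 0 i dY) -![_ *: _]/(_ * _) -scalemxAl.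
rewrite [X in _ + X = _]mxE [X in _ = _ + _ * X]mxE.
by rewrite /= mulrDr addrA mulrC [_ + f x * _]addrC mulrC; ring.
Qed.

Lemma divergenceB D G X Y x : open D -> smooth_on D X -> smooth_on D Y -> D x ->
  divergence G (fun z => X z - Y z) x = divergence G X x - divergence G Y x.
Proof.
move=> oD sX sY Dx; rewrite /divergence -sumrB; apply: eq_bigr => i _.
have dX : derivable X x (basis_vec i) := smooth_derivable oD sX Dx.
have dY : derivable Y x (basis_vec i) := smooth_derivable oD sY Dx.
rewrite /covi (deriveB dX dY) mulmxBl.
have gen (a b c d : V) : (a - b + (c - d)) 0 i = (a + c) 0 i - (b + d) 0 i.
  by rewrite !mxE; ring.
exact: gen.
Qed.

Lemma divergence_sum D G (I : Type) (s : seq I) (X : I -> V -> V) x :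
  (forall k, smooth_on D (X k)) -> open D -> D x ->
  divergence G (fun z => \sum_(k <- s) X k z) x = \sum_(k <- s) divergence G (X k) x.
Proof.
move=> sX oD Dx; rewrite /divergence exchange_big; apply: eq_bigr => i _.
have dX k : derivable (X k) x (basis_vec i) := smooth_derivable oD (sX k) Dx.
have [ds es] := derive_bigsum s dX.
by rewrite /covi [X in X + _]es mulmx_suml -big_split summxE.
Qed.

Definition cov_mx G X : V -> 'M[R]_m := fun x => \matrix_(i, j) covi G i X x 0 j.

Lemma row_cov_mx G X x i : row i (cov_mx G X x) = covi G i X x.
Proof. by apply/rowP => j; rewrite [LHS]mxE [LHS]mxE. Qed.

Lemma flat_smooth D G X : metric_on D G -> smooth_on D X -> smooth_on D (flat G X).
Proof. by move=> [oD sG _ _] sX; exact: smooth_mulmx oD sX sG. Qed.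

Lemma d1_skew (w : V -> V) x : (d1 w x)^T = - d1 w x.
Proof. by apply/matrixP => i j; rewrite mxE [LHS]mxE [RHS]mxE [X in _ = - X]mxE opprB. Qed.

Lemma d1_smooth D (w : V -> V) : open D -> smooth_on D w -> smooth_on D (d1 w).
Proof.
move=> oD sw; apply: (smooth_mx oD) => i j.
have s k l : smooth_on D (fun x => 'D_(basis_vec k) (fun y => w y 0 l) x).
  exact: smooth_partial k (smooth_entry 0 l oD sw).
by apply: (smooth_eq oD _ (smoothD oD (s i j) (smoothN oD (s j i)))) => z _; rewrite mxE.
Qed.

(** Metric compatibility and symmetry of the Christoffel symbols turn the exterior
    derivative of a lowered field into the skew part of its covariant derivative. *)
Lemma d1_flat D G X x : metric_on D G -> smooth_on D X -> D x ->
  d1 (flat G X) x = cov_mx G X x *m G x - (cov_mx G X x *m G x)^T.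
Proof.
move=> hG sX Dx; have [oD sG _ _] := hG.
have E i j : 'D_(basis_vec i) (fun y => flat G X y 0 j) x =
    (cov_mx G X x *m G x) i j + \sum_l (X x *m G x) 0 l * conn G i x j l.
  have dX : derivable X x (basis_vec i) := smooth_derivable oD sX Dx.
  have dG : derivable G x (basis_vec i) := smooth_derivable oD sG Dx.
  have [dXG eXG] := derivable_mulmx dX dG.
  rewrite (derive_mxE 0 j dXG) eXG (conn_metric i hG Dx) mulmxDr addrA mulmxA -mulmxDl.
  rewrite -/(covi G i X x) -row_cov_mx -row_mul mulmxA mxE; congr (_ + _).
    by rewrite mxE.
  by rewrite mxE; apply: eq_bigr => l _; rewrite [X in _ * X]mxE.
apply/matrixP => i j; rewrite [LHS]mxE !E [RHS]mxE [X in _ = _ + X]mxE [X in _ = _ - X]mxE.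
have -> : \sum_l (X x *m G x) 0 l * conn G i x j l = \sum_l (X x *m G x) 0 l * conn G j x i l.
  by apply: eq_bigr => l _; rewrite (conn_torsion _ _ _ hG Dx).
by rewrite opprD addrACA subrr addr0.
Qed.

Lemma raise2_d1_flat D G X x : metric_on D G -> smooth_on D X -> D x ->
  raise2 G (d1 (flat G X)) x =
  invmx (G x) *m cov_mx G X x - (cov_mx G X x)^T *m invmx (G x).
Proof.
move=> hG sX Dx; have uG := metric_unit hG Dx; have [_ _ symG _] := hG.
rewrite /raise2 (d1_flat hG sX Dx) mulmxBr mulmxBl trmx_mul (symG _ Dx).
by rewrite !mulmxA mulmxK// (mulVmx uG) mul1mx.
Qed.

Lemma divergence_row_invmx D G x k : metric_on D G -> D x ->
  divergence G (fun z => row k (invmx (G z))) x =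
  - \sum_i \sum_a conn G i x a k * invmx (G x) a i.
Proof.
move=> hG Dx; have [oD _ _ _] := hG; rewrite /divergence -sumrN; apply: eq_bigr => i _.
have sI := invmx_smooth hG.
have dI : derivable (fun z => invmx (G z)) x (basis_vec i) := smooth_derivable oD sI Dx.
have sR : smooth_on D (fun z => row k (invmx (G z))).
  apply: (smooth_mx oD) => a b.
  by apply: (smooth_eq oD _ (smooth_entry k b oD sI)) => z _; rewrite mxE.
have dR : derivable (fun z => row k (invmx (G z))) x (basis_vec i) := smooth_derivable oD sR Dx.
rewrite /covi mxE -(derive_mxE 0 i dR).
have -> : (fun z => row k (invmx (G z)) 0 i) = (fun z => invmx (G z) k i).
  by apply/funext => z; rewrite mxE.
rewrite (derive_mxE k i dI) (derive_invmx i hG Dx) -row_mul [X in X + _]mxE [X in - X + _]mxE.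
rewrite [X in _ + X]mxE opprD addrAC addNr add0r; congr (- _).
by rewrite mxE; apply: eq_bigr => a _; rewrite [X in X * _]mxE.
Qed.

(** The codifferential of d X^flat is minus the rough Laplacian of X plus a second
    contraction of its second derivative. *)
Lemma divergence2_raise2 D G X x : metric_on D G -> smooth_on D X -> D x ->
  divergence2 G (raise2 G (d1 (flat G X))) x =
  \sum_i \sum_k invmx (G x) i k *: hess G i k X x
  - (\row_a \sum_i hess G i a X x 0 i) *m invmx (G x).
Proof.
move=> hG sX Dx; have [oD _ _ _] := hG; have sI := invmx_smooth hG.
have sA k : smooth_on D (covi G k X) := covi_smooth k hG sX.
have sR k : smooth_on D (fun z => row k (invmx (G z))).
  apply: (smooth_mx oD) => a b.
  by apply: (smooth_eq oD _ (smooth_entry k b oD sI)) => z _; rewrite mxE.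
apply/rowP => j; rewrite mxE.
have sT1 k : smooth_on D (fun z => covi G k X z 0 j *: row k (invmx (G z))).
  exact: smooth_scale oD (smooth_entry 0 j oD (sA k)) (sR k).
have sT2 k : smooth_on D (fun z => invmx (G z) k j *: covi G k X z).
  exact: smooth_scale oD (smooth_entry k j oD sI) (sA k).
have colE z : D z -> (col j (raise2 G (d1 (flat G X)) z))^T =
    \sum_k covi G k X z 0 j *: row k (invmx (G z)) - \sum_k invmx (G z) k j *: covi G k X z.
  move=> Dz; rewrite (raise2_d1_flat hG sX Dz); apply/rowP => i.
  rewrite !mxE !summxE; congr (_ - _); apply: eq_bigr => k _; last by rewrite !mxE mulrC.
  rewrite !mxE mulrC; congr (_ * _).
  by rewrite -[in LHS](invmx_sym hG Dz) mxE.
rewrite (divergence_eq G oD Dx colE).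
rewrite (@divergenceB D _ (fun z => \sum_k covi G k X z 0 j *: row k (invmx (G z)))
   (fun z => \sum_k invmx (G z) k j *: covi G k X z) x oD _ _ Dx); last 2 first.
- exact: smooth_sum oD sT1.
- exact: smooth_sum oD sT2.
rewrite (divergence_sum G (index_enum 'I_m) sT1 oD Dx) (divergence_sum G (index_enum 'I_m) sT2 oD Dx).
have dAj i k : 'D_(basis_vec i) (fun z => covi G k X z 0 j) x =
    ('D_(basis_vec i) (covi G k X) x) 0 j.
  exact: derive_mxE 0 j (smooth_derivable oD (sA k) Dx).
have dIj i k : 'D_(basis_vec i) (fun z => invmx (G z) k j) x =
    - ((invmx (G x) *m conn G i x) k j + ((conn G i x)^T *m invmx (G x)) k j).
  rewrite (derive_mxE k j (smooth_derivable oD sI Dx)) (derive_invmx i hG Dx).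
  by rewrite [LHS]mxE [X in - X]mxE.
have hE i k l : hess G i k X x 0 l = ('D_(basis_vec i) (covi G k X) x) 0 l
    + \sum_b covi G k X x 0 b * conn G i x b l - \sum_b conn G i x k b * covi G b X x 0 l.
  have gen (u v w : V) : (u + v - w) 0 l = u 0 l + v 0 l - w 0 l by rewrite !mxE.
  rewrite /hess {1}/covi gen summxE [X in _ + X - _]mxE; congr (_ - _).
  by apply: eq_bigr => b _; rewrite mxE.
have divA k : divergence G (covi G k X) x = \sum_i (('D_(basis_vec i) (covi G k X) x) 0 i
    + \sum_b covi G k X x 0 b * conn G i x b i).
  apply: eq_bigr => i _; rewrite {1}/covi.
  have gen (u v : V) : (u + v) 0 i = u 0 i + v 0 i by rewrite mxE.
  by rewrite gen [X in _ + X]mxE.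
have key := @divergence2_algebra R 'I_m (fun i k => invmx (G x) i k)
  (fun i b c => conn G i x b c) (fun k l => covi G k X x 0 l)
  (fun i k l => ('D_(basis_vec i) (covi G k X) x) 0 l) j _ _.
have gS i k : invmx (G x) i k = invmx (G x) k i.
  by rewrite -[in LHS](invmx_sym hG Dx) mxE.
have CS i b c : conn G i x b c = conn G b x i c by exact: conn_torsion hG Dx.
transitivity (\sum_i \sum_k invmx (G x) i k * hess G i k X x 0 j
   - \sum_c (\sum_i hess G i c X x 0 i) * invmx (G x) c j); last first.
  rewrite [RHS]mxE [X in _ = _ + X]mxE; congr (_ - _).
    rewrite summxE; apply: eq_bigr => i _; rewrite summxE.
    by apply: eq_bigr => k _; rewrite [RHS]mxE.
  by rewrite [RHS]mxE; apply: eq_bigr => c _; rewrite [X in _ = X * _]mxE.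
under [X in _ = X - _]eq_bigr do under eq_bigr do rewrite hE.
under [X in _ = _ - X]eq_bigr do under eq_bigr do rewrite hE.
apply: (etrans _ (key gS CS)); congr (_ - _); apply: eq_bigr => k _.
  rewrite (divergence_scale G oD (smooth_entry 0 j oD (sA k)) (sR k) Dx).
  rewrite (divergence_row_invmx k hG Dx); congr (_ + _).
  by apply: eq_bigr => i _; rewrite dAj mxE.
rewrite (divergence_scale G oD (smooth_entry k j oD sI) (sA k) Dx) divA; congr (_ + _).
apply: eq_bigr => i _; rewrite dIj [X in - (X + _)]mxE [X in - (_ + X)]mxE.
by congr (- (_ + _) * _); apply: eq_bigr => b _; rewrite mxE.
Qed.

End HodgeCoordinates.

(** * The Weitzenboeck formula *)

Section Weitzenboeck.
Context {R : realType} {m : nat}.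
Local Notation V := 'rV[R]_m.
Implicit Types (D : set V) (G : V -> 'M[R]_m) (X Y Z W : V -> V) (x : V).
Implicit Types (E : 'I_m -> V -> V).

(** The terms in which the connection acts on the traced index cancel. *)
Lemma divergence_partial D G X x a : metric_on D G -> smooth_on D X -> D x ->
  'D_(basis_vec a) (divergence G X) x = \sum_i hess G a i X x 0 i.
Proof.
move=> hG sX Dx; have [oD _ _ _] := hG.
have sA i : smooth_on D (covi G i X) := covi_smooth i hG sX.
have dA i : derivable (covi G i X) x (basis_vec a) := smooth_derivable oD (sA i) Dx.
have dAi i := (derivable_mxP _ _ _).1 (dA i) 0 i.
have [_ E] := derive_bigsum (index_enum 'I_m) dAi.
apply: (etrans E).
have hE i : hess G a i X x 0 i = 'D_(basis_vec a) (fun z => covi G i X z 0 i) x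
    + (\sum_b covi G i X x 0 b * conn G a x b i - \sum_b conn G a x i b * covi G b X x 0 i).
  have gen (u v w : V) : (u + v - w) 0 i = u 0 i + (v 0 i - w 0 i) by rewrite !mxE addrA.
  rewrite /hess {1}/covi gen summxE (derive_mxE 0 i (dA i)) [X in _ + (X - _)]mxE.
  by congr (_ + (_ - _)); apply: eq_bigr => b _; rewrite mxE.
rewrite (eq_bigr _ (fun i _ => hE i)) big_split sumrB /=.
have -> : \sum_i \sum_b covi G i X x 0 b * conn G a x b i =
    \sum_i \sum_b conn G a x i b * covi G b X x 0 i.
  by rewrite exchange_big; apply: eq_bigr => i _; apply: eq_bigr => b _; rewrite mulrC.
by rewrite subrr addr0.
Qed.

(** The contraction in d d^* and the one in d^* d differ by a commutator of second
    derivatives; this is where curvature enters. *)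
Lemma hodge_coordinates D G X x : metric_on D G -> smooth_on D X -> D x ->
  hodge_laplacian D G X x =
  - (\sum_i \sum_k invmx (G x) i k *: hess G i k X x)
  + (\row_a \sum_i (X x *m curv_mx G i a x) 0 i) *m invmx (G x).
Proof.
move=> hG sX Dx; have [oD _ _ _] := hG; have uG := metric_unit hG Dx.
have sF := flat_smooth hG sX.
have E1 : d0 (codiff1 D G (flat G X)) x = - (\row_a \sum_i hess G a i X x 0 i).
  apply/rowP => a; rewrite [LHS]mxE [RHS]mxE [X in - X]mxE -(divergence_partial a hG sX Dx).
  have H : \near x, codiff1 D G (flat G X) x = - divergence G X x.
    by apply: (open_near_eq oD Dx) => z; rewrite inE => Dz; exact: codiff1E.
  rewrite (near_eq_derive (basis_vec a) H).
  exact: (deriveN (((divergence_smooth hG sX 1%N).2 a).1 x Dx)).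
have E2 : codiff2 D G (d1 (flat G X)) x = - divergence2 G (raise2 G (d1 (flat G X))) x *m G x.
  by apply: (codiff2E hG (d1_smooth oD sF)) => // z _; exact: d1_skew.
rewrite /hodge_laplacian /sharp E1 E2 mulmxDl mulmxK//.
have gen0 (A B C S : V) : B - A = C -> - A + - (S - B) = - S + C.
  by move=> <-; apply/rowP => l; rewrite !mxE; ring.
rewrite (divergence2_raise2 hG sX Dx) mulNmx; apply: gen0; rewrite -mulmxBl.
congr (_ *m _); apply/rowP => a.
have gen (u v : V) l : (u - v) 0 l = u 0 l - v 0 l by rewrite !mxE.
rewrite gen [X in X - _]mxE [X in _ - X]mxE [RHS]mxE -sumrB; apply: eq_bigr => i _.
by rewrite -gen (hess_commutator i a hG sX Dx).
Qed.

(** Orthonormality says F A F^T = 1 for the matrix F with rows E a; hence A^-1 is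
    F^T F. *)
Lemma frame_invmx (A : 'M[R]_m) (E : 'I_m -> V) :
  (forall a b, ip A (E a) (E b) = (a == b)%:R) ->
  A \in unitmx /\ forall i k, invmx A i k = \sum_a E a 0 i * E a 0 k.
Proof.
move=> on; pose F : 'M[R]_m := \matrix_(a, j) E a 0 j.
have rF a : row a F = E a by apply/rowP => j; rewrite !mxE.
have FA : F *m (A *m F^T) = 1%:M.
  apply/matrixP => a b; rewrite mulmxA [RHS]mxE -on /ip -!rF -row_mul [LHS]mxE [RHS]mxE.
  by apply: eq_bigr => j _; rewrite !mxE.
have AF : A *m (F^T *m F) = 1%:M by rewrite mulmxA (mulmx1C FA).
have uA : A \in unitmx by case: (mulmx1_unit AF).
split=> // i k; have -> : invmx A = F^T *m F.
  by rewrite -[RHS]mul1mx -(mulVmx uA) -mulmxA AF mulmx1.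
by rewrite mxE; apply: eq_bigr => a _; rewrite !mxE.
Qed.

(** The trace of the curvature over coordinates becomes a trace over the frame; the
    pair symmetry brings the indices into the order used for the Ricci tensor. *)
Lemma ricci_frame D G E X x : metric_on D G -> smooth_on D X ->
  (forall a, smooth_on D (E a)) -> D x ->
  (forall a b, ip (G x) (E a x) (E b x) = (a == b)%:R) ->
  (\row_a \sum_i (X x *m curv_mx G i a x) 0 i) *m invmx (G x)
  = - \sum_a curv G (E a) X (E a) x.
Proof.
move=> hG sX sE Dx on; have [oD _ symG _] := hG; have uG := metric_unit hG Dx.
have [_ gE] := frame_invmx on.
rewrite -[RHS](mulmxK uG); congr (_ *m _); apply/rowP => l; rewrite [LHS]mxE.
have -> : ((- \sum_a curv G (E a) X (E a) x) *m G x) 0 l =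
    - \sum_a curv4 G (E a) X (E a) (fun=> basis_vec l) x.
  rewrite mulNmx mulmx_suml [LHS]mxE summxE; congr (- _); apply: eq_bigr => a _.
  by rewrite /curv4 /ip /basis_vec trmx_delta -colE [RHS]mxE.
have cE a : curv4 G (E a) X (E a) (fun=> basis_vec l) x =
    \sum_i \sum_k \sum_j E a x 0 i * E a x 0 k * (X x 0 j * riem4 G x i j k l).
  rewrite (curv4E _ hG (sE a) sX (sE a) Dx); apply: eq_bigr => i _.
  rewrite exchange_big; apply: eq_bigr => k _; apply: eq_bigr => j _.
  rewrite (bigD1 l)//= big1 ?addr0; last first.
    by move=> b bl; rewrite mxE eqxx /= (negPf bl) mulr0 mul0r.
  by rewrite mxE !eqxx /=; ring.
rewrite (eq_bigr _ (fun a _ => cE a)).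
have cI i : (X x *m curv_mx G i l x) 0 i =
    \sum_k \sum_j invmx (G x) k i * (X x 0 j * riem4 G x i l j k).
  rewrite -[in LHS](mulmxK uG (curv_mx G i l x)) mulmxA [LHS]mxE; apply: eq_bigr => k _.
  rewrite [X in X * _ = _]mxE mulr_suml; apply: eq_bigr => j _; rewrite -/(riem4 G x i l j k); ring.
rewrite (eq_bigr _ (fun i _ => cI i)) exchange_big.
rewrite [X in _ = - X]exchange_big -sumrN; apply: eq_bigr => i _.
rewrite [X in _ = - X]exchange_big -sumrN; apply: eq_bigr => k _.
rewrite [X in _ = - X]exchange_big -sumrN; apply: eq_bigr => j _.
rewrite -mulr_suml -gE (riem4_pair k l j i hG Dx) (riem4_antisym12 _ _ j i k l); ring.
Qed.

(** The Bochner-Weitzenboeck formula: hodge_coordinates with the inverse metric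
    expanded in the frame. The frame may live on a smaller open set than the field,
    as it is only used to expand tensors. *)
Lemma weitzenboeck D (D0 : set V) G E X x : metric_on D G -> smooth_on D X ->
  open D0 -> D0 `<=` D -> D0 x -> (forall a, smooth_on D0 (E a)) ->
  (forall a b, ip (G x) (E a x) (E b x) = (a == b)%:R) ->
  hodge_laplacian D G X x =
  - \sum_a (cov G (E a) (cov G (E a) X) x - cov G (cov G (E a) (E a)) X x)
  - \sum_a curv G (E a) X (E a) x.
Proof.
move=> hG sX oW WD Wx sE on; have Dx := WD _ Wx.
have hW : metric_on D0 G.
  have [oD sG symG pG] := hG; split => //.
  - by move=> r; exact: Cr_on_sub WD (sG r).
  - by move=> z /WD; exact: symG.
  - by move=> z /WD; exact: pG.
have sXW : smooth_on D0 X by move=> r; exact: Cr_on_sub WD (sX r).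
rewrite (hodge_coordinates hG sX Dx) (ricci_frame hW sXW sE Wx on); congr (- _ - _).
have [_ gE] := frame_invmx on.
rewrite (eq_bigr _ (fun a _ => cov_cov_hess hW (sE a) (sE a) sXW Wx)).
rewrite [RHS]exchange_big; apply: eq_bigr => i _.
rewrite [RHS]exchange_big; apply: eq_bigr => k _.
by rewrite gE scaler_suml.
Qed.

Lemma ric_vecE D G E X x : metric_on D G -> smooth_on D X ->
  (forall a, smooth_on D (E a)) -> D x ->
  ric_vec G E X x = - \sum_a curv G (E a) X (E a) x.
Proof.
move=> hG sX sE Dx; have uG := metric_unit hG Dx.
rewrite /ric_vec /sharp -[RHS](mulmxK uG); congr (_ *m _).
apply/rowP => l; rewrite [LHS]mxE mulNmx mulmx_suml [RHS]mxE summxE -sumrN.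
apply: eq_bigr => a _; have sB : smooth_on D (coord_field l : V -> V) by move=> r; exact: Cr_on_cst.
rewrite (curv4_antisym34 hG (sE a) sX sB (sE a) Dx); congr (- _).
by rewrite /curv4 /ip /coord_field /basis_vec trmx_delta -colE [LHS]mxE.
Qed.

End Weitzenboeck.

(** * The formulas of Gauss and Weingarten *)

(** An isometric immersion of Om into D in coordinates, with the induced metric. *)
Definition sub_on {R : realType} {n m : nat} (L : local_sub R n m)
    (Om : set 'rV[R]_n) (D : set 'rV[R]_m) : Prop :=
  [/\ metric_on Om (lind L), metric_on D (lamb L), smooth_on Om (lmap L),
      forall z, Om z -> D (lmap L z) &
      forall z, Om z -> lind L z =
        jacobian (lmap L) z *m lamb L (lmap L z) *m (jacobian (lmap L) z)^T].

Section SubmanifoldCalculus.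
Context {R : realType} {n m : nat} (L : local_sub R n m).
Context (Om : set 'rV[R]_n) (D : set 'rV[R]_m) (hL : sub_on L Om D).
Local Notation F := (lmap L).
Local Notation G := (lamb L).
Local Notation g := (lind L).
Local Notation J := (jacobian (lmap L)).
Implicit Types (X Y Z : 'rV[R]_n -> 'rV[R]_n) (eta zeta : 'rV[R]_n -> 'rV[R]_m).
Implicit Types (z u : 'rV[R]_n) (w : 'rV[R]_m).

Lemma sub_open : open Om. Proof. by have [[]] := hL. Qed.
Let oOm := sub_open.
Let hg : metric_on Om g. Proof. by have [] := hL. Qed.
Let hG : metric_on D G. Proof. by have [] := hL. Qed.
Let FD z : Om z -> D (F z). Proof. by have [_ _ _ + _] := hL; apply. Qed.

Lemma lmap_differentiable z : Om z -> differentiable F z.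
Proof. by move=> Oz; have [_ _ sF _ _] := hL; exact: smooth_differentiable oOm sF Oz. Qed.
Let dF := lmap_differentiable.

Lemma jacobianE z u : Om z -> u *m J z = 'D_u F z.
Proof. by move=> Oz; rewrite (deriveEjacobian u (dF Oz)). Qed.

Lemma jacobian_smooth : smooth_on Om J.
Proof.
have [_ _ sF _ _] := hL; apply: (smooth_mx oOm) => i j.
apply: (smooth_eq oOm _ (smooth_entry 0 j oOm (smooth_partial i sF))) => z Oz.
by rewrite -jacobianE// -rowE mxE.
Qed.

Lemma push_smooth X : smooth_on Om X -> smooth_on Om (push L X).
Proof. by move=> sX; exact: smooth_mulmx oOm sX jacobian_smooth. Qed.

Lemma derive_compF p (Z : 'rV[R]_m -> 'rV[R]_p) z u : Om z -> differentiable Z (F z) ->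
  'D_u (Z \o F) z = 'D_(u *m J z) Z (F z).
Proof.
move=> Oz dZ; have dc : differentiable (Z \o F) z := differentiable_comp (dF Oz) dZ.
by rewrite (deriveE u dc) (diff_comp (dF Oz) dZ) /= -(deriveE u (dF Oz)) -jacobianE// deriveE.
Qed.

(** Along the submanifold the ambient connection is the derivative plus this
    matrix, linear in the direction u. *)
Definition pull_conn z u : 'M[R]_m := \sum_i (u *m J z) 0 i *: conn G i (F z).

Lemma cov_alongE X eta z :
  cov_along L X eta z = 'D_(X z) eta z + eta z *m pull_conn z (X z).
Proof.
rewrite /cov_along christoffel_formE /pull_conn mulmx_sumr; congr (_ + _).
by apply: eq_bigr => i _; rewrite -scalemxAr.
Qed.

(** The chain rule: the connection along the submanifold is the restriction of
    the ambient one. *)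
Lemma cov_restrict (Xt Z : 'rV[R]_m -> 'rV[R]_m) X z : Om z -> differentiable Z (F z) ->
  Xt (F z) = push L X z -> cov G Xt Z (F z) = cov_along L X (Z \o F) z.
Proof. by move=> Oz dZ XE; rewrite /cov /cov_along derive_compF// XE. Qed.

Lemma pull_metric z u : Om z ->
  'D_u (G \o F) z = pull_conn z u *m G (F z) + G (F z) *m (pull_conn z u)^T.
Proof.
move=> Oz; have [oD sG _ _] := hG; have dG := smooth_differentiable oD sG (FD Oz).
have dc : differentiable (G \o F) z := differentiable_comp (dF Oz) dG.
rewrite (deriveE u dc) (diff_comp (dF Oz) dG) /= -(deriveE u (dF Oz)) -jacobianE//.
rewrite -deriveE// derive_basis_sum// /pull_conn mulmx_suml linear_sum mulmx_sumr -big_split.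
apply: eq_bigr => i _; rewrite (conn_metric i hG (FD Oz)) scalerDr -scalemxAl.
by rewrite linearZ -scalemxAr.
Qed.

(** Metric compatibility of the pulled back connection. *)
Lemma cov_along_metric X eta zeta z : Om z -> differentiable eta z -> differentiable zeta z ->
  'D_(X z) (fun y => ip (G (F y)) (eta y) (zeta y)) z =
  ip (G (F z)) (cov_along L X eta z) (zeta z) + ip (G (F z)) (eta z) (cov_along L X zeta z).
Proof.
move=> Oz de dz; have [oD sG _ _] := hG; have dG := smooth_differentiable oD sG (FD Oz).
have dc : differentiable (G \o F) z := differentiable_comp (dF Oz) dG.
have d1 := derivable_mulmx (@diff_derivable _ _ _ _ _ (X z) de) (@diff_derivable _ _ _ _ _ (X z) dc).
have d2 := derivable_trmx (@diff_derivable _ _ _ _ _ (X z) dz).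
have d3 := derivable_mulmx d1.1 d2.1.
rewrite /ip (derive_mxE 0 0 d3.1) d3.2 d1.2 d2.2 (pull_metric _ Oz) !cov_alongE.
have tD (A B : 'rV[R]_m) : (A + B)^T = A^T + B^T by apply/matrixP => ? ?; rewrite !mxE.
rewrite tD trmx_mul !(mulmxDl, mulmxDr) !mulmxA.
have gen (a b c d : 'M[R]_1) : (a + (b + c) + d) 0 0 = (a + b) 0 0 + (d + c) 0 0.
  by rewrite !mxE; ring.
exact: gen.
Qed.

Definition pushb (j : 'I_n) : 'rV[R]_n -> 'rV[R]_m := push L (coord_field j).

Lemma pushbE z j : pushb j z = row j (J z).
Proof. by rewrite /pushb /push -rowE. Qed.

Lemma coord_field_smooth j : smooth_on Om (coord_field j : 'rV[R]_n -> 'rV[R]_n).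
Proof. by move=> r; exact: Cr_on_cst. Qed.

Lemma pushb_differentiable j z : Om z -> differentiable (pushb j) z.
Proof. by move=> Oz; exact: smooth_differentiable oOm (push_smooth (coord_field_smooth j)) Oz. Qed.

Lemma push_differentiable X z : Om z -> differentiable X z -> differentiable (push L X) z.
Proof.
move=> Oz dX; apply: differentiable_mulmx => //.
exact: smooth_differentiable oOm jacobian_smooth Oz.
Qed.

(** Second coordinate derivatives of the immersion, made covariant. *)
Definition hess_map i j : 'rV[R]_n -> 'rV[R]_m := cov_along L (coord_field i) (pushb j).

(** Second derivatives of the immersion commute and the ambient connection is
    torsion free. *)
Lemma hess_map_sym i j z : Om z -> hess_map i j z = hess_map j i z.
Proof.
move=> Oz; have [_ _ sF _ _] := hL.
apply: (etrans (cov_alongE _ _ _)); apply: (etrans _ (esym (cov_alongE _ _ _))).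
apply: (congr2 (fun a b : 'rV[R]_m => a + b)).
  have E k : \near z, pushb k z = 'D_(basis_vec k) F z.
    apply: (open_near_eq oOm Oz) => y; rewrite inE => Oy.
    by rewrite -jacobianE// pushbE rowE.
  apply: (etrans (near_eq_derive _ (E j))); apply: (etrans _ (esym (near_eq_derive _ (E i)))).
  exact: (partialC_mx i j oOm sF Oz).
have E k l : pushb k z *m pull_conn z (coord_field l z) =
    \sum_a \sum_b (pushb l z 0 a * pushb k z 0 b) *: row b (conn G a (F z)).
  rewrite /pull_conn mulmx_sumr; apply: eq_bigr => a _.
  rewrite -scalemxAr [pushb k z *m _]mulmx_sum_row scaler_sumr; apply: eq_bigr => b _.
  by rewrite scalerA.
rewrite !E exchange_big; apply: eq_bigr => a _; apply: eq_bigr => b _.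
have -> : row a (conn G b (F z)) = row b (conn G a (F z)).
  by apply/rowP => l; rewrite !mxE; have := conn_torsion b a l hG (FD Oz); rewrite !mxE.
by rewrite mulrC.
Qed.

Definition tan_mx z : 'M[R]_(m, n) := G (F z) *m (J z)^T *m invmx (g z).

Lemma tan_partE z w : tan_part L z w = w *m tan_mx z.
Proof. by rewrite /tan_part /sharp /tan_mx !mulmxA. Qed.

Lemma nor_partE z w : nor_part L z w = w *m (1%:M - tan_mx z *m J z).
Proof. by rewrite /nor_part tan_partE mulmxBr mulmx1 [X in _ = _ - X]mulmxA. Qed.

Lemma tan_push z u : Om z -> tan_part L z (u *m J z) = u.
Proof.
move=> Oz; have [_ _ _ _ gE] := hL; have ug := metric_unit hg Oz.
rewrite /tan_part /sharp (_ : _ *m (J z)^T = u *m g z) ?mulmxK//.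
by rewrite (gE _ Oz) !mulmxA.
Qed.

Lemma nor_push z u : Om z -> nor_part L z (u *m J z) = 0.
Proof. by move=> Oz; rewrite /nor_part tan_push// subrr. Qed.

Lemma push_ip z u u' : Om z -> ip (G (F z)) (u *m J z) (u' *m J z) = ip (g z) u u'.
Proof.
by move=> Oz; have [_ _ _ _ gE] := hL; rewrite (gE _ Oz) /ip trmx_mul !mulmxA.
Qed.

Lemma ip_tan z w u : Om z -> ip (G (F z)) w (u *m J z) = ip (g z) (tan_part L z w) u.
Proof.
move=> Oz; have ug := metric_unit hg Oz.
by rewrite /ip /tan_part /sharp trmx_mul mulmxKV// !mulmxA.
Qed.

Lemma nor_part_normal z w u : Om z -> ip (G (F z)) (nor_part L z w) (u *m J z) = 0.
Proof.
by move=> Oz; rewrite /nor_part ipDl ipNl push_ip// ip_tan// subrr.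
Qed.

(** It is enough to test on the coordinate basis of the tangent space. *)
Definition normal_at z w : Prop := forall a, ip (G (F z)) w (pushb a z) = 0.

Lemma tan_part_row z w :
  tan_part L z w = sharp (g z) (\row_a ip (G (F z)) w (pushb a z)).
Proof.
rewrite /tan_part; congr sharp; apply/rowP => a; rewrite [RHS]mxE pushbE /ip [LHS]mxE [RHS]mxE.
by apply: eq_bigr => j _; congr (_ * _); rewrite !mxE.
Qed.

Lemma normal_tan z w : normal_at z w -> tan_part L z w = 0.
Proof.
move=> nw; rewrite tan_part_row /sharp (_ : (\row_a _) = 0) ?mul0mx//.
by apply/rowP => a; rewrite [LHS]mxE nw mxE.
Qed.

Lemma normal_nor z w : normal_at z w -> nor_part L z w = w.
Proof. by move=> /normal_tan E; rewrite /nor_part E mul0mx subr0. Qed.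

Lemma nor_part_is_normal z w : Om z -> normal_at z (nor_part L z w).
Proof. by move=> Oz a; rewrite pushbE rowE nor_part_normal. Qed.

(** The Koszul formula: the induced Christoffel symbols are determined by the
    symmetry of hess_map and by the derivative of the induced metric. *)
Lemma tan_hess_map i j z : Om z -> tan_part L z (hess_map i j z) = row j (conn g i z).
Proof.
move=> Oz; have [_ _ _ _ gE] := hL.
pose q a b c := ip (G (F z)) (hess_map a b z) (pushb c z).
have pE a b c : partial_metric g z a b c = q a b c + q a c b.
  have E : \near z, g z b c = ip (G (F z)) (pushb b z) (pushb c z).
    apply: (open_near_eq oOm Oz) => y; rewrite inE => Oy.
    by rewrite !pushbE !rowE push_ip// /ip /basis_vec -rowE trmx_delta -colE !mxE.
  rewrite /partial_metric (near_eq_derive _ E).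
  rewrite (@cov_along_metric (coord_field a) _ _ z Oz (pushb_differentiable b Oz) (pushb_differentiable c Oz)).
  have [_ _ sG _] := hG; by rewrite /q [X in _ + X](ipC _ _ (sG _ (FD Oz))).
have qS a b c : q a b c = q b a c by rewrite /q hess_map_sym.
rewrite tan_part_row /sharp; apply/rowP => l; rewrite !mxE /christoffel mulr_sumr.
apply: eq_bigr => a _; rewrite [X in X * _ = _]mxE -/(q i j a) !pE.
rewrite (qS j i a) (qS a i j) (qS a j i).
have -> : invmx (g z) a l = invmx (g z) l a by rewrite -[in LHS](invmx_sym hg Oz) mxE.
by field.
Qed.

Lemma cov_along_sum X eta z : differentiable eta z ->
  cov_along L X eta z = \sum_i X z 0 i *: cov_along L (coord_field i) eta z.
Proof.
move=> de; rewrite cov_alongE (derive_basis_sum _ de).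
have -> : pull_conn z (X z) = \sum_i X z 0 i *: pull_conn z (basis_vec i).
  rewrite /pull_conn; under [RHS]eq_bigr do rewrite scaler_sumr.
  rewrite [RHS]exchange_big; apply: eq_bigr => a _.
  rewrite mxE scaler_suml; apply: eq_bigr => i _.
  by rewrite scalerA -rowE [X in _ = (_ * X) *: _]mxE.
rewrite mulmx_sumr -big_split; apply: eq_bigr => i _.
by rewrite cov_alongE scalerDr -scalemxAr.
Qed.

Lemma cov_along_push_coord Y z i : Om z -> differentiable Y z ->
  cov_along L (coord_field i) (push L Y) z =
  'D_(basis_vec i) Y z *m J z + \sum_j Y z 0 j *: hess_map i j z.
Proof.
move=> Oz dY; have dJ := smooth_differentiable oOm jacobian_smooth Oz.
have dJi := @diff_derivable _ _ _ _ _ (basis_vec i) dJ.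
rewrite cov_alongE (derive_mulmx (@diff_derivable _ _ _ _ _ (basis_vec i) dY) dJi) -addrA; congr (_ + _).
rewrite /push -mulmxA -mulmxDr mulmx_sum_row; apply: eq_bigr => j _; congr (_ *: _).
rewrite /hess_map cov_alongE pushbE -row_mul.
have -> : 'D_(basis_vec i) (pushb j) z = row j ('D_(basis_vec i) J z).
  have dp := @diff_derivable _ _ _ _ _ (basis_vec i) (pushb_differentiable j Oz).
  apply/rowP => b; rewrite [RHS]mxE.
  have EF : (fun y => pushb j y 0 b) = (fun y => J y j b).
    by apply/funext => y; rewrite pushbE mxE.
  by apply: (etrans (esym (derive_mxE 0 b dp))); rewrite EF; exact: derive_mxE j b dJi.
by apply/rowP => b; rewrite !mxE.
Qed.

(** Both sides are linear over functions in X and satisfy the Leibniz rule in Y, so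
    the coordinate fields, that is tan_hess_map, suffice. *)
Lemma tan_cov_along X Y z : Om z -> differentiable Y z ->
  tan_part L z (cov_along L X (push L Y) z) = cov g X Y z.
Proof.
move=> Oz dY; rewrite (cov_along_sum _ (push_differentiable Oz dY)) tan_partE mulmx_suml.
rewrite (covE _ _ dY); apply: eq_bigr => i _; rewrite -scalemxAl; congr (_ *: _).
rewrite cov_along_push_coord// -tan_partE tan_partE mulmxDl -tan_partE tan_push//.
rewrite mulmx_suml /covi mulmx_sum_row; congr (_ + _); apply: eq_bigr => j _.
by rewrite -scalemxAl -tan_partE tan_hess_map.
Qed.

Lemma gauss_formula X Y z : Om z -> differentiable Y z ->
  cov_along L X (push L Y) z = push L (cov g X Y) z + II L X Y z.
Proof. by move=> Oz dY; rewrite /II /nor_part tan_cov_along// addrC subrK. Qed.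

(** II is bilinear over functions. *)
Lemma IIE X Y z : Om z -> differentiable Y z ->
  II L X Y z = \sum_i \sum_j (X z 0 i * Y z 0 j) *: nor_part L z (hess_map i j z).
Proof.
move=> Oz dY; rewrite /II (cov_along_sum _ (push_differentiable Oz dY)) nor_partE mulmx_suml.
apply: eq_bigr => i _; rewrite -scalemxAl -nor_partE cov_along_push_coord//.
rewrite nor_partE mulmxDl -!nor_partE nor_push// add0r nor_partE mulmx_suml scaler_sumr.
by apply: eq_bigr => j _; rewrite -scalemxAl -nor_partE scalerA.
Qed.

Lemma II_sym X Y z : Om z -> differentiable X z -> differentiable Y z ->
  II L X Y z = II L Y X z.
Proof.
move=> Oz dX dY; rewrite !IIE// exchange_big; apply: eq_bigr => i _; apply: eq_bigr => j _.
by rewrite hess_map_sym// mulrC.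
Qed.

Lemma weingartenE eta X z : normal_at z (eta z) -> Om z ->
  weingarten L eta X z =
  sharp (g z) (\row_a ip (G (F z)) (eta z) (cov_along L X (pushb a) z)).
Proof.
move=> ne Oz; rewrite /weingarten; congr sharp; apply/rowP => a; rewrite [LHS]mxE [RHS]mxE.
have dc := smooth_differentiable oOm (coord_field_smooth a) Oz.
rewrite /pushb (gauss_formula X Oz dc) ipDr.
have [_ _ sG _] := hG.
by rewrite [X in _ = X + _]ip_tan// (normal_tan ne) ip0l add0r.
Qed.

(** Weingarten's equation: differentiate the orthogonality of eta and the
    coordinate fields. *)
Lemma tan_cov_normal eta X z : Om z -> differentiable eta z ->
  (forall y, Om y -> normal_at y (eta y)) ->
  tan_part L z (cov_along L X eta z) = - weingarten L eta X z.
Proof.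
move=> Oz de ne; rewrite (weingartenE X (ne _ Oz) Oz) tan_part_row /sharp -mulNmx.
congr (_ *m _); apply/rowP => a; rewrite [LHS]mxE [RHS]mxE [X in - X]mxE.
have := cov_along_metric X Oz de (pushb_differentiable a Oz).
have E : \near z, ip (G (F z)) (eta z) (pushb a z) = 0.
  by apply: (open_near_eq oOm Oz) => y; rewrite inE => Oy; exact: ne.
rewrite (near_eq_derive _ E) derive_cst => /esym/eqP; rewrite addr_eq0 => /eqP ->.
by [].
Qed.

End SubmanifoldCalculus.

(** * The equations of Gauss and Codazzi *)

Lemma cov_metric {R : realType} m (D : set 'rV[R]_m) (G : 'rV[R]_m -> 'M[R]_m)
    (X Y Z : 'rV[R]_m -> 'rV[R]_m) x :
  metric_on D G -> smooth_on D Y -> smooth_on D Z -> D x ->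
  'D_(X x) (fun y => ip (G y) (Y y) (Z y)) x =
  ip (G x) (cov G X Y x) (Z x) + ip (G x) (Y x) (cov G X Z x).
Proof.
move=> hG sY sZ Dx; have [oD sG _ _] := hG; pose P := \sum_i X x 0 i *: conn G i x.
have dY : derivable Y x (X x) := smooth_derivable oD sY Dx.
have dZ : derivable Z x (X x) := smooth_derivable oD sZ Dx.
have dG : derivable G x (X x) := smooth_derivable oD sG Dx.
have eG : 'D_(X x) G x = P *m G x + G x *m P^T.
  rewrite (derive_basis_sum _ (smooth_differentiable oD sG Dx)) /P mulmx_suml linear_sum.
  rewrite mulmx_sumr -big_split; apply: eq_bigr => i _.
  by rewrite (conn_metric i hG Dx) scalerDr -scalemxAl linearZ -scalemxAr.
have eC U : cov G X U x = 'D_(X x) U x + U x *m P.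
  rewrite /cov christoffel_formE mulmx_sumr; congr (_ + _).
  by apply: eq_bigr => i _; rewrite -scalemxAr.
have d1 := derivable_mulmx dY dG; have d2 := derivable_trmx dZ.
have d3 := derivable_mulmx d1.1 d2.1.
rewrite /ip (derive_mxE 0 0 d3.1) d3.2 d1.2 d2.2 eG !eC.
have tD (A B : 'rV[R]_m) : (A + B)^T = A^T + B^T by apply/matrixP => ? ?; rewrite !mxE.
rewrite tD trmx_mul !(mulmxDl, mulmxDr) !mulmxA.
have gen (a b c d : 'M[R]_1) : (a + (b + c) + d) 0 0 = (a + b) 0 0 + (d + c) 0 0.
  by rewrite !mxE; ring.
exact: gen.
Qed.

Section SecondDerivatives.
Context {R : realType} {n m : nat} (L : local_sub R n m).
Context (Om : set 'rV[R]_n) (D : set 'rV[R]_m) (hL : sub_on L Om D).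
Local Notation F := (lmap L).
Local Notation G := (lamb L).
Local Notation g := (lind L).
Local Notation J := (jacobian (lmap L)).
Implicit Types (X Y Z : 'rV[R]_n -> 'rV[R]_n) (eta zeta : 'rV[R]_n -> 'rV[R]_m).
Implicit Types (z u : 'rV[R]_n) (w : 'rV[R]_m).

Let oOm : open Om := sub_open hL.
Let hg : metric_on Om g. Proof. by have [] := hL. Qed.
Let hG : metric_on D G. Proof. by have [] := hL. Qed.
Let FD z : Om z -> D (F z). Proof. by have [_ _ _ + _] := hL; apply. Qed.

Lemma comp_differentiable p q (A : 'rV[R]_m -> 'M[R]_(p, q)) z :
  smooth_on D A -> Om z -> differentiable (A \o F) z.
Proof.
move=> sA Oz; have [oD _ _ _] := hG.
have dA := smooth_differentiable oD sA (FD Oz).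
exact: (differentiable_comp (lmap_differentiable hL Oz) dA).
Qed.

Lemma differentiable_scale_mx p q (a : 'rV[R]_n -> R) (f : 'rV[R]_n -> 'M[R]_(p, q)) z :
  differentiable a z -> differentiable f z -> differentiable (fun y => a y *: f y) z.
Proof.
move=> da /differentiable_mxP df; apply/differentiable_mxP => i j.
have -> : (fun y => (a y *: f y) i j) = a * (fun y => f y i j).
  by apply/funext => y; rewrite mxE.
exact: differentiableM.
Qed.

Lemma differentiable_bigsum (W : normedModType R) k (f : 'I_k -> 'rV[R]_n -> W) z :
  (forall i, differentiable (f i) z) -> differentiable (fun y => \sum_i f i y) z.
Proof.
move=> df; have -> : (fun y => \sum_i f i y) = \sum_i f i.
  by apply/funext => y; rewrite fct_sumE.
exact: differentiable_sum.
Qed.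

Lemma nor_part_differentiable eta z : Om z -> differentiable eta z ->
  differentiable (fun y => nor_part L y (eta y)) z.
Proof.
move=> Oz de; have dJ := smooth_differentiable oOm (jacobian_smooth hL) Oz.
have dI := smooth_differentiable oOm (invmx_smooth hg) Oz.
have [_ sG _ _] := hG; have dG := comp_differentiable sG Oz.
have -> : (fun y => nor_part L y (eta y)) =
    eta - (fun y => eta y *m (G \o F) y *m (J y)^T *m invmx (g y) *m J y).
  by apply/funext => y.
apply: differentiableB => //.
by do ![apply: differentiable_mulmx => //]; exact: differentiable_trmx.
Qed.

Lemma cov_along_differentiable X Y z : smooth_on Om X -> smooth_on Om Y -> Om z ->
  differentiable (cov_along L X (push L Y)) z.
Proof.
move=> sX sY Oz; have dX := smooth_differentiable oOm sX Oz.
have sP := push_smooth hL sY.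
have dP : differentiable (fun y => pull_conn L y (X y)) z.
  apply: differentiable_bigsum => i; apply: differentiable_scale_mx.
    exact: C1_differentiable_scalar oOm (smooth_entry 0 i oOm (push_smooth hL sX) 1%N) Oz.
  exact: comp_differentiable (conn_smooth i hG) Oz.
have dPP := differentiable_mulmx (smooth_differentiable oOm sP Oz) dP.
have dD := smooth_differentiable oOm (derivative_along_smooth oOm sX sP) Oz.
have -> : cov_along L X (push L Y) =
    fun y => 'D_(X y) (push L Y) y + push L Y y *m pull_conn L y (X y).
  by apply/funext => y; exact: cov_alongE.
exact: differentiableD dD dPP.
Qed.

Lemma II_differentiable X Y z : smooth_on Om X -> smooth_on Om Y -> Om z ->
  differentiable (II L X Y) z.
Proof.
by move=> sX sY Oz; exact: nor_part_differentiable Oz (cov_along_differentiable sX sY Oz).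
Qed.

Lemma II_is_normal X Y z : Om z -> normal_at L z (II L X Y z).
Proof. by move=> Oz; exact: (nor_part_is_normal hL _ Oz). Qed.

Lemma cov_along_eq X eta zeta z : Om z -> (forall y, Om y -> eta y = zeta y) ->
  cov_along L X eta z = cov_along L X zeta z.
Proof.
move=> Oz E; rewrite /cov_along (E _ Oz).
have H : \near z, eta z = zeta z by apply: (open_near_eq oOm Oz) => y; rewrite inE => /E.
by rewrite (near_eq_derive _ H).
Qed.

Lemma cov_alongD X eta zeta z : differentiable eta z -> differentiable zeta z ->
  cov_along L X (fun y => eta y + zeta y) z = cov_along L X eta z + cov_along L X zeta z.
Proof.
move=> de dz; rewrite !cov_alongE mulmxDl addrACA; congr (_ + _).
exact: (deriveD (diff_derivable (v := X z) de) (diff_derivable (v := X z) dz)).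
Qed.

(** Split the first derivative by the Gauss formula, then differentiate the
    tangent part by the Gauss formula and the normal part by Weingarten's. *)
Lemma second_cov_along X Y Z z : smooth_on Om X -> smooth_on Om Y -> smooth_on Om Z -> Om z ->
  cov_along L X (cov_along L Y (push L Z)) z =
  push L (cov g X (cov g Y Z)) z - push L (weingarten L (II L Y Z) X) z
  + (II L X (cov g Y Z) z + cov_perp L X (II L Y Z) z).
Proof.
move=> sX sY sZ Oz; have dZ y (Oy : Om y) := smooth_differentiable oOm sZ Oy.
have sYZ := cov_smooth hg sY sZ; have dYZ := smooth_differentiable oOm sYZ Oz.
rewrite (cov_along_eq X Oz (fun y Oy => gauss_formula hL Y Oy (dZ y Oy))).
have dII := II_differentiable sY sZ Oz.
rewrite (cov_alongD X (push_differentiable hL Oz dYZ) dII) (gauss_formula hL X Oz dYZ).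
have -> : cov_along L X (II L Y Z) z =
    - push L (weingarten L (II L Y Z) X) z + cov_perp L X (II L Y Z) z.
  rewrite /cov_perp /nor_part (tan_cov_normal hL X Oz dII (fun y Oy => II_is_normal Y Z Oy)).
  by rewrite /push mulNmx opprK addrC addrK.
by rewrite addrACA.
Qed.

Lemma II_B X Y Z z : Om z -> differentiable Z z -> forall U, U z = X z - Y z ->
  II L U Z z = II L X Z z - II L Y Z z.
Proof.
move=> Oz dZ U UE; rewrite !(IIE hL _ Oz dZ) -sumrB; apply: eq_bigr => i _.
rewrite -sumrB; apply: eq_bigr => j _.
by rewrite UE !mxE -scalerBl mulrBl.
Qed.

(** The tangential part is the equation of Gauss, the normal part that of Codazzi.
    All derivatives in the curvature of three extended tangent fields are
    tangential, and so is the bracket; each second derivative splits by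
    second_cov_along. *)
Lemma gauss_codazzi X Y Z Xt Yt Zt z : smooth_on Om X -> smooth_on Om Y -> smooth_on Om Z ->
  smooth_on D Xt -> smooth_on D Yt -> smooth_on D Zt ->
  (forall y, Om y -> Xt (F y) = push L X y) ->
  (forall y, Om y -> Yt (F y) = push L Y y) ->
  (forall y, Om y -> Zt (F y) = push L Z y) -> Om z ->
  curv G Xt Yt Zt (F z) =
  push L (curv g X Y Z) z
  + (push L (weingarten L (II L X Z) Y) z - push L (weingarten L (II L Y Z) X) z)
  + (covB L X (II L) Y Z z - covB L Y (II L) X Z z).
Proof.
move=> sX sY sZ sXt sYt sZt EX EY EZ Oz; have [oD _ _ _] := hG.
have dt (U : 'rV[R]_m -> 'rV[R]_m) y : smooth_on D U -> Om y -> differentiable U (F y).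
  by move=> sU Oy; exact: smooth_differentiable oD sU (FD Oy).
have ZF y : Om y -> (Zt \o F) y = push L Z y by move=> /EZ.
have one U Ut y : (forall y, Om y -> Ut (F y) = push L U y) -> Om y ->
    cov G Ut Zt (F y) = cov_along L U (push L Z) y.
  move=> EU Oy; rewrite (cov_restrict hL Oy (dt _ _ sZt Oy) (EU _ Oy)).
  exact: cov_along_eq Oy ZF.
have two U Ut W Wt : smooth_on D Wt -> (forall y, Om y -> Ut (F y) = push L U y) ->
    (forall y, Om y -> Wt (F y) = push L W y) ->
    cov G Ut (cov G Wt Zt) (F z) = cov_along L U (cov_along L W (push L Z)) z.
  move=> sWt EU EW.
  rewrite (cov_restrict hL Oz (dt _ _ (cov_smooth hG sWt sZt) Oz) (EU _ Oz)).
  by apply: (cov_along_eq _ Oz) => y Oy; exact: one.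
have dX := smooth_differentiable oOm sX Oz; have dY := smooth_differentiable oOm sY Oz.
have dZ := smooth_differentiable oOm sZ Oz.
have br : bracket Xt Yt (F z) = push L (bracket X Y) z.
  rewrite -(cov_torsion_free hG sXt sYt (FD Oz)) (cov_restrict hL Oz (dt _ _ sYt Oz) (EX _ Oz)).
  rewrite (cov_restrict hL Oz (dt _ _ sXt Oz) (EY _ Oz)).
  rewrite (cov_along_eq X Oz EY) (cov_along_eq Y Oz EX) (gauss_formula hL X Oz dY) (gauss_formula hL Y Oz dX).
  rewrite (II_sym hL Oz dX dY) opprD addrACA subrr addr0 /push -mulmxBl.
  by rewrite (cov_torsion_free hg sX sY Oz).
have three : cov G (bracket Xt Yt) Zt (F z) =
    push L (cov g (bracket X Y) Z) z + (II L (cov g X Y) Z z - II L (cov g Y X) Z z).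
  rewrite (cov_restrict hL Oz (dt _ _ sZt Oz) br) (cov_along_eq _ Oz ZF) (gauss_formula hL _ Oz dZ).
  by rewrite (II_B Oz dZ (esym (cov_torsion_free hg sX sY Oz))).
rewrite {1}/curv (two X Xt Y Yt sYt EX EY) (two Y Yt X Xt sXt EY EX) three.
rewrite (second_cov_along sX sY sZ Oz) (second_cov_along sY sX sZ Oz) /covB.
have -> : push L (curv g X Y Z) z = push L (cov g X (cov g Y Z)) z
    - push L (cov g Y (cov g X Z)) z - push L (cov g (bracket X Y) Z) z.
  by rewrite /push /curv !mulmxBl.
have gen (a b c d e f p q r s t : 'rV[R]_m) :
   a - b + (c + d) - (e - f + (p + q)) - (r + (s - t)) =
   a - e - r + (f - b) + (d - s - p - (q - t - c)).
  by apply/rowP => l; rewrite !mxE; ring.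
exact: gen.
Qed.

End SecondDerivatives.

(** * Adapted frames *)

(** By frame_invmx the frame is a basis with the expected dual basis. *)
Lemma frame_expansion {R : realType} m (A : 'M[R]_m) (E : 'I_m -> 'rV[R]_m) w :
  (forall a b, ip A (E a) (E b) = (a == b)%:R) -> w = \sum_a ip A w (E a) *: E a.
Proof.
move=> /frame_invmx[uA gE]; rewrite -[LHS](mulmxK uA); apply/rowP => l; rewrite mxE summxE.
under eq_bigr do rewrite gE mulr_sumr.
rewrite exchange_big; apply: eq_bigr => a _; rewrite [RHS]mxE /ip mxE mulr_suml.
by apply: eq_bigr => i _; rewrite [X in _ = _ * X * _]mxE mulrA.
Qed.

Section AdaptedFrame.
Context {R : realType} {n k : nat} (L : local_sub R n (n + k)).
Context (Om : set 'rV[R]_n) (D : set 'rV[R]_(n + k)) (hL : sub_on L Om D).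
Local Notation F := (lmap L).
Local Notation G := (lamb L).
Local Notation g := (lind L).
Local Notation J := (jacobian (lmap L)).
Local Notation TM := ('rV[R]_n -> 'rV[R]_n).
Local Notation TAt := ('rV[R]_(n + k) -> 'rV[R]_(n + k)).
Context (e : 'I_n -> TM) (se : forall i, smooth_on Om (e i)).
Context (et : 'I_n -> TAt) (nt : 'I_k -> TAt).
Context (sF : forall a, smooth_on D (join_frame et nt a)).
Context (on : forall y, D y -> forall a b,
  ip (G y) (join_frame et nt a y) (join_frame et nt b y) = (a == b)%:R).
Context (eE : forall i y, Om y -> et i (F y) = push L (e i) y).
Implicit Types (X Y Z : TM) (eta zeta : 'rV[R]_n -> 'rV[R]_(n + k)).
Implicit Types (z u : 'rV[R]_n) (w : 'rV[R]_(n + k)).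

Let oOm : open Om := sub_open hL.
Let hg : metric_on Om g. Proof. by have [] := hL. Qed.
Let hG : metric_on D G. Proof. by have [] := hL. Qed.
Let FD z : Om z -> D (F z). Proof. by have [_ _ _ + _] := hL; apply. Qed.
Let gS z : Om z -> (g z)^T = g z. Proof. by have [_ _ + _] := hg; apply. Qed.
Let GS y : D y -> (G y)^T = G y. Proof. by have [_ _ + _] := hG; apply. Qed.
Let de i z : Om z -> differentiable (e i) z.
Proof. by move=> Oz; exact: smooth_differentiable oOm (se i) Oz. Qed.

Definition frameN (l : 'I_k) : 'rV[R]_n -> 'rV[R]_(n + k) := nt l \o F.

Lemma join_frameE i : join_frame et nt (lshift k i) = et i.
Proof. by rewrite /join_frame; case: splitP => j /= E; [congr et; apply/val_inj|
  move: (ltn_ord i); rewrite E ltnNge leq_addr]. Qed.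

Lemma join_frameN l : join_frame et nt (rshift n l) = nt l.
Proof. by rewrite /join_frame; case: splitP => j /= E; [move: (ltn_ord j); rewrite -E ltnNge leq_addr|
  congr nt; apply/val_inj; move/addnI: E]. Qed.

Lemma sum_join_frame (f : TAt -> 'rV[R]_(n + k)) :
  \sum_a f (join_frame et nt a) = \sum_i f (et i) + \sum_l f (nt l).
Proof.
rewrite big_split_ord; congr (_ + _); apply: eq_bigr => i _.
  by rewrite join_frameE.
by rewrite join_frameN.
Qed.

Lemma set_smooth i : smooth_on D (et i). Proof. by rewrite -join_frameE. Qed.
Lemma snt_smooth l : smooth_on D (nt l). Proof. by rewrite -join_frameN. Qed.

Lemma et_on i j y : D y -> ip (G y) (et i y) (et j y) = (i == j)%:R.
Proof. by move=> Dy; rewrite -!join_frameE on// eq_lshift. Qed.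

Lemma nt_on l l' y : D y -> ip (G y) (nt l y) (nt l' y) = (l == l')%:R.
Proof. by move=> Dy; rewrite -!join_frameN on// eq_rshift. Qed.

Lemma nt_et l i y : D y -> ip (G y) (nt l y) (et i y) = 0.
Proof. by move=> Dy; rewrite -join_frameN -join_frameE on// eq_rlshift. Qed.

Lemma e_on i j z : Om z -> ip (g z) (e i z) (e j z) = (i == j)%:R.
Proof.
by move=> Oz; rewrite -(push_ip hL _ _ Oz) -!/(push L _ z) -!eE// et_on//; exact: FD.
Qed.

Lemma e_expansion z u : Om z -> u = \sum_i ip (g z) u (e i z) *: e i z.
Proof. by move=> Oz; apply: frame_expansion => i j; exact: e_on. Qed.

Lemma ambient_expansion y w : D y -> w = \sum_i ip (G y) w (et i y) *: et i y
  + \sum_l ip (G y) w (nt l y) *: nt l y.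
Proof.
move=> Dy; rewrite {1}(frame_expansion w (on Dy)) (sum_join_frame (fun A => ip (G y) w (A y) *: A y)).
by [].
Qed.

Lemma ip_e_inj z u u' : Om z -> (forall i, ip (g z) u (e i z) = ip (g z) u' (e i z)) -> u = u'.
Proof.
move=> Oz H; rewrite (e_expansion u Oz) (e_expansion u' Oz).
by apply: eq_bigr => i _; rewrite H.
Qed.

Lemma frameN_normal l z : Om z -> normal_at L z (frameN l z).
Proof.
move=> Oz a; rewrite pushbE rowE -/(basis_vec a) (e_expansion (basis_vec a) Oz) mulmx_suml.
rewrite ip_sumr big1// => i _; rewrite -scalemxAl ipZr -/(push L (e i) z) -eE//.
by rewrite nt_et ?mulr0//; exact: FD.
Qed.

Lemma ip_normal_push z w u : Om z -> normal_at L z w -> ip (G (F z)) w (u *m J z) = 0.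
Proof. by move=> Oz nw; rewrite (ip_tan hL _ _ Oz) (normal_tan nw) ip0l. Qed.

Lemma normal_expansion z w : Om z -> normal_at L z w ->
  w = \sum_l ip (G (F z)) w (frameN l z) *: frameN l z.
Proof.
move=> Oz nw; rewrite {1}(ambient_expansion w (FD Oz)) big1 ?add0r// => i _.
by rewrite eE// (ip_normal_push _ Oz nw) scale0r.
Qed.

Lemma normal_parseval z w w' : Om z -> normal_at L z w ->
  ip (G (F z)) w w' = \sum_l ip (G (F z)) w (frameN l z) * ip (G (F z)) (frameN l z) w'.
Proof.
move=> Oz nw; rewrite {1}(normal_expansion Oz nw) ip_suml.
by apply: eq_bigr => l _; rewrite ipZl.
Qed.

Lemma push_tan_expansion z w : Om z ->
  tan_part L z w *m J z = \sum_i ip (G (F z)) w (et i (F z)) *: et i (F z).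
Proof.
move=> Oz; rewrite {1}(e_expansion (tan_part L z w) Oz) mulmx_suml; apply: eq_bigr => i _.
by rewrite -scalemxAl eE// (ip_tan hL _ _ Oz).
Qed.

Lemma nor_part_expansion z w : Om z ->
  nor_part L z w = \sum_l ip (G (F z)) w (frameN l z) *: frameN l z.
Proof.
move=> Oz; rewrite /nor_part (push_tan_expansion _ Oz) {1}(ambient_expansion w (FD Oz)).
by rewrite addrAC subrr add0r.
Qed.

(** II is tensorial: only the value of X at z matters. *)
Lemma II_suml (c : 'I_n -> R) X Y z : Om z -> differentiable Y z ->
  X z = \sum_i c i *: e i z -> II L X Y z = \sum_i c i *: II L (e i) Y z.
Proof.
move=> Oz dY XE; rewrite (IIE hL _ Oz dY) XE.
under [RHS]eq_bigr do rewrite (IIE hL _ Oz dY) scaler_sumr.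
rewrite [RHS]exchange_big; apply: eq_bigr => a _; rewrite summxE.
under [RHS]eq_bigr do rewrite scaler_sumr.
rewrite [RHS]exchange_big; apply: eq_bigr => b _.
rewrite mulr_suml scaler_suml; apply: eq_bigr => i _.
by rewrite mxE scalerA mulrA.
Qed.

(** The definition of the shape operator extends from coordinate fields to all
    fields by bilinearity of II. *)
Lemma ip_weingarten eta X Y z : Om z -> differentiable Y z ->
  ip (g z) (weingarten L eta X z) (Y z) = ip (G (F z)) (eta z) (II L X Y z).
Proof.
move=> Oz dY; have ug := metric_unit hg Oz.
rewrite /ip /weingarten /sharp mulmxKV// -[RHS]/(ip (G (F z)) (eta z) (II L X Y z)).
have -> : II L X Y z = \sum_a Y z 0 a *: II L X (coord_field a) z.
  rewrite (IIE hL _ Oz dY) exchange_big; apply: eq_bigr => a _.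
  have dc := smooth_differentiable oOm (coord_field_smooth Om a) Oz.
  rewrite (IIE hL _ Oz dc) scaler_sumr; apply: eq_bigr => i _.
  rewrite (bigD1 a)//= big1 ?addr0; last first.
    by move=> b ba; rewrite mxE eqxx /= (negPf ba) mulr0 scale0r.
  by rewrite mxE !eqxx mulr1 scalerA mulrC.
rewrite mxE ip_sumr; apply: eq_bigr => a _.
by rewrite ipZr mulrC mxE [X in _ * X = _]mxE.
Qed.

Lemma weingarten_sum (I : Type) (s : seq I) (c : I -> R)
    (etas : I -> 'rV[R]_n -> 'rV[R]_(n + k)) eta X z :
  eta z = \sum_(i <- s) c i *: etas i z ->
  weingarten L eta X z = \sum_(i <- s) c i *: weingarten L (etas i) X z.
Proof.
move=> E; rewrite /weingarten /sharp; under [RHS]eq_bigr do rewrite scalemxAl.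
rewrite -mulmx_suml; congr (_ *m _); apply/rowP => a; rewrite mxE summxE E ip_suml.
by apply: eq_bigr => i _; rewrite ipZl !mxE.
Qed.

(** Both sides pair with e_j to the sum over i and l of
    <II(e_i, V), N_l> <N_l, II(e_i, e_j)>. *)
Lemma sum_weingarten_II V z : Om z -> smooth_on Om V ->
  \sum_i weingarten L (II L (e i) V) (e i) z =
  \sum_l weingarten L (frameN l) (weingarten L (frameN l) V) z.
Proof.
move=> Oz sV; have dV := smooth_differentiable oOm sV Oz.
apply: (ip_e_inj Oz) => j; rewrite !ip_suml.
transitivity (\sum_i \sum_l ip (G (F z)) (II L (e i) V z) (frameN l z)
   * ip (G (F z)) (frameN l z) (II L (e i) (e j) z)).
  apply: eq_bigr => i _; rewrite (ip_weingarten _ _ Oz (de j Oz)).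
  by apply: normal_parseval => //; exact: II_is_normal hL (e i) V z Oz.
rewrite exchange_big; apply: eq_bigr => l _; rewrite (ip_weingarten _ _ Oz (de j Oz)).
rewrite (II_suml Oz (de j Oz) (e_expansion _ Oz)) ip_sumr; apply: eq_bigr => i _.
rewrite ipZr (ip_weingarten _ _ Oz (de i Oz)) (ipC _ _ (GS (FD Oz))).
by rewrite (II_sym hL Oz (de i Oz) dV).
Qed.

Context (Ht : TAt) (sHt : smooth_on D Ht).
Context (HE : forall y, Om y -> Ht (F y) = mean_curv_vec L e y).
Context (n0 : (0 < n)%N).

Let nR : n%:R != 0 :> R. Proof. by rewrite pnatr_eq0 -lt0n. Qed.

Lemma sum_II_e z : \sum_i II L (e i) (e i) z = n%:R *: mean_curv_vec L e z.
Proof. by rewrite /mean_curv_vec scalerA mulfV// scale1r. Qed.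

Lemma sum_weingarten_mean V z :
  \sum_i weingarten L (II L (e i) (e i)) V z = n%:R *: weingarten L (mean_curv_vec L e) V z.
Proof.
rewrite (@weingarten_sum _ (index_enum 'I_n) (fun=> n%:R^-1) (fun i => II L (e i) (e i))); last first.
  by rewrite /mean_curv_vec scaler_sumr.
by rewrite -scaler_sumr scalerA mulfV// scale1r.
Qed.

(** The frame stays orthonormal, so the components of cov V e_i in the frame are
    skew, while II is symmetric. *)
Lemma sum_II_cov_e V z : Om z -> smooth_on Om V -> \sum_i II L (e i) (cov g V (e i)) z = 0.
Proof.
move=> Oz sV; have dV := smooth_differentiable oOm sV Oz.
have dc i := smooth_differentiable oOm (cov_smooth hg sV (se i)) Oz.
pose om i j := ip (g z) (cov g V (e i) z) (e j z).
have skew i j : om i j = - om j i.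
  have := cov_metric V hg (se i) (se j) Oz.
  have E : \near z, ip (g z) (e i z) (e j z) = (i == j)%:R.
    by apply: (open_near_eq oOm Oz) => y; rewrite inE => Oy; exact: e_on.
  rewrite (near_eq_derive _ E) derive_cst => /esym/eqP; rewrite addr_eq0 => /eqP.
  by rewrite /om => ->; rewrite (ipC _ _ (gS Oz)).
have S i : II L (e i) (cov g V (e i)) z = \sum_j om i j *: II L (e j) (e i) z.
  rewrite (II_sym hL Oz (de i Oz) (dc i)).
  exact: II_suml Oz (de i Oz) (e_expansion _ Oz).
have E : \sum_i II L (e i) (cov g V (e i)) z = - \sum_i II L (e i) (cov g V (e i)) z.
  rewrite {1}(eq_bigr _ (fun i _ => S i)) exchange_big -sumrN; apply: eq_bigr => i _.
  rewrite S -sumrN; apply: eq_bigr => j _.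
  by rewrite skew scaleNr (II_sym hL Oz (de i Oz) (de j Oz)).
have gen (a : 'rV[R]_(n + k)) : a = - a -> a = 0.
  by move=> H; apply/rowP => l; have := congr1 (fun u : 'rV[R]_(n + k) => u 0 l) H; rewrite !mxE; lra.
exact: gen E.
Qed.

Lemma cov_cov_restrict X Y Z Xt Yt Zt z : smooth_on Om X -> smooth_on Om Y -> smooth_on Om Z ->
  smooth_on D Yt -> smooth_on D Zt ->
  (forall y, Om y -> Xt (F y) = push L X y) ->
  (forall y, Om y -> Yt (F y) = push L Y y) ->
  (forall y, Om y -> Zt (F y) = push L Z y) -> Om z ->
  cov G Xt (cov G Yt Zt) (F z) = cov_along L X (cov_along L Y (push L Z)) z.
Proof.
move=> sX sY sZ sYt sZt EX EY EZ Oz; have [oD _ _ _] := hG.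
have dt (U : TAt) y : smooth_on D U -> Om y -> differentiable U (F y).
  by move=> sU Oy; exact: smooth_differentiable oD sU (FD Oy).
rewrite (cov_restrict hL Oz (dt _ _ (cov_smooth hG sYt sZt) Oz) (EX _ Oz)).
apply: (cov_along_eq hL _ Oz) => y Oy.
rewrite -[RHS](cov_along_eq hL Y (eta := Zt \o F) Oy) //.
exact: (cov_restrict hL Oy (dt _ _ sZt Oy) (EY _ Oy)).
Qed.

(** * The general formulas *)

Context (DM : set 'rV[R]_n) (hgM : metric_on DM g) (ODM : Om `<=` DM).
Context (V : TM) (sVM : smooth_on DM V) (Vt : TAt) (sVt : smooth_on D Vt).
Context (VE : forall y, Om y -> Vt (F y) = push L V y).

Let sV : smooth_on Om V. Proof. by move=> r; exact: Cr_on_sub ODM (sVM r). Qed.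
Let dV z : Om z -> differentiable V z.
Proof. by move=> Oz; exact: smooth_differentiable oOm sV Oz. Qed.
Let dVt z : Om z -> differentiable Vt (F z).
Proof. by move=> Oz; have [oD _ _ _] := hG; exact: smooth_differentiable oD sVt (FD Oz). Qed.
Let det i z : Om z -> differentiable (et i) (F z).
Proof. by move=> Oz; have [oD _ _ _] := hG; exact: smooth_differentiable oD (set_smooth i) (FD Oz). Qed.

Lemma cov_push_direction X Xt z : Om z -> Xt (F z) = push L X z ->
  cov G Xt Vt (F z) = push L (cov g X V) z + II L X V z.
Proof.
move=> Oz EX; rewrite (cov_restrict hL Oz (dVt Oz) EX) (cov_along_eq hL X Oz VE).
exact (gauss_formula hL X Oz (dV Oz)).
Qed.

(** The direction of the outer derivative splits by the Gauss formula; the part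
    II(e_i, e_i) is normal and is summed later. *)
Lemma cov_cov_frame i z : Om z -> cov G (cov G (et i) (et i)) Vt (F z) =
  push L (cov g (cov g (e i) (e i)) V) z + II L (cov g (e i) (e i)) V z
  + cov G (fun=> II L (e i) (e i) z) Vt (F z).
Proof.
move=> Oz; rewrite -(@cov_push_direction _ (fun=> push L (cov g (e i) (e i)) z) z Oz erefl).
refine (covDl _ (dVt Oz) _); rewrite (cov_restrict hL Oz (det i Oz) (eE i Oz)).
rewrite (cov_along_eq hL (e i) Oz (eE i)); exact (gauss_formula hL (e i) Oz (de i Oz)).
Qed.

(** Covariant derivatives are linear in the direction, and the directions sum to n
    times the mean curvature vector. *)
Lemma sum_cov_II z : Om z ->
  \sum_i cov G (fun=> II L (e i) (e i) z) Vt (F z) = n%:R *: cov G Ht Vt (F z).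
Proof.
move=> Oz; under eq_bigr do rewrite (covE _ _ (dVt Oz)).
rewrite (covE _ _ (dVt Oz)) exchange_big scaler_sumr; apply: eq_bigr => a _.
by rewrite -scaler_suml scalerA -summxE sum_II_e (HE Oz) mxE.
Qed.

(** The part of the ambient rough Laplacian over the tangent directions. *)
Lemma sum_rough_tangent z : Om z ->
  \sum_i (cov G (et i) (cov G (et i) Vt) (F z) - cov G (cov G (et i) (et i)) Vt (F z)) =
  (\sum_i (cov g (e i) (cov g (e i) V) z - cov g (cov g (e i) (e i)) V z)) *m J z
  - \sum_l push L (weingarten L (frameN l) (weingarten L (frameN l) V)) z
  + 2%:R *: \sum_i II L (e i) (cov g (e i) V) z + tr_covB_II L e V z
  - n%:R *: cov G Ht Vt (F z).
Proof.
move=> Oz; rewrite -(sum_cov_II Oz) /push -mulmx_suml -(sum_weingarten_II Oz sV).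
rewrite !mulmx_suml scaler_sumr -!sumrN -!big_split; apply: eq_bigr => i _.
rewrite (cov_cov_restrict (se i) (se i) sV (set_smooth i) sVt (eE i) (eE i) VE Oz).
rewrite (second_cov_along hL (se i) (se i) sV Oz) (cov_cov_frame i Oz) /covB /push mulmxBl.
have gen (a b c d f h p : 'rV[R]_(n + k)) :
  a - b + (c + d) - (f + h + p) = a - f - b + 2%:R *: c + (d - h - c) - p.
  by apply/rowP => l; rewrite !mxE; ring.
exact: gen.
Qed.

Lemma weingarten_eq eta zeta X z : eta z = zeta z -> weingarten L eta X z = weingarten L zeta X z.
Proof. by move=> E; rewrite /weingarten E. Qed.

(** The contribution of the tangent directions to the ambient Ricci tensor. *)
Lemma sum_curv_tangent z : Om z ->
  \sum_i curv G (et i) Vt (et i) (F z) =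
  (\sum_i curv g (e i) V (e i) z) *m J z
  + (n%:R *: push L (weingarten L (mean_curv_vec L e) V) z
     - \sum_l push L (weingarten L (frameN l) (weingarten L (frameN l) V)) z)
  + \sum_i (covB L (e i) (II L) V (e i) z - covB L V (II L) (e i) (e i) z).
Proof.
move=> Oz.
have WM : n%:R *: push L (weingarten L (mean_curv_vec L e) V) z =
    \sum_i weingarten L (II L (e i) (e i)) V z *m J z.
  by rewrite -mulmx_suml sum_weingarten_mean -scalemxAl.
have WW : \sum_l push L (weingarten L (frameN l) (weingarten L (frameN l) V)) z =
    \sum_i weingarten L (II L (e i) V) (e i) z *m J z.
  by rewrite -[RHS]mulmx_suml (sum_weingarten_II Oz sV) mulmx_suml.
rewrite WM WW mulmx_suml -sumrN -!big_split; apply: eq_bigr => i _.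
rewrite (gauss_codazzi hL (se i) sV (se i) (set_smooth i) sVt (set_smooth i) (eE i) VE (eE i) Oz).
exact (congr1 (fun w : 'rV[R]_n => _ + (_ - w *m J z) + _) (weingarten_eq (e i) (II_sym hL Oz (dV Oz) (de i Oz)))).
Qed.

(** Reversing all four arguments is the pair symmetry and a sign in each pair. *)
Lemma curv4_rev y (X Y Z W : TAt) : D y -> smooth_on D X -> smooth_on D Y -> smooth_on D Z ->
  smooth_on D W -> curv4 G X Y W Z y = curv4 G Z W Y X y.
Proof.
move=> Dy sX sY sZ sW; rewrite (curv4_pair hG sX sY sW sZ Dy) (curv4_antisym34 hG sW sZ sX sY Dy).
rewrite (curv4_pair hG sW sZ sY sX Dy) (curv4_antisym34 hG sY sX sW sZ Dy) opprK.
exact: (curv4_pair hG sY sX sZ sW Dy).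
Qed.

(** Moves V out of the alternating slot of the curvature, to the form in which the
    normal curvature terms appear in the formulas. *)
Lemma normal_curvature_tan l z : Om z ->
  tan_part L z (curv G (nt l) Vt (nt l) (F z)) *m J z =
  - \sum_i ip (G (F z)) (curv G (nt l) (et i) Vt (F z)) (nt l (F z)) *: et i (F z).
Proof.
move=> Oz; rewrite (push_tan_expansion _ Oz) -sumrN; apply: eq_bigr => i _.
rewrite -scaleNr; congr (_ *: _).
rewrite -!/(curv4 _ _ _ _ _ _) (curv4_antisym34 hG (snt_smooth l) sVt (snt_smooth l) (set_smooth i) (FD Oz)).
by rewrite (curv4_rev (FD Oz) (snt_smooth l) sVt (snt_smooth l) (set_smooth i)).
Qed.

Local Notation Ricv := (ric_vec G (join_frame et nt) Vt).

Lemma ric_vec_split z : Om z -> Ricv (F z) =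
  - (\sum_i curv G (et i) Vt (et i) (F z) + \sum_l curv G (nt l) Vt (nt l) (F z)).
Proof.
move=> Oz; rewrite (ric_vecE hG sVt sF (FD Oz)) (sum_join_frame (fun A => curv G A Vt A (F z))).
by [].
Qed.

Lemma normal_atB z w w' : normal_at L z w -> normal_at L z w' -> normal_at L z (w - w').
Proof. by move=> nw nw' a; rewrite ipDl ipNl nw nw' subrr. Qed.

Lemma covB_II_normal X Y Z z : Om z -> smooth_on Om X -> smooth_on Om Y -> smooth_on Om Z ->
  normal_at L z (covB L X (II L) Y Z z).
Proof.
move=> Oz sX sY sZ.
exact (normal_atB (normal_atB (nor_part_is_normal hL _ Oz) (II_is_normal hL (cov g X Y) Z Oz))
  (II_is_normal hL Y (cov g X Z) Oz)).
Qed.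

Lemma tan_sum (I : Type) (s : seq I) (w : I -> 'rV[R]_(n + k)) z :
  tan_part L z (\sum_(i <- s) w i) = \sum_(i <- s) tan_part L z (w i).
Proof. by rewrite tan_partE mulmx_suml; apply: eq_bigr => i _; rewrite tan_partE. Qed.

Lemma codazzi_normal i z : Om z ->
  normal_at L z (covB L (e i) (II L) V (e i) z - covB L V (II L) (e i) (e i) z).
Proof.
by move=> Oz; exact (normal_atB (covB_II_normal Oz (se i) sV (se i)) (covB_II_normal Oz sV (se i) (se i))).
Qed.

(** The intrinsic Ricci tensor, by the equation of Gauss, and the normal curvature
    terms. *)
Lemma ric_vec_tan z : Om z ->
  tan_part L z (Ricv (F z)) *m J z =
  - ((\sum_i curv g (e i) V (e i) z) *m J z)
  - n%:R *: push L (weingarten L (mean_curv_vec L e) V) z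
  + \sum_l push L (weingarten L (frameN l) (weingarten L (frameN l) V)) z
  + \sum_l \sum_i ip (G (F z)) (curv G (nt l) (et i) Vt (F z)) (nt l (F z)) *: et i (F z).
Proof.
move=> Oz.
have tanD (w w' : 'rV[R]_(n + k)) : tan_part L z (- (w + w')) *m J z =
    - (tan_part L z w *m J z) - tan_part L z w' *m J z.
  by rewrite !tan_partE mulNmx mulmxDl mulNmx mulmxDl opprD.
have nc : tan_part L z (\sum_l curv G (nt l) Vt (nt l) (F z)) *m J z =
    - \sum_l \sum_i ip (G (F z)) (curv G (nt l) (et i) Vt (F z)) (nt l (F z)) *: et i (F z).
  rewrite tan_sum mulmx_suml -sumrN; apply: eq_bigr => l _; exact: normal_curvature_tan.
have tc : tan_part L z (\sum_i curv G (et i) Vt (et i) (F z)) *m J z =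
    (\sum_i curv g (e i) V (e i) z) *m J z
    + (n%:R *: push L (weingarten L (mean_curv_vec L e) V) z
       - \sum_l push L (weingarten L (frameN l) (weingarten L (frameN l) V)) z).
  rewrite (sum_curv_tangent Oz) tan_partE [X in X *m _]mulmxDl -!tan_partE.
  rewrite [X in _ + X]tan_sum [X in _ + X]big1 ?addr0; last first.
    by move=> i _; exact: normal_tan (codazzi_normal i Oz).
  rewrite [X in _ - X](_ : _ = (\sum_l weingarten L (frameN l) (weingarten L (frameN l) V) z) *m J z); last first.
    by rewrite mulmx_suml.
  by rewrite /push scalemxAl -mulmxBl -mulmxDl (tan_push hL _ Oz).
rewrite (ric_vec_split Oz) tanD nc tc opprK; congr (_ + _).
have gen (a b c : 'rV[R]_(n + k)) : - (a + (b - c)) = - a - b + c.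
  by apply/rowP => l; rewrite !mxE; ring.
exact: gen.
Qed.

(** The two Weitzenboeck formulas compared. The term with the trace of the derivative
    of II comes from the rough Laplacian; the Ricci terms contribute the tangential
    curvature and one more copy of the shape operator terms. *)
Lemma hodge_laplacian_submanifold z : Om z ->
  hodge_laplacian D G Vt (F z) =
     push L (hodge_laplacian DM g V) z
     + 2%:R *: \sum_(l < k) push L (weingarten L (frameN l) (weingarten L (frameN l) V)) z
     - n%:R *: push L (weingarten L (mean_curv_vec L e) V) z
     + \sum_(l < k) \sum_(i < n)
         ip (G (F z)) (curv G (nt l) (et i) Vt (F z)) (nt l (F z)) *: et i (F z)
     + n%:R *: cov G Ht Vt (F z)
     - \sum_(l < k) cov G (nt l) (cov G (nt l) Vt) (F z)
     + \sum_(l < k) cov G (cov G (nt l) (nt l)) Vt (F z)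
     - tr_covB_II L e V z
     - 2%:R *: \sum_(i < n) II L (e i) (cov g (e i) V) z
     + nor_part L z (Ricv (F z)).
Proof.
move=> Oz; have [oD _ _ _] := hG.
rewrite (weitzenboeck hG sVt oD (fun _ => id) (FD Oz) sF (on (FD Oz))) -(ric_vecE hG sVt sF (FD Oz)).
rewrite (sum_join_frame (fun A => cov G A (cov G A Vt) (F z) - cov G (cov G A A) Vt (F z))).
rewrite (sum_rough_tangent Oz) [X in - (_ + X) + _ = _]sumrB.
rewrite [X in _ + X = _](_ : _ = tan_part L z (Ricv (F z)) *m J z + nor_part L z (Ricv (F z))); last first.
  by rewrite /nor_part addrC subrK.
rewrite (ric_vec_tan Oz) [X in _ = X + _ - _ + _ + _ - _ + _ - _ - _ + _]/push.
rewrite (weitzenboeck hgM sVM oOm ODM Oz se (fun i j => e_on i j Oz)) mulmxDl !mulNmx.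
have gen (a b c d f h p q r s t : 'rV[R]_(n + k)) :
  - (a - b + 2%:R *: c + d - f + (h - p)) + (- q - r + b + s + t) =
  - a - q + 2%:R *: b - r + s + f - h + p - d - 2%:R *: c + t.
  by apply/rowP => l; rewrite !mxE; ring.
exact: gen.
Qed.

Local Notation H0 := (mean_curv_vec L e).

Lemma II_e_differentiable i z : Om z -> differentiable (II L (e i) (e i)) z.
Proof. by move=> Oz; exact: II_differentiable hL _ _ _ (se i) (se i) Oz. Qed.

Lemma mean_curv_differentiable z : Om z -> differentiable H0 z.
Proof.
move=> Oz; have dS : differentiable (fun y => \sum_i II L (e i) (e i) y) z.
  by apply: differentiable_bigsum => i; exact: II_e_differentiable.
exact: (@differentiableZ _ _ _ _ n%:R^-1 _ dS).
Qed.

Lemma mean_curv_normal z : Om z -> normal_at L z (H0 z).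
Proof.
move=> Oz a; rewrite /mean_curv_vec ipZl ip_suml big1 ?mulr0// => i _.
exact: (II_is_normal hL (e i) (e i) Oz a).
Qed.

(** The normal connection commutes with the trace: it is additive. *)
Lemma sum_cov_perp_II z : Om z ->
  \sum_i cov_perp L V (II L (e i) (e i)) z = n%:R *: cov_perp L V H0 z.
Proof.
move=> Oz; have dII i := II_e_differentiable i Oz.
have E : n%:R *: cov_along L V H0 z = \sum_i cov_along L V (II L (e i) (e i)) z.
  have dS : 'D_(V z) H0 z = n%:R^-1 *: \sum_i 'D_(V z) (II L (e i) (e i)) z.
    have [dS <-] := derive_bigsum (index_enum 'I_n) (fun i => diff_derivable (v := V z) (dII i)).
    exact: deriveZ dS.
  rewrite cov_alongE dS scalerDr scalerA mulfV// scale1r scalemxAl -sum_II_e mulmx_suml -big_split.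
  by apply: eq_bigr => i _; rewrite cov_alongE.
rewrite /cov_perp !nor_partE scalemxAl E mulmx_suml; apply: eq_bigr => i _; exact: nor_partE.
Qed.

(** The derivative of a symmetric form is symmetric. *)
Lemma covB_II_sym X Y Z z : Om z -> smooth_on Om X -> smooth_on Om Y -> smooth_on Om Z ->
  covB L X (II L) Y Z z = covB L X (II L) Z Y z.
Proof.
move=> Oz sX sY sZ; have dY y (Oy : Om y) := smooth_differentiable oOm sY Oy.
have dZ y (Oy : Om y) := smooth_differentiable oOm sZ Oy.
have dXY := smooth_differentiable oOm (cov_smooth hg sX sY) Oz.
have dXZ := smooth_differentiable oOm (cov_smooth hg sX sZ) Oz.
have E : cov_perp L X (II L Y Z) z = cov_perp L X (II L Z Y) z.
  exact (congr1 (nor_part L z) (cov_along_eq hL X Oz (fun y Oy => II_sym hL Oy (dY y Oy) (dZ y Oy)))).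
have gen (a b c : 'rV[R]_(n + k)) : a - b - c = a - c - b by rewrite addrAC.
apply: (etrans (gen _ _ _)); rewrite /covB E (II_sym hL Oz (dY z Oz) dXZ).
by rewrite (II_sym hL Oz dXY (dZ z Oz)).
Qed.

(** Contracting the Codazzi equation with the frame; the terms in which V
    differentiates the frame drop out by sum_II_cov_e. *)
Lemma sum_codazzi z : Om z ->
  \sum_i (covB L (e i) (II L) V (e i) z - covB L V (II L) (e i) (e i) z) =
  tr_covB_II L e V z - n%:R *: cov_perp L V H0 z.
Proof.
move=> Oz; apply: (etrans (sumrB _ _ _ _)); apply: (congr2 (fun a b : 'rV[R]_(n + k) => a - b)).
  by apply: eq_bigr => i _; exact: covB_II_sym Oz (se i) sV (se i).
rewrite -(sum_cov_perp_II Oz) /covB.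
have E : \sum_i II L (cov g V (e i)) (e i) z = 0.
  apply: (etrans _ (sum_II_cov_e Oz sV)); apply: eq_bigr => i _.
  exact (II_sym hL Oz (smooth_differentiable oOm (cov_smooth hg sV (se i)) Oz) (de i Oz)).
have gen (f p q : 'I_n -> 'rV[R]_(n + k)) : \sum_i p i = 0 -> \sum_i q i = 0 ->
    \sum_i (f i - p i - q i) = \sum_i f i.
  by rewrite !sumrB => -> ->; rewrite !subr0.
exact: gen _ _ _ E (sum_II_cov_e Oz sV).
Qed.

Lemma nor_sum (I : Type) (s : seq I) (w : I -> 'rV[R]_(n + k)) z :
  nor_part L z (\sum_(i <- s) w i) = \sum_(i <- s) nor_part L z (w i).
Proof. by rewrite nor_partE mulmx_suml; apply: eq_bigr => i _; rewrite nor_partE. Qed.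

Lemma sum_nor_curv z : Om z ->
  \sum_i nor_part L z (curv G (et i) Vt (et i) (F z)) =
  tr_covB_II L e V z - n%:R *: cov_perp L V H0 z.
Proof.
move=> Oz; rewrite -(sum_codazzi Oz); apply: eq_bigr => i _.
rewrite (gauss_codazzi hL (se i) sV (se i) (set_smooth i) sVt (set_smooth i) (eE i) VE (eE i) Oz).
have gen (a b c : 'rV[R]_n) (w : 'rV[R]_(n + k)) : normal_at L z w ->
    nor_part L z (a *m J z + (b *m J z - c *m J z) + w) = w.
  move=> nw; rewrite -mulmxBl -mulmxDl nor_partE mulmxDl -!nor_partE (nor_push hL _ Oz) add0r.
  exact: normal_nor nw.
exact: (gen _ _ _ _ (codazzi_normal i Oz)).
Qed.

(** Weingarten's equation for the normal field H. *)
Lemma cov_mean_curv z : Om z -> cov G Vt Ht (F z) =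
  - push L (weingarten L H0 V) z + cov_perp L V H0 z.
Proof.
move=> Oz; have [oD _ _ _] := hG; have dH := smooth_differentiable oD sHt (FD Oz).
rewrite (cov_restrict hL Oz dH (VE Oz)) (cov_along_eq hL V Oz HE) /cov_perp /nor_part.
rewrite (tan_cov_normal hL V Oz (mean_curv_differentiable Oz) mean_curv_normal).
by rewrite /push mulNmx opprK addrC addrK.
Qed.

(** Starting from hodge_laplacian_submanifold, the derivative of v along H is
    traded for the bracket; the normal derivative of H that appears is absorbed by
    the contracted Codazzi equation. *)
Lemma hodge_laplacian_submanifold_bracket z : Om z ->
  hodge_laplacian D G Vt (F z) =
     push L (hodge_laplacian DM g V) z
     + 2%:R *: \sum_(l < k) push L (weingarten L (frameN l) (weingarten L (frameN l) V)) z
     - (2%:R * n%:R) *: push L (weingarten L H0 V) z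
     + \sum_(l < k) \sum_(i < n)
         ip (G (F z)) (curv G (nt l) (et i) Vt (F z)) (nt l (F z)) *: et i (F z)
     + n%:R *: bracket Ht Vt (F z)
     - \sum_(l < k) cov G (nt l) (cov G (nt l) Vt) (F z)
     + \sum_(l < k) cov G (cov G (nt l) (nt l)) Vt (F z)
     - 2%:R *: \sum_(i < n) II L (e i) (cov g (e i) V) z
     - \sum_(i < n) nor_part L z (curv G (et i) Vt (et i) (F z))
     + nor_part L z (Ricv (F z)).
Proof.
move=> Oz; rewrite (hodge_laplacian_submanifold Oz) (sum_nor_curv Oz).
rewrite -(cov_torsion_free hG sHt sVt (FD Oz)) (cov_mean_curv Oz).
have gen (c : R) (a b f h p q r s t x y : 'rV[R]_(n + k)) :
  a + 2%:R *: b - c *: f + h + c *: p - q + r - s - t + x =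
  a + 2%:R *: b - (2%:R * c) *: f + h + c *: (p - (- f + y)) - q + r - t
    - (s - c *: y) + x.
  by apply/rowP => l; rewrite !mxE; ring.
exact: gen.
Qed.

(** * Hypersurfaces *)

Context (k1 : k = 1%N) (l : 'I_k).
Local Notation N := (frameN l).
Local Notation Hs := (mean_curv L N e).
Local Notation h := (sff L N).

Lemma sum_codim1 (W : nmodType) (f : 'I_k -> W) : \sum_j f j = f l.
Proof.
have ord0 (j : 'I_k) : j = 0%N :> nat.
  by apply/eqP; rewrite -leqn0 -ltnS (leq_trans (ltn_ord j))// k1.
rewrite (bigD1 l)//= big1 ?addr0// => j /negP[]; apply/eqP/val_inj.
by rewrite /= !ord0.
Qed.

(** In codimension one the normal space is spanned by N. *)
Lemma normal_line z w : Om z -> normal_at L z w -> w = ip (G (F z)) (N z) w *: N z.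
Proof.
move=> Oz nw; rewrite {1}(normal_expansion Oz nw) sum_codim1.
by rewrite (ipC _ _ (GS (FD Oz))).
Qed.

Let dN z : Om z -> differentiable N z.
Proof. by move=> Oz; exact: (comp_differentiable hL (snt_smooth l) Oz). Qed.

(** Differentiate |N|^2 = 1. *)
Lemma ip_cov_unit X z : Om z -> ip (G (F z)) (N z) (cov_along L X N z) = 0.
Proof.
move=> Oz; have := cov_along_metric hL X Oz (dN Oz) (dN Oz).
have E : \near z, ip (G (F z)) (N z) (N z) = 1.
  apply: (open_near_eq oOm Oz) => y; rewrite inE => Oy.
  by rewrite (nt_on l l (FD Oy)) eqxx.
rewrite (near_eq_derive _ E) derive_cst (ipC (cov_along L X N z) _ (GS (FD Oz))).
have gen (a : R) : 0 = a + a -> a = 0 by move=> H; lra.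
exact: gen.
Qed.

Lemma ip_unit_nor z w : Om z -> ip (G (F z)) (N z) (nor_part L z w) = ip (G (F z)) (N z) w.
Proof.
move=> Oz; rewrite /nor_part ipDr ipNr (ip_normal_push _ Oz (frameN_normal l Oz)).
by rewrite subr0.
Qed.

(** The normal derivative of N vanishes, so differentiating the component of a
    normal field along N only differentiates the field. *)
Lemma derive_ip_unit X eta z : Om z -> differentiable eta z -> normal_at L z (eta z) ->
  'D_(X z) (fun y => ip (G (F y)) (N y) (eta y)) z = ip (G (F z)) (N z) (cov_perp L X eta z).
Proof.
move=> Oz deta neta; rewrite (cov_along_metric hL X Oz (dN Oz) deta) (ip_unit_nor _ Oz).
have -> : ip (G (F z)) (cov_along L X N z) (eta z) = 0; last by rewrite add0r.
rewrite (ipC _ _ (GS (FD Oz))) (normal_parseval _ Oz neta) sum_codim1.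
by rewrite (ip_cov_unit X Oz) mulr0.
Qed.

Lemma mean_curvE z : Om z -> Hs z = ip (G (F z)) (N z) (H0 z).
Proof.
move=> Oz; rewrite /mean_curv /mean_curv_vec ipZr ip_sumr; congr (_ * _).
by apply: eq_bigr => i _; rewrite /shape_op (ip_weingarten N (e i) Oz (de i Oz)).
Qed.

Lemma mean_curv_vecE z : Om z -> H0 z = Hs z *: N z.
Proof.
by move=> Oz; rewrite mean_curvE//; exact: normal_line Oz (mean_curv_normal Oz).
Qed.

Lemma cov_perp_mean_curv z : Om z -> cov_perp L V H0 z = 'D_(V z) Hs z *: N z.
Proof.
move=> Oz; rewrite {1}(normal_line Oz (nor_part_is_normal hL _ Oz) : cov_perp L V H0 z = _).
rewrite -(derive_ip_unit V Oz (mean_curv_differentiable Oz) (mean_curv_normal Oz)).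
have E : \near z, ip (G (F z)) (N z) (H0 z) = Hs z.
  by apply: (open_near_eq oOm Oz) => y; rewrite inE => Oy; rewrite mean_curvE.
by rewrite (near_eq_derive _ E).
Qed.

Lemma weingarten_mean_curv z : Om z -> weingarten L H0 V z = Hs z *: weingarten L N V z.
Proof.
move=> Oz; rewrite (@weingarten_sum _ [:: tt] (fun=> Hs z) (fun=> N)) ?big_seq1//.
by rewrite mean_curv_vecE.
Qed.

Lemma cov_mean_direction z : Om z -> cov G Ht Vt (F z) = Hs z *: cov G (nt l) Vt (F z).
Proof.
move=> Oz; rewrite !(covE _ _ (dVt Oz)) scaler_sumr; apply: eq_bigr => a _.
by rewrite (HE Oz) (mean_curv_vecE Oz) mxE scalerA.
Qed.

Lemma II_unit X Y z : Om z -> II L X Y z = h X Y z *: N z.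
Proof. by move=> Oz; exact: normal_line Oz (II_is_normal hL X Y Oz). Qed.

(** Since N has no normal derivative, differentiating II and taking components
    along N commute. *)
Lemma tr_covB_unit z : Om z -> tr_covB_II L e V z = div_sff L N e V z *: N z.
Proof.
move=> Oz; rewrite /div_sff scaler_suml; apply: eq_bigr => i _.
have -> : covB L (e i) (II L) (e i) V z =
    ip (G (F z)) (N z) (covB L (e i) (II L) (e i) V z) *: N z.
  exact: normal_line Oz (covB_II_normal Oz (se i) (se i) sV).
congr (_ *: _); have ipBB A (u a b c : 'rV[R]_(n + k)) : ip A u (a - b - c) = ip A u a - ip A u b - ip A u c.
  by rewrite !ipDr !ipNr.
apply: (etrans (ipBB _ _ _ _ _)).
have E := derive_ip_unit (e i) Oz (II_differentiable hL (se i) sV Oz) (II_is_normal hL (e i) V Oz).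
exact (congr1 (fun a => a - _ - _) (esym E)).
Qed.

(** The Codazzi equation in codimension one; the curvature term of N itself has no
    normal component by skewness. This is what makes the two expressions for the
    normal term agree. *)
Lemma nor_ric_vec z : Om z ->
  nor_part L z (Ricv (F z)) = (n%:R * 'D_(V z) Hs z - div_sff L N e V z) *: N z.
Proof.
move=> Oz; rewrite (ric_vec_split Oz) sum_codim1 nor_partE mulNmx mulmxDl -!nor_partE.
have -> : nor_part L z (curv G (nt l) Vt (nt l) (F z)) = 0.
  rewrite (nor_part_expansion _ Oz) sum_codim1.
  have -> : ip (G (F z)) (curv G (nt l) Vt (nt l) (F z)) (N z) = 0; last by rewrite scale0r.
  have := curv4_antisym34 hG (snt_smooth l) sVt (snt_smooth l) (snt_smooth l) (FD Oz).
  by rewrite /curv4 -/(frameN l z); move: (ip _ _ _) => a H; lra.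
rewrite nor_sum (sum_nor_curv Oz) (tr_covB_unit Oz) (cov_perp_mean_curv Oz).
have gen (a b c : R) (w : 'rV[R]_(n + k)) : - (a *: w - b *: (c *: w) + 0) = (b * c - a) *: w.
  by apply/rowP => j; rewrite !mxE; ring.
exact: gen.
Qed.

(** As |N| = 1 near the submanifold, the derivative of N along N is tangent, so
    the Gauss formula applies in that direction. *)
Lemma cov_cov_normal z : Om z ->
  let Z := fun y => tan_part L y (cov G (nt l) (nt l) (F y)) in
  cov G (cov G (nt l) (nt l)) Vt (F z) = push L (cov g Z V) z + h Z V z *: N z.
Proof.
move=> Oz Z; rewrite -(II_unit Z V Oz); apply: (cov_push_direction Oz).
have nor0 : nor_part L z (cov G (nt l) (nt l) (F z)) = 0.
  rewrite (nor_part_expansion _ Oz) sum_codim1.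
  have -> : ip (G (F z)) (cov G (nt l) (nt l) (F z)) (N z) = 0; last by rewrite scale0r.
  have := cov_metric (nt l) hG (snt_smooth l) (snt_smooth l) (FD Oz).
  have E : \forall y \near F z, ip (G y) (nt l y) (nt l y) = 1.
    have [oD _ _ _] := hG.
    by apply: (open_near_eq oD (FD Oz)) => y; rewrite inE => Dy; rewrite (nt_on l l Dy) eqxx.
  rewrite (near_eq_derive _ E) derive_cst (ipC (nt l (F z)) _ (GS (FD Oz))).
  have gen (a : R) : 0 = a + a -> a = 0 by move=> H; lra.
  exact: gen.
by move/subr0_eq: nor0.
Qed.

Lemma sum_II_principal z (kappa : 'I_n -> R) : Om z ->
  (forall i, shape_op L N (e i) z = kappa i *: e i z) ->
  \sum_i II L (e i) (cov g (e i) V) z =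
  (\sum_i kappa i * ip (g z) (cov g (e i) V z) (e i z)) *: N z.
Proof.
move=> Oz pk; rewrite scaler_suml; apply: eq_bigr => i _; rewrite (II_unit _ _ Oz).
have dc := smooth_differentiable oOm (cov_smooth hg (se i) sV) Oz.
rewrite /sff -(ip_weingarten N (e i) Oz dc) -/(shape_op L N (e i)) pk ipZl.
by rewrite (ipC (e i z) _ (gS Oz)).
Qed.

Lemma hodge_laplacian_hypersurface z (kappa : 'I_n -> R) : Om z ->
  let s := shape_op L N in
  let Z := fun z => tan_part L z (cov G (nt l) (nt l) (F z)) in
  (forall i, s (e i) z = kappa i *: e i z) ->
  let N5a :=
    - (2%:R * (\sum_(i < n) kappa i * ip (g z) (cov g (e i) V z) (e i z))
       + n%:R * 'D_(V z) Hs z - h Z V z) *: nt l (F z)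
    + 2%:R *: nor_part L z (Ricv (F z)) in
  let N5b :=
    - (div_sff L N e V z
       + 2%:R * (\sum_(i < n) kappa i * ip (g z) (cov g (e i) V z) (e i z))
       - h Z V z) *: nt l (F z)
    + nor_part L z (Ricv (F z)) in
  (hodge_laplacian D G Vt (F z) =
     push L (hodge_laplacian DM g V) z
     + 2%:R *: push L (s (s V)) z
     + (n%:R * Hs z) *: (cov G (nt l) Vt (F z) - push L (s V) z)
     + \sum_(i < n) curv4 G (nt l) (et i) Vt (nt l) (F z) *: et i (F z)
     - cov G (nt l) (cov G (nt l) Vt) (F z)
     + push L (cov g Z V) z
     + N5a)
  /\ N5a = N5b.
Proof.
move=> Oz s Z pk N5a N5b.
have N5E : N5a = N5b.
  rewrite /N5a /N5b (nor_ric_vec Oz) -/(frameN l z).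
  have gen (S DH h' dv : R) (w : 'rV[R]_(n + k)) :
      - (2%:R * S + DH - h') *: w + 2%:R *: ((DH - dv) *: w) =
      - (dv + 2%:R * S - h') *: w + (DH - dv) *: w.
    by apply/rowP => j; rewrite !mxE; ring.
  exact: gen.
split; last exact: N5E.
rewrite N5E /N5b (hodge_laplacian_submanifold Oz) !sum_codim1.
have pW : push L (weingarten L H0 V) z = Hs z *: push L (s V) z.
  by rewrite /push (weingarten_mean_curv Oz) -scalemxAl.
have gen (c H S h' dv : R) (a b f p q r t w x W C K T I : 'rV[R]_(n + k)) :
    W = H *: f -> C = H *: q -> K = t + h' *: w -> T = dv *: w -> I = S *: w ->
    a + b - c *: W + p + c *: C - r + K - T - 2%:R *: I + x =
    a + b + (c * H) *: (q - f) + p - r + t + (- (dv + 2%:R * S - h') *: w + x).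
  by move=> -> -> -> -> ->; apply/rowP => j; rewrite !mxE; ring.
exact: (gen _ _ _ _ _ _ _ _ _ _ _ _ _ _ _ _ _ _ _ pW (cov_mean_direction Oz)
  (cov_cov_normal Oz) (tr_covB_unit Oz) (sum_II_principal Oz pk)).
Qed.

End AdaptedFrame.

(** * From charts to the manifold *)

(** The image is the preimage of U under the inverse map, inside an open set. *)
Lemma open_image_section (S T : topologicalType) (A : set S) (f : S -> T) (f' : T -> S) U :
  open (f @` A) -> (forall q, A q -> f' (f q) = q) ->
  (forall q, A q -> {for f q, continuous f'}) -> open U -> open (f @` (A `&` U)).
Proof.
move=> ofA fK cf' oU; rewrite openE => _ [q [Aq Uq] <-].
have n1 : nbhs (f q) (f @` A) by apply: open_nbhs_nbhs; split => //; exists q.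
have n2 : nbhs (f q) (f' @^-1` U).
  by apply: (cf' q Aq); rewrite fK//; exact: open_nbhs_nbhs.
apply: filterS (filterI n1 n2) => _ [[q' Aq' <-]].
by rewrite /= fK// => Uq'; exists q'.
Qed.

Lemma open_chart_image {R : realType} m (M : manifold R m) (c : chart M) U :
  open U -> open (chart_image c U).
Proof.
move=> oU; exact: (open_image_section (@chart_map_open _ _ M c) (@chart_mapK _ _ M c)
  (@chart_inv_continuous _ _ M c) oU).
Qed.

Lemma metric_on_chart {R : realType} m (M : manifold R m) (g : field M 'M[R]_m) c U :
  riemannian_metric g -> open U -> metric_on (chart_image c U) (g c).
Proof.
move=> [sg _ symg posg] oU.
have sub : chart_image c U `<=` chart_image c setT by move=> _ [q [cq _] <-]; exists q.
split; first exact: open_chart_image.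
- by move=> r; exact: Cr_on_sub sub (sg c r).
- by move=> z /sub; exact: symg.
- by move=> z /sub; exact: posg.
Qed.

(** In charts an embedded submanifold is an isometric immersion, over the part of
    the chart that is mapped into U and into the ambient chart. *)
Lemma sub_on_charts {R : realType} n m (M : manifold R n) (Mt : manifold R m) (iota : M -> Mt)
    (gt : field Mt 'M[R]_m) (g : field M 'M[R]_n) (U : set Mt) b c :
  riemannian_metric gt -> embedding iota -> riemannian_metric g ->
  induced_metric iota gt g -> open U ->
  sub_on (in_charts iota gt g b c) (chart_image b (iota @^-1` (cdom c `&` U))) (chart_image c U).
Proof.
move=> hgt [_ ciota _ siota _] hg hind oU.
have sub : chart_image b (iota @^-1` (cdom c `&` U)) `<=` chart_image b (iota @^-1` cdom c).
  by move=> _ [q [bq [cq _]] <-]; exists q.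
split.
- refine (metric_on_chart b hg _); move/continuousP: ciota; apply.
  exact: openI (@cdom_open _ _ Mt c) oU.
- exact (metric_on_chart c hgt oU).
- by move=> r; exact: Cr_on_sub sub (siota b c r).
- move=> _ [q [bq [cq Uq]] <-]; exists (iota q) => //.
  by rewrite /= /local_rep /= (@chart_mapK _ _ M b q bq).
- by move=> z /sub; exact: hind.
Qed.

Lemma join_frame_app n k (I W : Type) (E : 'I_n -> I -> W) (N : 'I_k -> I -> W) c a :
  join_frame (fun i => E i c) (fun l => N l c) a = join_frame E N a c.
Proof. by rewrite /join_frame; case: fintype.split. Qed.

Theorem corollary1p20 (R : realType) (n k : nat)
  (hn : (2 <= n)%N) (hk : (1 <= k)%N)
  (* the ambient manifold, the submanifold and its induced metric *)
  (Mt : manifold R (n + k)) (gt : field Mt 'M[R]_(n + k))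
  (hgt : riemannian_metric gt)
  (M : manifold R n) (iota : M -> Mt) (hiota : embedding iota)
  (g : field M 'M[R]_n) (hg : riemannian_metric g)
  (hind : induced_metric iota gt g)
  (* the vector field on M, the point, the neighborhood and the extension *)
  (v : field M 'rV[R]_n) (hv : vector_field [set: M] v)
  (p : M)
  (U : set Mt) (hU : open U) (hUp : U (iota p))
  (vt : field Mt 'rV[R]_(n + k)) (hvt : vector_field U vt)
  (hvvt : extends_field iota gt g U v vt)
  (* the adapted orthonormal frame: E on M, its extension Et, and Nt *)
  (E : 'I_n -> field M 'rV[R]_n)
  (hE : forall i, vector_field (iota @^-1` U) (E i))
  (Et : 'I_n -> field Mt 'rV[R]_(n + k))
  (hEEt : forall i, extends_field iota gt g U (E i) (Et i))
  (Nt : 'I_k -> field Mt 'rV[R]_(n + k))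
  (hON : orthonormal_frame gt U (join_frame Et Nt))
  (* the extension of the mean curvature vector *)
  (Ht : field Mt 'rV[R]_(n + k)) (hHt : vector_field U Ht)
  (hHHt : extends_along iota U
     (fun b c => mean_curv_vec (in_charts iota gt g b c) (fun i => E i b)) Ht)
  (* charts around p and iota p *)
  (b : chart M) (hb : cdom b p) (c : chart Mt) (hc : cdom c (iota p)) :
  let L := in_charts iota gt g b c in
  let x := chart_map b p in
  let y := chart_map c (iota p) in
  let G := gt c in
  let gM := g b in
  let V := v b in
  let Vt := vt c in
  let e := fun i => E i b in
  let et := fun i => Et i c in
  let nt := fun l => Nt l c in
  let N := fun l => nt l \o lmap L in
  let H := mean_curv_vec L e in
  let Ricv := ric_vec G (join_frame et nt) Vt in
  let lap := hodge_laplacian (chart_image b [set: M]) gM V in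
  let lapt := hodge_laplacian (chart_image c U) G Vt in
  (lapt y =
     push L lap x
     + 2%:R *: \sum_(l < k) push L (weingarten L (N l) (weingarten L (N l) V)) x
     - (2%:R * n%:R) *: push L (weingarten L H V) x
     + \sum_(l < k) \sum_(i < n)
         ip (G y) (curv G (nt l) (et i) Vt y) (nt l y) *: et i y
     + n%:R *: bracket (Ht c) Vt y
     - \sum_(l < k) cov G (nt l) (cov G (nt l) Vt) y
     + \sum_(l < k) cov G (cov G (nt l) (nt l)) Vt y
     - 2%:R *: \sum_(i < n) II L (e i) (cov gM (e i) V) x
     - \sum_(i < n) nor_part L x (curv G (et i) Vt (et i) y)
     + nor_part L x (Ricv y))
  /\
  (lapt y =
     push L lap x
     + 2%:R *: \sum_(l < k) push L (weingarten L (N l) (weingarten L (N l) V)) x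
     - n%:R *: push L (weingarten L H V) x
     + \sum_(l < k) \sum_(i < n)
         ip (G y) (curv G (nt l) (et i) Vt y) (nt l y) *: et i y
     + n%:R *: cov G (Ht c) Vt y
     - \sum_(l < k) cov G (nt l) (cov G (nt l) Vt) y
     + \sum_(l < k) cov G (cov G (nt l) (nt l)) Vt y
     - tr_covB_II L e V x
     - 2%:R *: \sum_(i < n) II L (e i) (cov gM (e i) V) x
     + nor_part L x (Ricv y))
  /\
  (k = 1%N -> forall (l : 'I_k) (kappa : 'I_n -> R),
     let s := shape_op L (N l) in
     let h := sff L (N l) in
     let Hs := mean_curv L (N l) e in
     (* the vector field (tilde nabla_N N)|_M on M, tangent as |N| = 1 *)
     let Z := fun z => tan_part L z (cov G (nt l) (nt l) (lmap L z)) in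
     (forall i, s (e i) x = kappa i *: e i x) ->
     let N5a :=
       - (2%:R * (\sum_(i < n) kappa i * ip (gM x) (cov gM (e i) V x) (e i x))
          + n%:R * 'D_(V x) Hs x - h Z V x) *: nt l y
       + 2%:R *: nor_part L x (Ricv y) in
     let N5b :=
       - (div_sff L (N l) e V x
          + 2%:R * (\sum_(i < n) kappa i * ip (gM x) (cov gM (e i) V x) (e i x))
          - h Z V x) *: nt l y
       + nor_part L x (Ricv y) in
     (lapt y =
        push L lap x
        + 2%:R *: push L (s (s V)) x
        + (n%:R * Hs x) *: (cov G (nt l) Vt y - push L (s V) x)
        + \sum_(i < n) curv4 G (nt l) (et i) Vt (nt l) y *: et i y
        - cov G (nt l) (cov G (nt l) Vt) y
        + push L (cov gM Z V) x
        + N5a)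
     /\ N5a = N5b).
Proof.
move=> L x y G gM V Vt e et nt N H Ricv lap lapt.
(* the part of the chart b that is mapped into U and into the chart c *)
pose Om := chart_image b (iota @^-1` (cdom c `&` U)); pose D := chart_image c U.
have hL : sub_on L Om D := sub_on_charts b c hgt hiota hg hind hU.
have xE : chart_inv b x = p := chart_mapK hb.
have Ox : Om x by exists p.
have yE : y = lmap L x by rewrite /L /= /local_rep /= xE.
have OmM : Om `<=` chart_image b [set: M] by move=> _ [q [bq _] <-]; exists q.
have OmU : Om `<=` chart_image b (iota @^-1` U) by move=> _ [q [bq [_ Uq]] <-]; exists q.
have hgM : metric_on (chart_image b [set: M]) (lind L) := metric_on_chart b hg openT.
have se i : smooth_on Om (e i) by move=> r; exact: Cr_on_sub OmU ((hE i).1 b r).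
have sF a : smooth_on D (join_frame et nt a).
  by rewrite join_frame_app; exact: (hON.1 a).1 c.
have on z : D z -> forall a a', ip (G z) (join_frame et nt a z) (join_frame et nt a' z) = (a == a')%:R.
  by move=> Dz a a'; rewrite !join_frame_app; exact: hON.2 c z Dz a a'.
have eE i z : Om z -> et i (lmap L z) = push L (e i) z by exact: hEEt.
have HE z : Om z -> Ht c (lmap L z) = mean_curv_vec L e z by exact: hHHt.
have VE z : Om z -> Vt (lmap L z) = push L V z by exact: hvvt.
have n0 : (0 < n)%N := ltnW hn.
have sV := hv.1 b; have sVt := hvt.1 c; have sHt := hHt.1 c.
split; first by rewrite yE; exact: (hodge_laplacian_submanifold_bracket hL se sF on eE sHt HE n0 hgM OmM sV sVt VE Ox).
split; first by rewrite yE; exact: (hodge_laplacian_submanifold hL se sF on eE HE n0 hgM OmM sV sVt VE Ox).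
move=> k1 l kappa; rewrite yE.
exact: (hodge_laplacian_hypersurface hL se sF on eE HE n0 hgM OmM sV sVt VE k1 (l := l) (kappa := kappa) Ox).
Qed.
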